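(* Let $a,b>0$ be constants with $a+b<\tfrac12$. There exists $\varepsilon_0>0$ such that for every fixed $0<\varepsilon<\varepsilon_0$ the following holds. Consider data $m,n,\boldsymbol{s},\boldsymbol{t},H$ (as in the context) with $m,n\to\infty$, such that, uniformly over $1\le j\le m$, $1\le k\le n$: $s_j-s$, $x_j$, $t_k-t$ and $y_k$ are $O(n^{1/2+\varepsilon})$; $X=O(n^{1+2\varepsilon})$; $n=o(m^{1+\varepsilon})$ and $m=o(n^{1+\varepsilon})$; and \[ \frac{(1-2\lambda)^2}{8A}\Bigl(1+\frac{5m}{6n}+\frac{5n}{6m}\Bigr)\le a\log n. \] Then \[ |\mathcal{B}(\boldsymbol{s},\boldsymbol{t},H)| = \binom{mn-X}{\lambda mn}^{-1}\prod_{j=1}^m\binom{n-x_j}{s_j}\prod_{k=1}^n\binom{m-y_k}{t_k}\,\exp\Bigl(-\frac12\Bigl(1-\frac{R}{2Amn}\Bigr)\Bigl(1-\frac{C}{2Amn}\Bigr)-\frac{Y}{2Amn}+O(n^{-b})\Bigr). \]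
   Context: Let $\boldsymbol{s}=(s_1,\dots,s_m)$ and $\boldsymbol{t}=(t_1,\dots,t_n)$ be vectors of positive integers with $\sum_j s_j=\sum_k t_k$. $\mathcal{B}(\boldsymbol{s},\boldsymbol{t})$ is the set of simple bipartite graphs on vertex set $\{u_1,\dots,u_m\}\cup\{v_1,\dots,v_n\}$ (all edges join some $u_j$ to some $v_k$) in which $u_j$ has degree $s_j$ and $v_k$ has degree $t_k$ for all $j,k$ (equivalently $m\times n$ 0-1 matrices with row sums $\boldsymbol{s}$ and column sums $\boldsymbol{t}$). $H$ is a fixed bipartite graph on the same vertex set (edges only between $u$'s and $v$'s); $x_j$ and $y_k$ are the degrees of $u_j$ and $v_k$ in $H$. $\mathcal{B}(\boldsymbol{s},\boldsymbol{t},H)$ is the set of graphs in $\mathcal{B}(\boldsymbol{s},\boldsymbol{t})$ that are edge-disjoint from $H$. Define $s=m^{-1}\sum_j s_j$, $t=n^{-1}\sum_k t_k$, $\lambda=s/n=t/m$, $A=\tfrac12\lambda(1-\lambda)$, $\delta_j=s_j-s+\lambda x_j$, $\eta_k=t_k-t+\lambda y_k$, $X=\sum_j x_j=\sum_k y_k$, $Y=\sum_{u_jv_k\in E(H)}\delta_j\eta_k$, $R=\sum_{j=1}^m(s_j-s)^2$, $C=\sum_{k=1}^n(t_k-t)^2$. All asymptotic notation refers to $m,n\to\infty$; constants implicit in the hypotheses are arbitrary but fixed. *)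

(* Defs.v *)
From HB Require Import structures.
From mathcomp Require Import all_boot all_order all_algebra.
From mathcomp Require Import all_classical all_reals all_analysis.
Set Implicit Arguments. Unset Strict Implicit. Unset Printing Implicit Defensive.
Import Order.TTheory GRing.Theory Num.Theory.
Local Open Scope ring_scope.

(* Data (m, n, s, t, H).  Vertices u_j are 'I_m, v_k are 'I_n;
   H is given by its (bipartite) adjacency relation  H j k <=> u_j v_k in E(H). *)
Record bdata := BData {
  bm : nat;
  bn : nat;
  bs : 'I_bm -> nat;
  bt : 'I_bn -> nat;
  bH : 'I_bm -> 'I_bn -> bool }.
Arguments bs : clear implicits.
Arguments bt : clear implicits.
Arguments bH : clear implicits.

(* A bipartite graph on {u_j} u {v_k} with edges only between the sides,
   encoded by its biadjacency 0-1 matrix G (j,k). *)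
Definition bigraph (D : bdata) := {ffun 'I_(bm D) * 'I_(bn D) -> bool}.

Definition in_BstH (D : bdata) (G : bigraph D) : bool :=
  [forall j, #|[set k | G (j, k)]| == bs D j] &&
  [forall k, #|[set j | G (j, k)]| == bt D k] &&
  [forall j, forall k, G (j, k) ==> ~~ bH D j k].

Definition card_BstH (D : bdata) : nat := #|[set G : bigraph D | in_BstH G]|.

Definition hx (D : bdata) (j : 'I_(bm D)) : nat := #|[set k | bH D j k]|.
Definition hy (D : bdata) (k : 'I_(bn D)) : nat := #|[set j | bH D j k]|.
Definition hX (D : bdata) : nat := (\sum_(j < bm D) hx j)%N.
(* total number of edges  sum_j s_j  ( = lambda m n ) *)
Definition stot (D : bdata) : nat := (\sum_(j < bm D) bs D j)%N.
Definition ttot (D : bdata) : nat := (\sum_(k < bn D) bt D k)%N.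

Section Quantities.
Variable R : realType.
Variable D : bdata.
Local Notation m := (bm D).
Local Notation n := (bn D).

Definition savg : R := (stot D)%:R / m%:R.
Definition tavg : R := (ttot D)%:R / n%:R.
Definition lam : R := savg / n%:R.
Definition AA : R := 2^-1 * lam * (1 - lam).
Definition dlt (j : 'I_m) : R := (bs D j)%:R - savg + lam * (hx j)%:R.
Definition eta (k : 'I_n) : R := (bt D k)%:R - tavg + lam * (hy k)%:R.
Definition YY : R := \sum_(j < m) \sum_(k < n | bH D j k) dlt j * eta k.
Definition RR : R := \sum_(j < m) ((bs D j)%:R - savg) ^+ 2.
Definition CC : R := \sum_(k < n) ((bt D k)%:R - tavg) ^+ 2.

Definition main_term : R :=
  ('C(m * n - hX D, stot D))%:R^-1
  * \prod_(j < m) ('C(n - hx j, bs D j))%:R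
  * \prod_(k < n) ('C(m - hy k, bt D k))%:R.

Definition exponent_term : R :=
  - 2^-1 * (1 - RR / (2 * AA * m%:R * n%:R)) * (1 - CC / (2 * AA * m%:R * n%:R))
  - YY / (2 * AA * m%:R * n%:R).
End Quantities.

(* Main.v *)
(* Work with the uniform measure on the graphs avoiding H.  Exchanging, within two columns k and l,
   two rows on which these columns differ is an involution; it gives the exact identity
   P(jk) - P(jl) = E[free_j * diff / nfree], where free_j says that row j differs in the columns k
   and l (off H), nfree counts such rows and diff is the signed count.  Exchangeable pairs give a
   fourth moment bound for nfree, and inserting cell probabilities known to some order into the
   identity, then averaging over a row, yields them to the next order, up to O~(n^(-3/2)).
   Consequently adding one edge to H changes log(|B(s,t,H)| / formula) by O~(n^(-3/2)) only, and
   H has O~(n) edges, so H may be taken empty.  For H empty, moving a unit between two columns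
   changes the count by a ratio of mean codegrees; along such moves a corrected log-ratio
   telescopes, so the log-ratio is constant up to O~(n^(-1/2)) over all column vectors near the
   average, and by transposition over all row vectors.  The constant is found by summing over the
   column vectors for one row vector with R close to lambda (1 - lambda) m n, where the
   exponential factor is trivial and Chernoff bounds show that atypical column vectors are
   negligible. *)
Require Import Defs.
From HB Require Import structures.
From mathcomp Require Import all_boot all_order all_algebra all_fingroup.
From mathcomp Require Import ring lra zify.
Set Implicit Arguments. Unset Strict Implicit. Unset Printing Implicit Defensive.
Import Order.TTheory GRing.Theory Num.Theory.
Local Open Scope ring_scope.

(** * Orders of magnitude *)

(** The accuracy n^(-b), with b allowed close to 1/2, decides how far each expansion goes. With u =
    sqrt n, the graph H has O~(u^2) edges and the total error may be about u^-1, so every cell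
    probability is required up to O~(u^-3), two orders beyond the bare density. In the exact
    identity the random denominator [nfree] may be small or even 0. There the quotient is merely
    bounded by 1, and the event is paid for by the fourth moment of the relative deviation, which is
    O~(u^-4); a second moment would give only u^-2. Changing column sums takes up to O~(u^3) unit
    moves (u^2 columns, O~(u) units each), so a move may cost O~(u^-4), whereas codegrees known up
    to u^-1 out of u^2 yield u^-3; the correction of the log-ratio gains this missing factor. The
    density [lam] stays fixed while cells are exposed, so that predictions for different instances
    can be compared. All factors n^eps and log n are counted as powers of one [w]; the largest power
    reached determines how small eps must be. *)

Section Magnitude.
Context {R : realFieldType} (w u : R).
Hypotheses (w_ge : 16%:R <= w) (u_ge1 : 1 <= u).

(* [bd k e x] reads [x = O~(u ^ e)], with [u = sqrt n] and the hidden factor a power of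
   [w = n ^ (3 * eps)]; constants up to 16 are absorbed in one more factor [w]. *)
Definition bd (k : nat) (e : int) (x : R) : Prop := `|x| <= w ^+ k * u ^ e.

Lemma w_ge1 : 1 <= w. Proof. by apply: le_trans w_ge; rewrite ler1n. Qed.
Lemma u_gt0 : 0 < u. Proof. exact: lt_le_trans u_ge1. Qed.
Lemma w_gt0 : 0 < w. Proof. exact: lt_le_trans w_ge1. Qed.
Lemma ue_gt0 e : 0 < u ^ e. Proof. by rewrite exprz_gt0 ?u_gt0. Qed.
Lemma we_gt0 e : 0 < w ^+ e. Proof. by rewrite exprn_gt0 ?w_gt0. Qed.
Lemma ue_ge0 e : 0 <= u ^ e. Proof. exact: ltW (ue_gt0 e). Qed.
Lemma we_ge0 e : 0 <= w ^+ e. Proof. exact: ltW (we_gt0 e). Qed.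

Lemma bd_le k1 (e1 : int) k2 (e2 : int) x : bd k1 e1 x -> (k1 <= k2)%N -> e1 <= e2 -> bd k2 e2 x.
Proof using w_ge u_ge1.
move=> h hk he; apply: le_trans h _; apply: ler_pM; rewrite ?we_ge0 ?ue_ge0 //.
  exact: (ler_weXn2l w_ge1).
exact: (ler_weXz2l u_ge1).
Qed.

Lemma bdN k e x : bd k e x -> bd k e (- x).
Proof using w_ge u_ge1. by rewrite /bd normrN. Qed.

Lemma bd_norm k e x : bd k e x -> bd k e `|x|.
Proof using w_ge u_ge1. by rewrite /bd normr_id. Qed.

Lemma bdD k1 e1 k2 e2 x y : bd k1 e1 x -> bd k2 e2 y ->
  bd (maxn k1 k2).+1 (Order.max e1 e2) (x + y).
Proof using w_ge u_ge1.
move=> hx hy; set k := maxn _ _; set e := Order.max _ _.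
have hx' : bd k e x by apply: bd_le hx _ _; rewrite ?leq_maxl // le_max lexx.
have hy' : bd k e y by apply: bd_le hy _ _; rewrite ?leq_maxr // le_max lexx orbT.
apply: le_trans (ler_normD _ _) _; apply: le_trans (lerD hx' hy') _.
rewrite -mulr2n -mulr_natl exprS -mulrA ler_wpM2r ?mulr_ge0 ?we_ge0 ?ue_ge0 //.
by apply: le_trans w_ge; rewrite ler_nat.
Qed.

Lemma bdB k1 e1 k2 e2 x y : bd k1 e1 x -> bd k2 e2 y ->
  bd (maxn k1 k2).+1 (Order.max e1 e2) (x - y).
Proof using w_ge u_ge1. by move=> hx /bdN; apply: bdD. Qed.

Lemma bdM k1 e1 k2 e2 x y : bd k1 e1 x -> bd k2 e2 y -> bd (k1 + k2) (e1 + e2) (x * y).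
Proof using w_ge u_ge1.
move=> hx hy; rewrite /bd normrM exprD expfzDr ?gt_eqF ?u_gt0 // mulrACA.
by apply: ler_pM.
Qed.

Lemma bdX k e x i : bd k e x -> bd (k * i) (e * i%:Z) (x ^+ i).
Proof using w_ge u_ge1.
by move=> h; rewrite /bd normrX exprM -exprz_exp -exprnP -exprMn lerXn2r // ?nnegrE ?mulr_ge0 ?we_ge0 ?ue_ge0.
Qed.

(** Zero has every order. The exponent -100 lies below all that occur, so that in a sum the other
    summand decides. *)
Lemma bd0 : bd 0 (-100)%Z 0.
Proof using w_ge u_ge1. by rewrite /bd normr0 mulr_ge0 ?we_ge0 ?ue_ge0. Qed.

Lemma bd1 : bd 0 0 1.
Proof using w_ge u_ge1. by rewrite /bd normr1 mul1r. Qed.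

Lemma bd_natr c : (c <= 16)%N -> bd 1 0 c%:R.
Proof using w_ge u_ge1. by move=> h; rewrite /bd normr_nat expr1 mulr1; apply: le_trans w_ge; rewrite ler_nat. Qed.

Lemma bd_natinv c : bd 0 0 (c%:R^-1).
Proof using w_ge u_ge1.
rewrite /bd mul1r expr0z normfV normr_nat; case: c => [|c]; first by rewrite invr0.
by rewrite invf_le1 ?ltr0n // ler1n.
Qed.

Lemma bd_bool (b : bool) : bd 0 0 b%:R.
Proof using w_ge u_ge1. by case: b; [exact: bd1 | apply: bd_le bd0 _ _]. Qed.

Lemma bd_le1 x : `|x| <= 1 -> bd 0 0 x.
Proof using w_ge u_ge1. by rewrite /bd mul1r. Qed.

Lemma bd_norm_le k e x y : `|x| <= y -> bd k e y -> bd k e x.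
Proof using w_ge u_ge1. by move=> h hy; apply: le_trans h _; apply: le_trans (ler_norm _) hy. Qed.

Lemma bd_lin3 p e x y z : bd p e x -> bd p e y -> bd p e z -> bd (p + 3) e (x + y - 2 * z).
Proof using w_ge u_ge1.
move=> hx hy hz; have h2 := bdM (bd_natr (isT : (2 <= 16)%N)) hz.
apply: (bd_le (bdB (bdD hx hy) h2)); first by lia.
by rewrite add0r !maxxx.
Qed.

Lemma bd_sum (I : finType) (P : pred I) k e k' e' (F : I -> R) :
  bd k' e' (#|P|)%:R -> (forall i, P i -> bd k e (F i)) ->
  bd (k' + k) (e' + e) (\sum_(i | P i) F i).
Proof using w_ge u_ge1.
move=> hP hF; apply: le_trans (ler_norm_sum _ _ _) _.
apply: (@le_trans _ _ (\sum_(i | P i) w ^+ k * u ^ e)); first exact: ler_sum.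
rewrite sumr_const -mulr_natl exprD expfzDr ?gt_eqF ?u_gt0 // mulrACA.
by rewrite ler_wpM2r ?mulr_ge0 ?we_ge0 ?ue_ge0 //; apply: le_trans (ler_norm _) hP.
Qed.

End Magnitude.


Ltac wu := assumption.
(* [bdauto] proves [bd k e x] by recursion on the expression [x], from the bounds in the
   context and those that [bdatom] knows. *)
Ltac bdatom x := fail.
Ltac bdleaf := solve [ match goal with H : bd _ _ _ _ ?y |- bd _ _ _ _ ?x => constr_eq x y; exact H end
  | match goal with H : forall i, bd _ _ _ _ _ |- bd _ _ _ _ _ => apply: H end
  | match goal with |- bd _ _ _ _ ?x => bdatom x end ].
Ltac bdap2 lem x y := match goal with W : is_true (_ <= ?w), U : is_true (_ <= ?u) |- bd ?w ?u _ _ _ =>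
  eapply (lem _ _ _ W U _ _ _ _ x y) end.
Ltac bdap1 lem x := match goal with W : is_true (_ <= ?w), U : is_true (_ <= ?u) |- bd ?w ?u _ _ _ =>
  eapply (lem _ _ _ W U _ _ x) end.
Ltac bdt := first [ bdleaf |
  lazymatch goal with
  | |- bd _ _ _ _ (?x + - ?y) => bdap2 @bdB x y; [bdt|bdt]
  | |- bd _ _ _ _ (?x + ?y) => bdap2 @bdD x y; [bdt|bdt]
  | |- bd _ _ _ _ (- ?x) => bdap1 @bdN x; bdt
  | |- bd _ _ _ _ (`| ?x |) => bdap1 @bd_norm x; bdt
  | |- bd _ _ _ _ 0 => eapply bd0; wu
  | |- bd _ _ _ _ 1 => eapply bd1; wu
  | |- bd _ _ _ _ (_ *+ (nat_of_bool ?b)) => match goal with W : is_true (_ <= ?w), U : is_true (_ <= ?u) |- bd ?w ?u _ _ _ => eapply (bd_bool W U b) end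
  | |- bd _ _ _ _ (1 *+ ?c) => match goal with W : is_true (_ <= ?w), U : is_true (_ <= ?u) |- bd ?w ?u _ _ _ => eapply (@bd_natr _ _ _ W U c); by [] end
  | |- bd _ _ _ _ (?x * ?y) => bdap2 @bdM x y; [bdt|bdt]
  | |- bd _ _ _ _ (?x ^+ ?i) => match goal with W : is_true (_ <= ?w), U : is_true (_ <= ?u) |- bd ?w ?u _ _ _ => eapply (@bdX _ _ _ W U _ _ x i); bdt end
  end ].
Ltac bdauto := eapply bd_le; [wu|wu|bdt|by vm_compute|by vm_compute].

(** * Random bipartite graphs with given degrees *)

(** Degrees and forbidden cells are data of their own, since exposing a cell changes them while [m]
    and [n] stay. *)
Record inst (m n : nat) := Inst {
  rs : 'I_m -> nat;
  cs : 'I_n -> nat;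
  forb : {set 'I_m * 'I_n} }.

Section Graphs.
Context {m n : nat}.
Notation graph := {ffun 'I_m * 'I_n -> bool}.
Notation inst := (inst m n).
Implicit Types (I : inst) (G : graph) (e : 'I_m * 'I_n).

Definition graphs I : {set graph} := [set G : graph |
  [&& [forall j, (\sum_k G (j, k) == rs I j)%N],
      [forall k, (\sum_j G (j, k) == cs I k)%N] &
      [forall e, (e \in forb I) ==> ~~ G e]]].

Lemma graphsP I G : reflect
  [/\ forall j, (\sum_k G (j, k) = rs I j)%N, forall k, (\sum_j G (j, k) = cs I k)%N &
      forall e, e \in forb I -> G e = false] (G \in graphs I).
Proof.
rewrite inE; apply: (iffP and3P) => -[h1 h2 h3]; split.
- by move=> j; apply/eqP/(forallP h1).
- by move=> k; apply/eqP/(forallP h2).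
- by move=> e he; have := forallP h3 e; rewrite he => /negbTE.
- by apply/forallP => j; rewrite h1.
- by apply/forallP => j; rewrite h2.
- by apply/forallP => e; apply/implyP => /h3 ->.
Qed.

Definition setcell (b : bool) e G : graph := [ffun e' => if e' == e then b else G e'].

(* the instance left to the other cells when the cell [e] is occupied *)
Definition occ I e : inst := Inst (fun i => (rs I i - (i == e.1))%N)
  (fun i => (cs I i - (i == e.2))%N) (e |: forb I).

Definition emp I e : inst := Inst (rs I) (cs I) (e |: forb I).

Lemma setcellK b e G : G e = b -> forall c, setcell b e (setcell c e G) = G.
Proof. by move=> h c; apply/ffunP => e'; rewrite !ffunE; case: eqP => // ->. Qed.

Lemma sum_row_setcell b e G j :
  (\sum_k setcell b e G (j, k) + (j == e.1) * G e = \sum_k G (j, k) + (j == e.1) * b)%N.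
Proof.
case: e => j0 k0 /=; case: (eqVneq j j0) => [->|ne]; last first.
  by rewrite !mul0n !addn0; apply: eq_bigr => k _; rewrite ffunE xpair_eqE (negbTE ne).
rewrite (bigD1 k0) //= [in RHS](bigD1 k0) //= ffunE eqxx.
under eq_bigr => k hk do rewrite ffunE xpair_eqE (negbTE hk) andbF.
by rewrite !mul1n; lia.
Qed.

Lemma sum_col_setcell b e G k :
  (\sum_j setcell b e G (j, k) + (k == e.2) * G e = \sum_j G (j, k) + (k == e.2) * b)%N.
Proof.
case: e => j0 k0 /=; case: (eqVneq k k0) => [->|ne]; last first.
  by rewrite !mul0n !addn0; apply: eq_bigr => j _; rewrite ffunE xpair_eqE (negbTE ne) andbF.
rewrite (bigD1 j0) //= [in RHS](bigD1 j0) //= ffunE eqxx.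
under eq_bigr => j hj do rewrite ffunE xpair_eqE (negbTE hj) andFb.
by rewrite !mul1n; lia.
Qed.

(** Deleting the cell [e] and refilling it are inverse bijections. The degrees at [e] are taken
    positive because the subtraction in [occ] is truncated. *)
Lemma graphs_occ I e G : e \notin forb I -> (0 < rs I e.1)%N -> (0 < cs I e.2)%N ->
  (G \in graphs I) && G e = (setcell false e G \in graphs (occ I e)) && (setcell true e G == G).
Proof.
move=> he hr hc.
have -> : (setcell true e G == G) = G e.
  apply/eqP/idP => [<-|h]; first by rewrite ffunE eqxx.
  by apply/ffunP => e'; rewrite ffunE; case: eqP => // ->.
case hG: (G e); rewrite ?andbF // !andbT.
apply/graphsP/graphsP => -[h1 h2 h3]; split => /=.
- move=> j; have := sum_row_setcell false e G j; rewrite h1 hG; case: eqP => [->|_] /=; lia.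
- move=> k; have := sum_col_setcell false e G k; rewrite h2 hG; case: eqP => [->|_] /=; lia.
- by move=> e'; rewrite in_setU1 ffunE; case: eqP => //= _ /h3.
- move=> j; have := sum_row_setcell false e G j; rewrite h1 hG /=.
  by case: eqP => [->|_] /=; lia.
- move=> k; have := sum_col_setcell false e G k; rewrite h2 hG /=.
  by case: eqP => [->|_] /=; lia.
- move=> e' h; have := h3 e'; rewrite in_setU1 h orbT ffunE => /(_ isT).
  by case: eqP => // E; rewrite E (negbTE he) in h.
Qed.

Lemma graphs_emp I e G : (G \in graphs (emp I e)) = (G \in graphs I) && ~~ G e.
Proof.
apply/graphsP/andP => [[h1 h2 h3]|[/graphsP[h1 h2 h3] hG]].
  split; last by rewrite h3 // in_setU1 eqxx.
  by apply/graphsP; split=> // e' h; apply: h3; rewrite in_setU1 h orbT.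
by split=> //= e'; rewrite in_setU1 => /orP[/eqP ->|/h3 //]; apply/negbTE.
Qed.

Section Mean.
Context {R : realFieldType}.
Implicit Types f g : graph -> R.

(** If there is no graph the value is 0, by the convention that 0 has inverse 0. *)
Definition mean I f : R := (\sum_(G in graphs I) f G) / #|graphs I|%:R.
Definition nonempty I := (0 < #|graphs I|)%N.

Lemma eq_mean I f g : (forall G, G \in graphs I -> f G = g G) -> mean I f = mean I g.
Proof. by move=> h; rewrite /mean; congr (_ / _); apply: eq_bigr. Qed.

Lemma meanD I f g : mean I (fun G => f G + g G) = mean I f + mean I g.
Proof. by rewrite /mean big_split mulrDl. Qed.

Lemma meanN I f : mean I (fun G => - f G) = - mean I f.
Proof. by rewrite /mean sumrN mulNr. Qed.

Lemma meanB I f g : mean I (fun G => f G - g G) = mean I f - mean I g.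
Proof. by rewrite meanD meanN. Qed.

Lemma meanZ I (c : R) f : mean I (fun G => c * f G) = c * mean I f.
Proof. by rewrite /mean -mulr_sumr mulrA. Qed.

Lemma meanZr I (c : R) f : mean I (fun G => f G * c) = mean I f * c.
Proof. by rewrite mulrC -meanZ; apply: eq_mean => G _; rewrite mulrC. Qed.

Lemma mean_sum I (J : finType) (P : pred J) (F : J -> graph -> R) :
  mean I (fun G => \sum_(i | P i) F i G) = \sum_(i | P i) mean I (F i).
Proof. by rewrite /mean exchange_big mulr_suml. Qed.

Lemma mean_cst I (c : R) : nonempty I -> mean I (fun=> c) = c.
Proof.
move=> h; rewrite /mean sumr_const -[c *+ _]mulr_natr -mulrA mulfV ?mulr1 //.
by rewrite pnatr_eq0 -lt0n.
Qed.

Lemma ler_mean I f g : (forall G, G \in graphs I -> f G <= g G) -> mean I f <= mean I g.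
Proof. by move=> h; rewrite /mean ler_wpM2r ?invr_ge0 ?ler0n //; apply: ler_sum. Qed.

Lemma mean_ge0 I f : (forall G, G \in graphs I -> 0 <= f G) -> 0 <= mean I f.
Proof. by move=> h; rewrite /mean mulr_ge0 ?invr_ge0 ?ler0n //; apply: sumr_ge0. Qed.

Lemma ler_norm_mean I f : `|mean I f| <= mean I (fun G => `|f G|).
Proof.
rewrite /mean normrM (ger0_norm (_ : 0 <= _^-1)) ?invr_ge0 ?ler0n // ler_wpM2r ?invr_ge0 ?ler0n //.
exact: ler_norm_sum.
Qed.

Lemma mean_le_cst I f (c : R) : 0 <= c -> (forall G, G \in graphs I -> f G <= c) -> mean I f <= c.
Proof.
move=> c0 h; case: (posnP #|graphs I|) => [h0|h0]; first by rewrite /mean h0 invr0 mulr0.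
by apply: le_trans (ler_mean h) _; rewrite mean_cst.
Qed.

Lemma mean_norm_le1 I f : (forall G, G \in graphs I -> `|f G| <= 1) -> `|mean I f| <= 1.
Proof.
by move=> h; apply: le_trans (ler_norm_mean _ _) _; apply: mean_le_cst.
Qed.

Definition Pr I e : R := mean I (fun G => (G e)%:R).

Lemma Pr_forb I e : e \in forb I -> Pr I e = 0.
Proof.
move=> h; rewrite /Pr (@eq_mean _ _ (fun=> 0)); last by move=> G /graphsP[_ _ ->].
by rewrite /mean big1 ?mul0r.
Qed.

Lemma sum_row_Pr I j : nonempty I -> \sum_k Pr I (j, k) = (rs I j)%:R.
Proof.
move=> h; rewrite -mean_sum (@eq_mean _ _ (fun=> (rs I j)%:R)) ?mean_cst //.
by move=> G /graphsP[<- _ _]; rewrite natr_sum.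
Qed.

Lemma sum_occ I e (g : graph -> R) : e \notin forb I -> (0 < rs I e.1)%N -> (0 < cs I e.2)%N ->
  (forall G, g (setcell true e G) = g G) ->
  \sum_(G in graphs I) (G e)%:R * g G = \sum_(G in graphs (occ I e)) g G.
Proof.
move=> he hr hc hg; rewrite (bigID (fun G => G e)) /= [X in _ + X]big1 ?addr0; last first.
  by move=> G /andP[_ /negbTE ->]; rewrite mul0r.
transitivity (\sum_(G in graphs I | G e) g G).
  by apply: eq_bigr => G /andP[_ ->]; rewrite mul1r.
rewrite (reindex_onto (setcell true e) (setcell false e)) /=; last first.
  by move=> G /andP[_ hG]; apply: setcellK.
apply: eq_big => [G|G _]; last exact: hg.
rewrite graphs_occ // .
have -> : setcell true e (setcell true e G) = setcell true e G.
  by apply/ffunP => e'; rewrite !ffunE; case: eqP.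
rewrite eqxx andbT; case: (eqVneq (setcell false e (setcell true e G)) G) => [->|ne].
  by rewrite andbT.
rewrite andbF; symmetry; apply/negbTE/negP => /graphsP[_ _ /(_ e)].
by rewrite in_setU1 eqxx => /(_ isT) hG; rewrite setcellK ?eqxx in ne.
Qed.

Lemma card_occ I e : e \notin forb I -> (0 < rs I e.1)%N -> (0 < cs I e.2)%N ->
  #|graphs (occ I e)|%:R = \sum_(G in graphs I) (G e)%:R :> R.
Proof.
move=> he hr hc; have := @sum_occ I e (fun=> 1) he hr hc (fun=> erefl); rewrite sumr_const => <-.
by apply: eq_bigr => G _; rewrite mulr1.
Qed.

(** Conditioning on an occupied cell is a passage to another instance, so joint probabilities become
    products of single cell probabilities of successive instances. *)
Lemma mean_occ I e f : e \notin forb I -> (0 < rs I e.1)%N -> (0 < cs I e.2)%N ->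
  (forall G, f (setcell true e G) = f G) ->
  mean I (fun G => (G e)%:R * f G) = Pr I e * mean (occ I e) f.
Proof.
move=> he hr hc hf.
have PrE : Pr I e = #|graphs (occ I e)|%:R / #|graphs I|%:R by rewrite card_occ.
rewrite PrE /mean sum_occ //; case: (posnP #|graphs (occ I e)|) => [h0|h0].
  by rewrite h0 !mul0r (eq_bigl xpred0) ?big_pred0_eq ?mul0r // => G; rewrite (card0_eq h0).
have b0 : #|graphs (occ I e)|%:R != 0 :> R by rewrite pnatr_eq0 -lt0n.
by rewrite [RHS]mulrC mulrA divfK ?b0.
Qed.

Lemma card_emp I e : nonempty I -> #|graphs (emp I e)|%:R = #|graphs I|%:R * (1 - Pr I e).
Proof.
move=> h; rewrite mulrBr mulr1 /Pr /mean mulrCA mulfV ?mulr1 ?pnatr_eq0 -?lt0n //.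
rewrite -!sumr_const -sumrB big_mkcond [RHS]big_mkcond /=.
apply: eq_bigr => G _; rewrite graphs_emp.
by case: (G \in _); case: (G e); rewrite ?subrr ?subr0.
Qed.

End Mean.
End Graphs.

(** * Exchanging rows within two columns *)

Section TwoColumns.
Context {R : realFieldType} {m n : nat}.
Notation graph := {ffun 'I_m * 'I_n -> bool}.
Notation inst := (inst m n).
Variables (I : inst) (k l : 'I_n).
Hypothesis neq_kl : k != l.
Implicit Types (G : graph) (i j : 'I_m).

Definition blocked (i : 'I_m) := ((i, k) \in forb I) || ((i, l) \in forb I).
Definition free G (i : 'I_m) := ~~ blocked i && (G (i, k) (+) G (i, l)).
Definition df G (i : 'I_m) : R := (G (i, k))%:R - (G (i, l))%:R.
Definition nfree G : R := \sum_i (free G i)%:R.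
Definition diff G : R := \sum_i (free G i)%:R * df G i.

(* Exchanging two free, differing rows within the columns [k] and [l] preserves all degrees. *)
Definition swap (i j : 'I_m) G : graph :=
  [ffun e => if (e.2 == k) || (e.2 == l) then G (tperm i j e.1, e.2) else G e].

Lemma swapK i j : involutive (swap i j).
Proof.
by move=> G; apply/ffunP => -[a b]; rewrite !ffunE /=; case: ifP => h; rewrite h ?tpermK.
Qed.

Lemma swap_k i j G a : swap i j G (a, k) = G (tperm i j a, k).
Proof. by rewrite ffunE /= eqxx. Qed.

Lemma swap_l i j G a : swap i j G (a, l) = G (tperm i j a, l).
Proof. by rewrite ffunE /= eqxx orbT. Qed.

Lemma swap_other i j G a b : b != k -> b != l -> swap i j G (a, b) = G (a, b).
Proof. by move=> /negbTE hk /negbTE hl; rewrite ffunE /= hk hl. Qed.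

Lemma df_swap i j G a : df (swap i j G) a = df G (tperm i j a).
Proof. by rewrite /df swap_k swap_l. Qed.

Lemma free_swap i j G a : free G i -> free G j -> free (swap i j G) a = free G a.
Proof.
rewrite /free swap_k swap_l => /andP[hi1 hi2] /andP[hj1 hj2].
by case: tpermP => [->|->|//]; rewrite ?hi1 ?hj1 ?hi2 ?hj2.
Qed.

Lemma addb_nat (a b : bool) : a (+) b -> (a + b = 1)%N.
Proof. by case: a; case: b. Qed.

(** A free row has exactly one entry in the two columns, which keeps the row sums; a permutation of
    rows keeps the column sums; and neither row has a forbidden cell in these columns. *)
Lemma swap_graphs i j G : free G i -> free G j ->
  (swap i j G \in graphs I) = (G \in graphs I).
Proof.
wlog suff h : G / free G i -> free G j -> G \in graphs I -> swap i j G \in graphs I.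
  move=> hi hj; apply/idP/idP; last exact: h.
  by move=> hs; rewrite -(swapK i j G); apply: h; rewrite ?free_swap.
move=> hi hj /graphsP[h1 h2 h3]; apply/graphsP; split.
- move=> a; rewrite -h1 (bigD1 k) //= (bigD1 l) 1?eq_sym //= [in RHS](bigD1 k) //= [in RHS](bigD1 l) 1?eq_sym //=.
  rewrite swap_k swap_l !addnA; congr (_ + _)%N; last first.
    by apply: eq_bigr => b /andP[hk hl]; rewrite swap_other.
  case/andP: hi => [_ /addb_nat hi]; case/andP: hj => [_ /addb_nat hj].
  by case: tpermP => [->|->|//]; rewrite hi hj.
- move=> b; case: (boolP ((b == k) || (b == l))) => [hb|]; last first.
    by rewrite negb_or => /andP[hk hl]; rewrite -h2; apply: eq_bigr => a _; rewrite swap_other.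
  rewrite -h2 [RHS](reindex_inj (@perm_inj _ (tperm i j))).
  by apply: eq_bigr => a _; rewrite ffunE /= hb.
- move=> [a b] hab; rewrite ffunE /=; case: ifP => hb; last exact: h3.
  case/andP: hi; rewrite /blocked negb_or => /andP[hi1 hi2] _.
  case/andP: hj; rewrite /blocked negb_or => /andP[hj1 hj2] _.
  case: tpermP => [E|E|_ _]; last exact: h3.
  + by exfalso; move: hb hab; rewrite E => /orP[] /eqP ->; rewrite ?(negbTE hi1) ?(negbTE hi2).
  + by exfalso; move: hb hab; rewrite E => /orP[] /eqP ->; rewrite ?(negbTE hj1) ?(negbTE hj2).
Qed.

Lemma mean_swap i j (f : graph -> R) :
  mean I (fun G => (free G i && free G j)%:R * f G) =
  mean I (fun G => (free G i && free G j)%:R * f (swap i j G)).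
Proof.
rewrite /mean; congr (_ / _).
have E g : \sum_(G in graphs I) (free G i && free G j)%:R * g G =
    \sum_(G | [&& G \in graphs I, free G i & free G j]) (g G : R).
  rewrite big_mkcond [RHS]big_mkcond; apply: eq_bigr => G _.
  by case: (G \in _) => //=; case: (_ && _); rewrite ?mul1r ?mul0r.
rewrite !E (reindex_inj (inv_inj (swapK i j))).
apply: eq_bigl => G.
case: (boolP (free G i && free G j)) => [/andP[hi hj]|hn].
  by rewrite swap_graphs // !free_swap // hi hj.
rewrite andbF; apply/negbTE/negP => /and3P[_ hi hj]; case/negP: hn.
by have:= free_swap i hi hj; have:= free_swap j hi hj; rewrite swapK hi hj => -> ->.
Qed.

(** The identity of exchangeable pairs: an antisymmetric [A] turns the mean of [A * f] into half the
    mean of [A] times the increment of [f], which can be small where [f] is large. *)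
Lemma mean_swap_anti i j (A f : graph -> R) :
  (forall G, free G i -> free G j -> A (swap i j G) = - A G) ->
  mean I (fun G => (free G i && free G j)%:R * (A G * f G)) =
  2^-1 * mean I (fun G => (free G i && free G j)%:R * (A G * (f G - f (swap i j G)))).
Proof.
move=> hA.
have E : mean I (fun G => (free G i && free G j)%:R * (A G * f G)) =
    - mean I (fun G => (free G i && free G j)%:R * (A G * f (swap i j G))).
  rewrite mean_swap -meanN; apply: eq_mean => G _.
  case: (boolP (_ && _)) => [/andP[hi hj]|_]; last by rewrite !mul0r oppr0.
  by rewrite hA // !mul1r mulNr.
have -> : mean I (fun G => (free G i && free G j)%:R * (A G * (f G - f (swap i j G)))) =
   mean I (fun G => (free G i && free G j)%:R * (A G * f G)) -
   mean I (fun G => (free G i && free G j)%:R * (A G * f (swap i j G))).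
  by rewrite -meanB; apply: eq_mean => G _; ring.
rewrite {2}E; lra.
Qed.

Lemma nfree_swap i j G : free G i -> free G j -> nfree (swap i j G) = nfree G.
Proof. by move=> hi hj; apply: eq_bigr => a _; rewrite free_swap. Qed.

Lemma nfree_ge1 G i : free G i -> 1 <= nfree G.
Proof.
move=> hi; rewrite /nfree (bigD1 i) //= hi lerDl; apply: sumr_ge0 => *; exact: ler0n.
Qed.

Lemma nfree_ge0 G : 0 <= nfree G.
Proof. by apply: sumr_ge0 => *; exact: ler0n. Qed.

Lemma nfree_le G : nfree G <= m%:R.
Proof.
apply: (@le_trans _ _ (\sum_(i : 'I_m) 1)); last by rewrite sumr_const card_ord.
by apply: ler_sum => i _; case: (free G i); rewrite ?ler01.
Qed.

Lemma df_le1 G i : `|df G i| <= 1.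
Proof. by rewrite /df; case: (G _); case: (G _); rewrite /= ?subrr ?subr0 ?sub0r ?normrN ?normr1 ?normr0. Qed.

Lemma diff_le_nfree G : `|diff G| <= nfree G.
Proof.
apply: le_trans (ler_norm_sum _ _ _) _; apply: ler_sum => i _.
by rewrite normrM normr_nat ler_piMr ?ler0n // df_le1.
Qed.

(** For a free [j], [diff / nfree - df j] is the average of [df i - df j] over the free rows [i].
    Each term is antisymmetric under the exchange of [i] and [j], which leaves [nfree] unchanged, so
    its mean is 0. If [j] is neither blocked nor free, [df j] is 0. *)
Lemma mean_df j : ~~ blocked j ->
  mean I (fun G => df G j) = mean I (fun G => (free G j)%:R * (diff G / nfree G)).
Proof.
move=> hj; apply/eqP; rewrite eq_sym -subr_eq0 -meanB; apply/eqP.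
rewrite (@eq_mean _ _ _ _ _
   (fun G => \sum_i (free G j && free G i)%:R * ((df G i - df G j) * (nfree G)^-1))); last first.
  move=> G _; case hf: (free G j); last first.
    rewrite /= mul0r sub0r big1; last by move=> i _; rewrite mul0r.
    move: hf; rewrite /free hj /df /=; case: (G _); case: (G _) => //=; by rewrite subrr oppr0.
  rewrite mul1r /= /diff mulr_suml.
  have h0 : nfree G != 0 by apply: lt0r_neq0; apply: lt_le_trans (nfree_ge1 hf); rewrite ltr01.
  transitivity (\sum_i ((free G i)%:R * df G i / nfree G - (free G i)%:R * (df G j / nfree G))).
    rewrite sumrB -[X in _ = _ - X]mulr_suml -/(nfree G); congr (_ - _).
    by rewrite mulrCA mulfV // mulr1.
  by apply: eq_bigr => i _; ring.
rewrite mean_sum big1 // => i _; rewrite mean_swap_anti.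
  rewrite (@eq_mean _ _ _ _ _ (fun=> 0)) ?/mean ?big1 ?mul0r ?mulr0 // => G _.
  case: (boolP (_ && _)) => [/andP[h1 h2]|_]; last by rewrite mul0r.
  by rewrite nfree_swap // subrr mulr0 mulr0.
by move=> G h1 h2; rewrite !df_swap tpermL tpermR [RHS]opprB.
Qed.


Section FourthMoment.
Variable k0 : 'I_n.
Hypotheses (neq0k : k0 != k) (neq0l : k0 != l).

(** The share of the free rows in the difference of the codegrees of [(k0, k)] and [(k0, l)]. *)
Definition lin G : R := \sum_i (free G i)%:R * (G (i, k0))%:R * df G i.

Lemma lin_swap i j G : free G i -> free G j -> `|lin G - lin (swap i j G)| <= 2%:R.
Proof.
move=> hi hj; rewrite /lin -sumrB.
have E a : (free G a)%:R * (G (a, k0))%:R * df G a -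
    (free (swap i j G) a)%:R * (swap i j G (a, k0))%:R * df (swap i j G) a =
    (free G a)%:R * (G (a, k0))%:R * (df G a - df G (tperm i j a)).
  by rewrite free_swap // swap_other // df_swap [RHS]mulrBr.
under eq_bigr do rewrite E.
have [->|ne] := eqVneq i j.
  rewrite big1 ?normr0 ?ler0n // => a _; rewrite tperm1 perm1 subrr mulr0 //.
rewrite (bigD1 i) //= (bigD1 j) 1?eq_sym //= big1 ?addr0; last first.
  by move=> a /andP[h1 h2]; rewrite tpermD 1?eq_sym // subrr mulr0.
rewrite tpermL tpermR hi hj !mul1r.
have -> : (G (i, k0))%:R * (df G i - df G j) + (G (j, k0))%:R * (df G j - df G i) =
  ((G (i, k0))%:R - (G (j, k0))%:R) * (df G i - df G j) :> R by ring.
have := df_le1 G i; have := df_le1 G j.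
by case: (G (i, k0)); case: (G (j, k0)); rewrite /= ?subrr ?subr0 ?sub0r ?mul0r ?mul1r ?mulN1r ?normrN ?normr0 ?ler0n //;
 rewrite !ler_norml => /andP[? ?] /andP[? ?]; apply/andP; split; lra.
Qed.

Lemma cube_diff (x y : R) : `|x - y| <= 2 -> `|x ^+ 3 - y ^+ 3| <= 12 * x ^+ 2 + 14.
Proof.
move=> h; have -> : x ^+ 3 - y ^+ 3 = (x - y) * (3 * x ^+ 2 - 3 * x * (x - y) + (x - y) ^+ 2) by ring.
set d := x - y in h *; rewrite normrM.
have hd : d ^+ 2 <= 4.
  by move: h; rewrite ler_norml => /andP[h1 h2]; nra.
have h0 : 0 <= 3 * x ^+ 2 - 3 * x * d + d ^+ 2 by have := sqr_ge0 (x - d / 2); have := sqr_ge0 d; nra.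
rewrite (ger0_norm h0); apply: le_trans (ler_wpM2r h0 h) _.
by have := sqr_ge0 (x + d / 2); nra.
Qed.

(** Young's inequality by cases: for [|x| > 4 a] the cubic term is below [x ^+ 4 / 4], otherwise
    below [64 * a ^+ 4]. *)
Lemma young3 (a x : R) : 0 <= a -> a * `|x| ^+ 3 <= x ^+ 4 / 4 + 64 * a ^+ 4.
Proof.
move=> a0; have -> : x ^+ 4 = `|x| ^+ 4 by rewrite -normrX ger0_norm // exprn_even_ge0.
have := normr_ge0 x; set y := `|x| => y0.
have [h|h] := lerP y (4 * a).
  apply: (@le_trans _ _ (64 * a ^+ 4)).
    have -> : 64 * a ^+ 4 = a * (4 * a) ^+ 3 by ring.
    by rewrite ler_wpM2l // lerXn2r ?nnegrE // mulr_ge0.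
  by rewrite lerDr mulr_ge0 ?exprn_ge0 // invr_ge0.
apply: (@le_trans _ _ (y ^+ 4 / 4)); last by rewrite lerDl mulr_ge0 ?exprn_ge0.
have -> : y ^+ 4 / 4 = (y / 4) * y ^+ 3 by field.
by rewrite ler_wpM2r ?exprn_ge0 //; lra.
Qed.

(** [lin * nfree - W * diff] is a double sum of the antisymmetric terms [A i j]. Multiplied by
    [Phi], it therefore contributes only increments of [lin ^+ 3], divided by [nfree], in total at
    most [m * (12 * lin ^+ 2 + 14)]. The drift [W * diff * Phi] is at most [D * |lin| ^+ 3]. Half of
    [lin ^+ 4] absorbs both. *)
Lemma mean_lin4 (D : R) : 0 <= D -> (forall G, G \in graphs I -> `|diff G| <= D) ->
  mean I (fun G => lin G ^+ 4) <= 128 * D ^+ 4 + 288 * m%:R ^+ 2 + 28 * m%:R.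
Proof.
move=> D0 hD.
have [h0|h0] := posnP #|graphs I|.
  by rewrite /mean h0 invr0 mulr0 !addr_ge0 ?mulr_ge0 ?exprn_ge0 ?ler0n.
pose W G : R := \sum_i (free G i)%:R * (G (i, k0))%:R.
pose A i j G : R := (G (i, k0))%:R * (df G i - df G j).
pose Phi G : R := lin G ^+ 3 / nfree G.
have Z0 G : nfree G = 0 -> lin G = 0.
  move=> /eqP; rewrite psumr_eq0; last by move=> *; exact: ler0n.
  by move=> /allP h; rewrite /lin big1 // => i _; have /eqP -> := h i (mem_index_enum _); rewrite !mul0r.
have E1 : mean I (fun G => lin G ^+ 4 - W G * diff G * lin G ^+ 3 / nfree G) =
    \sum_i \sum_j mean I (fun G => (free G i && free G j)%:R * (A i j G * Phi G)).
  under [RHS]eq_bigr do rewrite -mean_sum.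
  rewrite -mean_sum; apply: eq_mean => G _.
  have -> : lin G ^+ 4 = lin G * nfree G * Phi G.
    rewrite /Phi; have [/Z0 ->|z0] := eqVneq (nfree G) 0; first by rewrite !expr0n /= !mul0r.
    by field.
  have -> : W G * diff G * lin G ^+ 3 / nfree G = W G * diff G * Phi G by rewrite /Phi !mulrA.
  rewrite -mulrBl.
  have -> : lin G * nfree G - W G * diff G =
      \sum_i \sum_j (free G i && free G j)%:R * A i j G.
    rewrite /lin /W [_ * nfree G]mulr_suml mulr_suml -sumrB; apply: eq_bigr => i _.
    rewrite /nfree /diff !mulr_sumr -sumrB; apply: eq_bigr => j _.
    by rewrite /A -mulnb natrM; ring.
  rewrite mulr_suml; apply: eq_bigr => i _; rewrite mulr_suml.
  by apply: eq_bigr => j _; rewrite mulrA.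
have E2 : \sum_i \sum_j mean I (fun G => (free G i && free G j)%:R * (A i j G * Phi G)) <=
    mean I (fun G => m%:R * (12 * lin G ^+ 2 + 14)).
  apply: (@le_trans _ _ (\sum_i \sum_j
     mean I (fun G => (free G i)%:R * (free G j)%:R * ((12 * lin G ^+ 2 + 14) / nfree G)))).
    apply: ler_sum => i _; apply: ler_sum => j _; rewrite mean_swap_anti; last first.
      by move=> G _ _; rewrite /A swap_other // !df_swap tpermL tpermR -mulrN [in RHS]opprB.
    rewrite -meanZ; apply: ler_mean => G _; rewrite -mulnb natrM.
    case hi: (free G i); last by rewrite !mul0r mulr0.
    case hj: (free G j); last by rewrite !mulr0 !mul0r mulr0.
    rewrite !mul1r /Phi nfree_swap // -mulrBl [A i j G * _]mulrA [2^-1 * _]mulrA ler_wpM2r ?invr_ge0 ?nfree_ge0 //.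
    have hA : `|A i j G| <= 2.
      rewrite /A normrM normr_nat; have := df_le1 G i; have := df_le1 G j.
      rewrite !ler_norml => /andP[? ?] /andP[? ?].
      have : `|df G i - df G j| <= 2 by rewrite ler_norml; apply/andP; split; lra.
      by case: (G (i, k0)); rewrite ?mul1r ?mul0r.
    have := cube_diff (lin_swap hi hj); set c := lin G ^+ 3 - _ => hc.
    apply: (@le_trans _ _ (2^-1 * (`|A i j G| * `|c|))).
      by rewrite -normrM ler_wpM2l ?invr_ge0 ?ler0n // ler_norm.
    apply: (@le_trans _ _ (2^-1 * (2 * `|c|))); last by rewrite mulKf ?pnatr_eq0.
    by rewrite ler_wpM2l ?invr_ge0 // ler_wpM2r.
  under eq_bigr do rewrite -mean_sum.
  rewrite -mean_sum; apply: ler_mean => G _.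
  under eq_bigr do rewrite -mulr_suml -mulr_sumr.
  rewrite -!mulr_suml -/(nfree G).
  have [->|z0] := eqVneq (nfree G) 0.
    by rewrite !mul0r mulr_ge0 ?ler0n // addr_ge0 // mulr_ge0 // sqr_ge0.
  rewrite mulrA mulrAC mulrK ?unitfE // ler_wpM2r ?nfree_le //.
  by rewrite addr_ge0 // mulr_ge0 // sqr_ge0.
rewrite -E1 in E2.
have E3 : mean I (fun G => lin G ^+ 4) <= mean I (fun G => lin G ^+ 4 / 2 +
   (64 * D ^+ 4 + 144 * m%:R ^+ 2 + 14 * m%:R)).
  have -> : mean I (fun G => lin G ^+ 4) =
    mean I (fun G => lin G ^+ 4 - W G * diff G * lin G ^+ 3 / nfree G) +
    mean I (fun G => W G * diff G * lin G ^+ 3 / nfree G).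
    by rewrite -meanD; apply: eq_mean => G _; rewrite subrK.
  apply: le_trans (lerD E2 (lexx _)) _; rewrite -meanD; apply: ler_mean => G hG.
  have h1 : W G * diff G * lin G ^+ 3 / nfree G <= D * `|lin G| ^+ 3.
    have [hz|z0] := eqVneq (nfree G) 0.
      by rewrite hz invr0 mulr0 mulr_ge0 // exprn_ge0.
    have zp : 0 < nfree G by rewrite lt_def z0 nfree_ge0.
    rewrite ler_pdivrMr //; apply: le_trans (ler_norm _) _.
    have hW0 : 0 <= W G by apply: sumr_ge0 => i _; rewrite mulr_ge0 ?ler0n.
    have hW : W G <= nfree G.
      by apply: ler_sum => i _; case: (G (i, k0)); rewrite ?mulr1 ?mulr0 ?ler0n.
    rewrite normrM normrX normrM (ger0_norm hW0) -mulrA mulrC ler_pM //.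
      by rewrite mulr_ge0 // exprn_ge0.
    by rewrite ler_wpM2r ?exprn_ge0 // hD.
  have h2 := young3 (lin G) D0.
  (* Moves [12 * m * lin ^+ 2] into [lin ^+ 4 / 4 + 144 * m ^+ 2]. *)
  have h3 : 0 <= (lin G ^+ 2 / 2 - 12 * m%:R) ^+ 2 by exact: sqr_ge0.
  have E4 : lin G ^+ 4 = (lin G ^+ 2) ^+ 2 by rewrite -exprM.
  move: h1 h2 h3; rewrite E4; set v := _ / _; set y := lin G ^+ 2; set z := _ * `|_| ^+ 3.
  set M := (m%:R : R); set D4 := D ^+ 4 => h1 h2 h3; nra.
rewrite meanD mean_cst // in E3.
have E5 : mean I (fun G => lin G ^+ 4 / 2) = mean I (fun G => lin G ^+ 4) / 2 by rewrite meanZr.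
rewrite E5 in E3; lra.
Qed.

End FourthMoment.
End TwoColumns.

(** * The asymptotic regime *)

(** [lam_var] makes a division by [lam * (1 - lam)] cost one power of [w]; [w_le_u] makes every
    [w ^+ k / u] with [k < 500] at most [1 / w]. *)
Record scale {R : realFieldType} (w u lam : R) (m n : nat) : Prop := Scale {
  w_ge16 : 16%:R <= w;
  u_ge1' : 1 <= u;
  w_le_u : w ^+ 500 <= u;
  u_sqr : u ^+ 2 = n%:R;
  lam_gt0 : 0 < lam;
  lam_lt1 : lam < 1;
  lam_var : 1 <= w * (lam * (1 - lam));
  m_le : m%:R <= w * n%:R;
  n_le : n%:R <= w * m%:R }.

Definition hrow {m n} (I : inst m n) j : nat := (\sum_k ((j, k) \in forb I))%N.
Definition hcol {m n} (I : inst m n) k : nat := (\sum_j ((j, k) \in forb I))%N.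

(* [r] bounds the number of cells already exposed; [lam] is kept fixed while cells are exposed,
   hence the slack [r] in every field. *)
Record cls {R : realFieldType} {m n : nat} (w u lam : R) (r : nat) (I : inst m n) : Prop := Cls {
  r_le16 : (r <= 16)%N;
  tot_eq : (\sum_j rs I j = \sum_k cs I k)%N;
  tot_dev : `|(\sum_j rs I j)%N%:R - lam * m%:R * n%:R| <= r%:R;
  row_dev : forall j, `|(rs I j)%:R - lam * n%:R| <= w * u + r%:R;
  col_dev : forall k, `|(cs I k)%:R - lam * m%:R| <= w * u + r%:R;
  row_forb : forall j, (hrow I j)%:R <= w * u + r%:R;
  col_forb : forall k, (hcol I k)%:R <= w * u + r%:R;
  card_forb : #|forb I|%:R <= w * n%:R + r%:R }.

Section ScaleFacts.
Context {R : realFieldType} (w u lam : R) (m n : nat).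
Hypothesis sc : scale w u lam m n.
Let w_ge := w_ge16 sc.
Let u_ge1 := u_ge1' sc.
Notation bd := (bd w u).
Notation Lam := (lam * (1 - lam)).

Lemma sc_w1 : 1 <= w. Proof. exact: w_ge1 w_ge. Qed.
Lemma sc_w0 : 0 < w. Proof. exact: w_gt0 w_ge. Qed.
Lemma sc_u0 : 0 < u. Proof. exact: u_gt0 u_ge1. Qed.
Lemma sc_Lam0 : 0 < Lam.
Proof. by rewrite mulr_gt0 ?(lam_gt0 sc) // subr_gt0 (lam_lt1 sc). Qed.
Lemma sc_n0 : 0 < n%:R :> R.
Proof. by rewrite -(u_sqr sc) exprn_gt0 // sc_u0. Qed.
Lemma sc_m0 : 0 < m%:R :> R.
Proof.
have h := lt_le_trans sc_n0 (n_le sc).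
by move: h; rewrite pmulr_rgt0 ?sc_w0.
Qed.

Lemma bd_w : bd 1 0 w.
Proof. by rewrite /bd expr1 expr0z mulr1 ger0_norm ?(ltW sc_w0). Qed.
Lemma bd_u : bd 0 1 u.
Proof. by rewrite /bd mul1r expr1z ger0_norm ?(ltW sc_u0). Qed.
Lemma bd_n : bd 0 2 n%:R.
Proof. by rewrite /bd mul1r -(u_sqr sc) normrX ger0_norm ?(ltW sc_u0). Qed.
Lemma bd_ninv : bd 0 (-2) n%:R^-1.
Proof.
by rewrite /bd mul1r -(u_sqr sc) normfV normrX ger0_norm ?(ltW sc_u0) // -exprnN exprz_inv.
Qed.
Lemma bd_m : bd 1 2 m%:R.
Proof.
apply: (bd_norm_le w_ge u_ge1 (y := w * n%:R)); first by rewrite normr_nat (m_le sc).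
by have := bdM w_ge u_ge1 bd_w bd_n.
Qed.
Lemma bd_minv : bd 1 (-2) m%:R^-1.
Proof.
apply: (bd_norm_le w_ge u_ge1 (y := w * n%:R^-1)).
  rewrite normfV normr_nat -[w]invrK -invfM lef_pV2 ?posrE ?sc_m0 ?mulr_gt0 ?invr_gt0 ?sc_w0 ?sc_n0 //.
  by rewrite ler_pdivrMl ?sc_w0 // (n_le sc).
by have := bdM w_ge u_ge1 bd_w bd_ninv.
Qed.
Lemma bd_lam : bd 0 0 lam.
Proof.
apply: bd_le1 => //; rewrite ger0_norm ?(ltW (lam_gt0 sc)) ?(ltW (lam_lt1 sc)) //.
Qed.
Lemma bd_1lam : bd 0 0 (1 - lam).
Proof.
have h0 := lam_gt0 sc; have h1 := lam_lt1 sc.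
by apply: bd_le1 => //; rewrite ger0_norm; lra.
Qed.
Lemma bd_Laminv : bd 1 0 Lam^-1.
Proof.
rewrite /bd expr1 expr0z mulr1 ger0_norm ?invr_ge0 ?(ltW sc_Lam0) //.
by rewrite -div1r ler_pdivrMr ?sc_Lam0 // (lam_var sc).
Qed.
Lemma bd_laminv : bd 1 0 lam^-1.
Proof.
apply: (bd_norm_le w_ge u_ge1 (y := (1 - lam) * Lam^-1)).
  have h0 := lam_gt0 sc; have h1 := lam_lt1 sc.
  rewrite ger0_norm ?invr_ge0 ?(ltW h0) // invfM mulrCA mulfV ?mulr1 //.
  by apply: lt0r_neq0; lra.
by have := bdM w_ge u_ge1 bd_1lam bd_Laminv.
Qed.
Lemma bd_1laminv : bd 1 0 (1 - lam)^-1.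
Proof.
apply: (bd_norm_le w_ge u_ge1 (y := lam * Lam^-1)).
  have h0 := lam_gt0 sc; have h1 := lam_lt1 sc.
  by rewrite ger0_norm ?invr_ge0 ?subr_ge0 ?(ltW h1) // invfM mulrA mulfV ?mul1r // lt0r_neq0.
by have := bdM w_ge u_ge1 bd_lam bd_Laminv.
Qed.

(* [w ^+ 500 <= u] trades a power of [u] for powers of [w] *)
Lemma w_pow_le i : (i <= 500)%N -> w ^+ i <= u.
Proof.
by move=> h; apply: le_trans (w_le_u sc); apply: (ler_weXn2l sc_w1).
Qed.

Section ClassFacts.
Variables (r : nat) (I : inst m n).
Hypothesis cl : cls w u lam r I.

(** The quantities delta_j and eta_k, formed with the fixed density [lam] rather than with the
    averages of the instance. *)
Definition idlt (I : inst m n) j : R := (rs I j)%:R - lam * n%:R + lam * (hrow I j)%:R.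
Definition ieta (I : inst m n) k : R := (cs I k)%:R - lam * m%:R + lam * (hcol I k)%:R.

Lemma r_le_w : r%:R <= w.
Proof. by apply: le_trans w_ge; rewrite ler_nat (r_le16 cl). Qed.

Lemma wur_bd : w * u + r%:R <= 2 * w * u.
Proof.
have h : w <= w * u by rewrite ler_peMr // ltW ?sc_w0.
have := r_le_w; lra.
Qed.

Lemma bd_2wu x : `|x| <= w * u + r%:R -> bd 2 1 x.
Proof.
move=> h; apply: (bd_norm_le w_ge u_ge1 (y := 2 * w * u)).
  exact: le_trans h wur_bd.
have h2 := bd_natr w_ge u_ge1 (isT : (2 <= 16)%N).
by have := bdM w_ge u_ge1 (bdM w_ge u_ge1 h2 bd_w) bd_u.
Qed.

Lemma bd_row j : bd 2 1 ((rs I j)%:R - lam * n%:R).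
Proof. exact: bd_2wu (row_dev cl j). Qed.
Lemma bd_col k : bd 2 1 ((cs I k)%:R - lam * m%:R).
Proof. exact: bd_2wu (col_dev cl k). Qed.
Lemma bd_hrow j : bd 2 1 (hrow I j)%:R.
Proof. by apply: bd_2wu; rewrite normr_nat (row_forb cl). Qed.
Lemma bd_hcol k : bd 2 1 (hcol I k)%:R.
Proof. by apply: bd_2wu; rewrite normr_nat (col_forb cl). Qed.
Lemma bd_card : bd 2 2 #|forb I|%:R.
Proof.
apply: (bd_norm_le w_ge u_ge1 (y := w * n%:R + w)).
  by rewrite normr_nat; apply: le_trans (card_forb cl) _; rewrite lerD2l r_le_w.
by apply: (bd_le w_ge u_ge1 (bdD w_ge u_ge1 (bdM w_ge u_ge1 bd_w bd_n) bd_w)).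
Qed.
Lemma bd_tot : bd 1 0 ((\sum_j rs I j)%N%:R - lam * m%:R * n%:R).
Proof.
apply: (bd_norm_le w_ge u_ge1 (y := w)); last exact: bd_w.
exact: le_trans (tot_dev cl) r_le_w.
Qed.
Lemma bd_dlt j : bd 3 1 (idlt I j).
Proof.
exact: (bd_le w_ge u_ge1 (bdD w_ge u_ge1 (bd_row j) (bdM w_ge u_ge1 bd_lam (bd_hrow j)))).
Qed.
Lemma bd_eta k : bd 3 1 (ieta I k).
Proof.
exact: (bd_le w_ge u_ge1 (bdD w_ge u_ge1 (bd_col k) (bdM w_ge u_ge1 bd_lam (bd_hcol k)))).
Qed.
Lemma bd_rs j : bd 3 2 (rs I j)%:R.
Proof.
have -> : (rs I j)%:R = (rs I j)%:R - lam * n%:R + lam * n%:R by rewrite subrK.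
exact: (bd_le w_ge u_ge1 (bdD w_ge u_ge1 (bd_row j) (bdM w_ge u_ge1 bd_lam bd_n))).
Qed.
Lemma bd_cs k : bd 3 2 (cs I k)%:R.
Proof.
have -> : (cs I k)%:R = (cs I k)%:R - lam * m%:R + lam * m%:R by rewrite subrK.
exact: (bd_le w_ge u_ge1 (bdD w_ge u_ge1 (bd_col k) (bdM w_ge u_ge1 bd_lam bd_m))).
Qed.

Lemma two_wur_le : 4 * (w * (w * u + r%:R)) <= n%:R.
Proof.
have h1 : 8 * w ^+ 2 <= u.
  apply: le_trans (w_pow_le (isT : (3 <= 500)%N)); rewrite [_ ^+ 3]exprS ler_wpM2r ?exprn_ge0 ?(ltW sc_w0) //.
  by apply: le_trans w_ge; rewrite ler_nat.
rewrite -(u_sqr sc); apply: (@le_trans _ _ (4 * (w * (2 * w * u)))).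
  by rewrite !ler_wpM2l ?ler0n ?(ltW sc_w0) // wur_bd.
have -> : 4 * (w * (2 * w * u)) = 8 * w ^+ 2 * u by ring.
by rewrite expr2 ler_wpM2r // ltW ?sc_u0.
Qed.

Lemma nx_ge j : n%:R / 2 <= n%:R - (hrow I j)%:R :> R.
Proof.
have h := row_forb cl j; have h2 := two_wur_le.
have h3 : w * u + r%:R <= w * (w * u + r%:R).
  by rewrite ler_peMl ?sc_w1 // addr_ge0 ?ler0n // mulr_ge0 ?(ltW sc_w0) ?(ltW sc_u0).
have h4 := sc_n0; lra.
Qed.

Lemma my_ge k : m%:R / 2 <= m%:R - (hcol I k)%:R :> R.
Proof.
have h := col_forb cl k; have h2 := two_wur_le.
have h3 : 4 * (w * u + r%:R) <= m%:R.
  rewrite -(ler_pM2l sc_w0) mulrCA; apply: le_trans h2 (n_le sc).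
have h4 : (0 : R) <= m%:R by exact: ler0n.
by lra.
Qed.

Lemma bd_nxinv j : bd 1 (-2) (n%:R - (hrow I j)%:R)^-1.
Proof.
have h := nx_ge j; have n0 := sc_n0.
have p0 : 0 < n%:R - (hrow I j)%:R :> R by lra.
apply: (bd_norm_le w_ge u_ge1 (y := 2 * n%:R^-1)).
  rewrite ger0_norm ?invr_ge0 ?(ltW p0) // -[2]invrK -invfM lef_pV2 ?posrE ?mulr_gt0 ?invr_gt0 //.
  by rewrite mulrC.
have h2 := bd_natr w_ge u_ge1 (isT : (2 <= 16)%N).
by have := bdM w_ge u_ge1 h2 bd_ninv.
Qed.

Lemma bd_myinv k : bd 2 (-2) (m%:R - (hcol I k)%:R)^-1.
Proof.
have h := my_ge k; have m0 := sc_m0.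
have p0 : 0 < m%:R - (hcol I k)%:R :> R by lra.
apply: (bd_norm_le w_ge u_ge1 (y := 2 * m%:R^-1)).
  rewrite ger0_norm ?invr_ge0 ?(ltW p0) // -[2]invrK -invfM lef_pV2 ?posrE ?mulr_gt0 ?invr_gt0 //.
  by rewrite mulrC.
have h2 := bd_natr w_ge u_ge1 (isT : (2 <= 16)%N).
by have := bdM w_ge u_ge1 h2 bd_minv.
Qed.
End ClassFacts.
End ScaleFacts.

Ltac use_scale lem := match goal with S : scale _ _ _ _ _ |- _ => apply (lem _ _ _ _ _ _ S) end.
Ltac use_class lem := match goal with S : scale _ _ _ _ _, C : cls _ _ _ _ _ |- _ => apply (lem _ _ _ _ _ _ S _ _ C) end.
(** Centred degrees are tried before plain ones, which are larger by a factor [u]: splitting such a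
    difference would lose the cancellation. *)
Ltac bdatom x ::=
  lazymatch x with
  | _ *+ rs _ _ - _ => use_class @bd_row
  | _ *+ cs _ _ - _ => use_class @bd_col
  | _ *+ (bigop _ _ _) - _ => use_class @bd_tot
  | _ *+ hrow _ _ => use_class @bd_hrow
  | _ *+ hcol _ _ => use_class @bd_hcol
  | _ *+ card _ => use_class @bd_card
  | _ *+ rs _ _ => use_class @bd_rs
  | _ *+ cs _ _ => use_class @bd_cs
  | idlt _ _ _ => use_class @bd_dlt
  | ieta _ _ _ => use_class @bd_eta
  | (_ *+ _ - _ *+ hrow _ _)^-1 => use_class @bd_nxinv
  | (_ *+ _ - _ *+ hcol _ _)^-1 => use_class @bd_myinv
  | 1 - ?l => use_scale @bd_1lam
  | (?l * (1 - ?l))^-1 => use_scale @bd_Laminv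
  | (1 - ?l)^-1 => use_scale @bd_1laminv
  | (_ *+ _)^-1 => first [use_scale @bd_ninv | use_scale @bd_minv | eapply bd_natinv; eassumption]
  | ?l^-1 => use_scale @bd_laminv
  | _ *+ _ => first [use_scale @bd_n | use_scale @bd_m]
  | _ => first [use_scale @bd_u | use_scale @bd_w | use_scale @bd_lam]
  end.

(** * Fourth moments *)

Section PowerMean.
Context {R : realFieldType}.

Lemma sqr_sum_le (I : finType) (a : I -> R) :
  (\sum_i a i) ^+ 2 <= #|I|%:R * \sum_i a i ^+ 2.
Proof.
rewrite expr2 big_distrlr /=.
apply: (@le_trans _ _ (\sum_i \sum_j (a i ^+ 2 + a j ^+ 2) / 2)).
  apply: ler_sum => i _; apply: ler_sum => j _.
  by have := sqr_ge0 (a i - a j); lra.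
set S := \sum_i a i ^+ 2.
have E i : \sum_j (a i ^+ 2 + a j ^+ 2) / 2 = (#|I|%:R * a i ^+ 2 + S) / 2.
  by rewrite -big_distrl big_split /= sumr_const mulr_natl.
under eq_bigr do rewrite E.
rewrite -big_distrl big_split /= -mulr_sumr sumr_const -/S -mulr_natl; lra.
Qed.

Lemma fourth_sum_le (I : finType) (a : I -> R) :
  (\sum_i a i) ^+ 4 <= #|I|%:R ^+ 3 * \sum_i a i ^+ 4.
Proof.
have -> : (\sum_i a i) ^+ 4 = ((\sum_i a i) ^+ 2) ^+ 2 by rewrite -exprM.
have h := sqr_sum_le a; have h2 := sqr_sum_le (fun i => a i ^+ 2).
apply: (@le_trans _ _ ((#|I|%:R * \sum_i a i ^+ 2) ^+ 2)).
  by rewrite lerXn2r // nnegrE ?sqr_ge0 // mulr_ge0 // sumr_ge0 // => i _; rewrite sqr_ge0.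
rewrite exprMn [_ ^+ 3]exprSr -mulrA ler_wpM2l ?sqr_ge0 //.
apply: le_trans h2 _; rewrite ler_wpM2l //; apply: ler_sum => i _; by rewrite -exprM.
Qed.

Lemma fourth_add_le (x y : R) : (x + y) ^+ 4 <= 8 * (x ^+ 4 + y ^+ 4).
Proof.
have h1 : (x + y) ^+ 2 <= 2 * (x ^+ 2 + y ^+ 2) by have := sqr_ge0 (x - y); lra.
have -> : (x + y) ^+ 4 = ((x + y) ^+ 2) ^+ 2 by ring.
apply: (@le_trans _ _ ((2 * (x ^+ 2 + y ^+ 2)) ^+ 2)).
  by rewrite lerXn2r // nnegrE ?sqr_ge0 // mulr_ge0 // addr_ge0 ?sqr_ge0.
by have := sqr_ge0 (x ^+ 2 - y ^+ 2); lra.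
Qed.

Lemma pow4_le (x b : R) : `|x| <= b -> x ^+ 4 <= b ^+ 4.
Proof.
move=> h; have -> : x ^+ 4 = `|x| ^+ 4 by rewrite -normrX ger0_norm // exprn_even_ge0.
by apply: lerXn2r; rewrite ?nnegrE // (le_trans _ h).
Qed.
End PowerMean.

Section Pointwise.
Context {R : realFieldType} (w u lam : R) (m n : nat).
Hypothesis sc : scale w u lam m n.
Let w_ge := w_ge16 sc.
Let u_ge1 := u_ge1' sc.
Notation bd := (bd w u).
Notation Lam := (lam * (1 - lam)).
Variables (r : nat) (I : inst m n).
Hypothesis cl : cls w u lam r I.
Notation graph := {ffun 'I_m * 'I_n -> bool}.
Implicit Types (G : graph) (i j : 'I_m) (k l : 'I_n).

Lemma bd_mean p e (f : graph -> R) : (forall G, G \in graphs I -> bd p e (f G)) ->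
  bd p e (mean I f).
Proof.
move=> h; apply: le_trans (ler_norm_mean _ _) _; apply: mean_le_cst h.
by rewrite mulr_ge0 ?(we_ge0 w_ge) ?(ue_ge0 u_ge1).
Qed.

Lemma bd_mean_le p e (f g : graph -> R) : (forall G, G \in graphs I -> `|f G| <= g G) ->
  bd p e (mean I g) -> bd p e (mean I f).
Proof.
move=> h hg; apply: bd_norm_le hg => //.
by apply: le_trans (ler_norm_mean _ _) _; apply: ler_mean.
Qed.

Lemma card_blocked_le k l : (#|[pred i | blocked I k l i]| <= hcol I k + hcol I l)%N.
Proof.
rewrite -sum1_card big_mkcond /hcol -big_split /=; apply: leq_sum => i _.
by rewrite inE /blocked; case: (_ \in _); case: (_ \in _).
Qed.

Lemma bd_blocked k l : bd 3 1 (#|blocked I k l|)%:R.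
Proof.
apply: (bd_norm_le w_ge u_ge1 (y := (hcol I k)%:R + (hcol I l)%:R)); last by bdauto.
by rewrite normr_nat -natrD ler_nat card_blocked_le.
Qed.

Lemma bd_cell G e : bd 0 0 ((G e)%:R : R).
Proof. exact: bd_bool. Qed.

Lemma bd_df k l G i : bd 0 0 (df k l G i : R).
Proof. by apply: bd_le1 => //; exact: df_le1. Qed.

Lemma sum_col_cells G k : G \in graphs I -> \sum_i (G (i, k))%:R = (cs I k)%:R :> R.
Proof. by move=> /graphsP[_ <- _]; rewrite natr_sum. Qed.

Lemma sum_row_cells G j : G \in graphs I -> \sum_k (G (j, k))%:R = (rs I j)%:R :> R.
Proof. by move=> /graphsP[<- _ _]; rewrite natr_sum. Qed.

(** An unblocked row that is not free has [df] equal to 0, so [diff] is the difference of the column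
    sums up to the blocked rows. Randomness remains in O~(u) rows only. *)
Lemma diffE k l G : G \in graphs I ->
  diff I k l G = (cs I k)%:R - (cs I l)%:R - \sum_(i | blocked I k l i) df k l G i :> R.
Proof.
move=> hG; rewrite -!(sum_col_cells _ hG) -sumrB [in RHS](bigID (blocked I k l)) /=.
rewrite addrC addrK /diff [in RHS]big_mkcond; apply: eq_bigr => i _.
rewrite /free /df; case: (blocked _ _ _ _) => /=; rewrite ?mul0r //.
by case: (G _); case: (G _) => /=; rewrite ?mul0r ?mul1r ?subrr.
Qed.

Lemma nfreeE k l G : nfree I k l G =
  \sum_(i | ~~ blocked I k l i) ((G (i, k))%:R + (G (i, l))%:R - 2 * (G (i, k))%:R * (G (i, l))%:R) :> R.
Proof.
rewrite /nfree [RHS]big_mkcond; apply: eq_bigr => i _; rewrite /free.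
case: (blocked _ _ _ _) => //=; case: (G _); case: (G _) => /=; ring.
Qed.

Lemma bd_diff k l G : G \in graphs I -> bd 5 1 (diff I k l G : R).
Proof.
move=> hG; rewrite diffE //.
have -> : (cs I k)%:R - (cs I l)%:R = ((cs I k)%:R - lam * m%:R) - ((cs I l)%:R - lam * m%:R) by ring.
have h : bd 3 1 (\sum_(i | blocked I k l i) df k l G i : R).
  by apply: (bd_le w_ge u_ge1 (bd_sum w_ge u_ge1 (bd_blocked k l) (fun i _ => bd_df k l G i))).
by bdauto.
Qed.

Definition cod k l G : R := \sum_i (G (i, k))%:R * (G (i, l))%:R.

Lemma bd_cod k l G : bd 1 2 (cod k l G).
Proof.
have hm : bd 1 2 #|'I_m|%:R by rewrite card_ord; bdauto.
by apply: (bd_le w_ge u_ge1 (bd_sum w_ge u_ge1 hm (fun i _ => bdM w_ge u_ge1 (bd_cell _ _) (bd_cell _ _)))).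
Qed.

Lemma cod_diff k l l' G : k != l -> k != l' -> G \in graphs I ->
  cod k l G - cod k l' G = lin I l l' k G + \sum_(i | blocked I l l' i) (G (i, k))%:R * df l l' G i.
Proof.
move=> h1 h2 hG; rewrite /cod -sumrB /lin [X in _ + X]big_mkcond -big_split /=.
apply: eq_bigr => i _; rewrite /free /df; case: (blocked _ _ _ _) => /=; first by ring.
by case: (G (i, l)); case: (G (i, l')) => /=; ring.
Qed.

Lemma mean_cod_diff4 k l l' : l != l' -> k != l -> k != l' ->
  bd 40 4 (mean I (fun G => (cod k l G - cod k l' G) ^+ 4)).
Proof.
move=> hll hkl hkl'.
pose D := w ^+ 5 * u ^ 1.
have D0 : 0 <= D by rewrite mulr_ge0 ?(we_ge0 w_ge) ?(ue_ge0 u_ge1).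
have hlin := mean_lin4 hll hkl hkl' D0 (fun G => bd_diff l l' (G:=G)).
have hD : bd 5 1 D by rewrite /bd ger0_norm.
have hb : bd 24 4 (mean I (fun G => lin I l l' k G ^+ 4)).
  apply: (bd_norm_le w_ge u_ge1 (y := _)).
    rewrite ger0_norm; first exact: hlin.
    by apply: mean_ge0 => G _; rewrite exprn_even_ge0.
  have -> : 128 * D ^+ 4 + 288 * m%:R ^+ 2 + 28 * m%:R =
    8 * 16 * D ^+ 4 + 2 * 12 * 12 * m%:R ^+ 2 + 2 * 14 * m%:R by ring.
  by bdauto.
apply: (bd_mean_le (g := fun G => 8 * (lin I l l' k G ^+ 4 + (w ^+ 3 * u ^ 1) ^+ 4))).
  move=> G hG; rewrite ger0_norm ?exprn_even_ge0 // cod_diff //.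
  apply: le_trans (fourth_add_le _ _) _; rewrite ler_wpM2l // lerD2l.
  have h : bd 3 1 (\sum_(i | blocked I l l' i) (G (i, k))%:R * df l l' G i : R).
    apply: (bd_le w_ge u_ge1 (bd_sum w_ge u_ge1 (bd_blocked l l')
      (fun i _ => bdM w_ge u_ge1 (bd_cell _ _) (bd_df l l' G i)))) => //.
  exact: pow4_le h.
rewrite meanZ meanD.
have h2 : bd 20 4 (mean I (fun=> (w ^+ 3 * u ^ 1) ^+ 4)).
  apply: bd_mean => G _; have h3 : bd 3 1 (w ^+ 3 * u ^ 1).
    by rewrite /bd ger0_norm // mulr_ge0 ?(we_ge0 w_ge) ?(ue_ge0 u_ge1).
  by bdauto.
by bdauto.
Qed.

Lemma sum_cod k G : G \in graphs I -> \sum_l cod k l G = \sum_i (G (i, k))%:R * (rs I i)%:R.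
Proof.
move=> hG; rewrite /cod exchange_big; apply: eq_bigr => i _.
by rewrite -mulr_sumr (sum_row_cells _ hG).
Qed.

(** The codegrees of [k] with all columns add up to a weighted column sum, known from the degrees.
    Hence [cod k l] is [lam ^+ 2 * m] up to an average of codegree differences, whose fourth moments
    are known. The columns [k] and [l] are split off because that moment bound concerns three
    distinct columns. *)
Lemma cod_center k l G : k != l -> G \in graphs I -> exists B, bd 8 1 B /\
  cod k l G - lam ^+ 2 * m%:R = B + n%:R^-1 * \sum_(l' | (l' != k) && (l' != l)) (cod k l G - cod k l' G).
Proof.
move=> hkl hG.
exists (lam * ((cs I k)%:R - lam * m%:R) + n%:R^-1 * (\sum_i (G (i, k))%:R * ((rs I i)%:R - lam * n%:R))
   + n%:R^-1 * (cod k l G - cod k k G)); split.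
  have hm : bd 1 2 #|'I_m|%:R by rewrite card_ord; bdauto.
  have h : bd 3 3 (\sum_i (G (i, k))%:R * ((rs I i)%:R - lam * n%:R)).
    by apply: (bd_le w_ge u_ge1 (bd_sum w_ge u_ge1 hm (fun i _ => bdM w_ge u_ge1 (bd_cell _ _) (bd_row sc cl i)))).
  have h1 := bd_cod k l G; have h2 := bd_cod k k G.
  by bdauto.
have E : \sum_l' (cod k l G - cod k l' G) = n%:R * cod k l G - lam * n%:R * (cs I k)%:R
     - \sum_i (G (i, k))%:R * ((rs I i)%:R - lam * n%:R).
  have E0 : \sum_i (G (i, k))%:R * (rs I i)%:R =
      lam * n%:R * (cs I k)%:R + \sum_i (G (i, k))%:R * ((rs I i)%:R - lam * n%:R).
    by rewrite -(sum_col_cells _ hG) mulr_sumr -big_split /=; apply: eq_bigr => i _; ring.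
  by rewrite sumrB sumr_const card_ord -[cod k l G *+ n]mulr_natl (sum_cod _ hG) E0; ring.
rewrite (bigD1 k) //= (bigD1 l) 1?eq_sym //= subrr add0r in E.
have -> : \sum_(i < n | (i != k) && (i != l)) (cod k l G - cod k i G) =
  n%:R * cod k l G - lam * n%:R * (cs I k)%:R - \sum_i (G (i, k))%:R * ((rs I i)%:R - lam * n%:R)
   - (cod k l G - cod k k G) by rewrite -E; ring.
have n0 : n%:R != 0 :> R by rewrite lt0r_neq0 ?(sc_n0 sc).
by field.
Qed.

(** The mean of [nfree] for independent cells of density [lam] and no forbidden cells. *)
Definition zeta : R := 2 * Lam * m%:R.

Lemma nfree_center k l G : k != l -> G \in graphs I -> exists B, bd 12 1 B /\
  nfree I k l G - zeta = B - 2 * (n%:R^-1 * \sum_(l' | (l' != k) && (l' != l)) (cod k l G - cod k l' G)).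
Proof.
move=> hkl hG; have [B [hB E]] := cod_center hkl hG.
pose hh i : R := (G (i, k))%:R + (G (i, l))%:R - 2 * (G (i, k))%:R * (G (i, l))%:R.
exists (((cs I k)%:R - lam * m%:R) + ((cs I l)%:R - lam * m%:R) - 2 * B - \sum_(i | blocked I k l i) hh i); split.
  have h : bd 5 1 (\sum_(i | blocked I k l i) hh i).
    apply: (bd_le w_ge u_ge1 (bd_sum w_ge u_ge1 (bd_blocked k l) (k := 2) (e := 0) _)) => // i _.
    have h1 := bd_cell G (i, k); have h2 := bd_cell G (i, l); rewrite /hh; by bdauto.
  by bdauto.
have E2 : nfree I k l G = (cs I k)%:R + (cs I l)%:R - 2 * cod k l G - \sum_(i | blocked I k l i) hh i.
  rewrite nfreeE -!(sum_col_cells _ hG) /cod mulr_sumr -big_split -sumrB /= [in RHS](bigID (blocked I k l)) /=.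
  rewrite [in RHS]addrC; set S1 := \sum_(i < m | _) _; set S2 := \sum_(i < m | _) _; set S3 := \sum_(i < m | _) _.
  have -> : S2 = S1 by apply: eq_bigr => i _; rewrite mulrA.
  have -> : \sum_(i < m | blocked I k l i) hh i = S3 by apply: eq_bigr => i _; rewrite /hh mulrA.
  by rewrite addrK.
rewrite E2 /zeta; set S := \sum_(l' | _) _ in E *.
have -> : cod k l G = B + n%:R^-1 * S + lam ^+ 2 * m%:R by rewrite -E subrK.
ring.
Qed.

(** Up to O~(u), [nfree] is an affine function of the codegree; the power mean inequality carries
    the fourth moment through the average over the columns [l']. *)
Lemma mean_nfree4 k l : k != l -> bd 80 4 (mean I (fun G => (nfree I k l G - zeta) ^+ 4)).
Proof.
move=> hkl.
pose g G : R := 8 * ((w ^+ 12 * u ^ 1) ^+ 4 +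
   16 * (n%:R^-1 * \sum_(l' | (l' != k) && (l' != l)) (cod k l G - cod k l' G) ^+ 4)).
apply: (bd_mean_le (g := g)).
  move=> G hG; rewrite ger0_norm ?exprn_even_ge0 //.
  have [B [hB ->]] := nfree_center hkl hG; rewrite /g.
  apply: le_trans (fourth_add_le _ _) _; rewrite ler_wpM2l //; apply: lerD.
    exact: pow4_le hB.
  set S := \sum_(l' | _) _; set S4 := \sum_(l' | _) _.
  have -> : (- (2 * (n%:R^-1 * S))) ^+ 4 = 16 * (n%:R^-1 ^+ 4 * S ^+ 4) by ring.
  rewrite ler_wpM2l //.
  have n0 : n%:R != 0 :> R by rewrite lt0r_neq0 ?(sc_n0 sc).
  have -> : n%:R^-1 * S4 = n%:R^-1 ^+ 4 * (n%:R ^+ 3 * S4) by field.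
  rewrite ler_wpM2l ?exprn_ge0 ?invr_ge0 //.
  rewrite /S big_mkcond /S4 [in leRHS]big_mkcond /=.
  apply: le_trans (fourth_sum_le _) _; rewrite card_ord ler_wpM2l ?exprn_ge0 //.
  by apply: ler_sum => i _; case: ifP => // _; rewrite expr0n.
rewrite /g meanZ meanD [X in _ + X]meanZ [X in 16 * X]meanZ mean_sum.
have h1 : bd 50 4 (mean I (fun=> (w ^+ 12 * u ^ 1) ^+ 4)).
  apply: bd_mean => G _; have h3 : bd 12 1 (w ^+ 12 * u ^ 1).
    by rewrite /bd ger0_norm // mulr_ge0 ?(we_ge0 w_ge) ?(ue_ge0 u_ge1).
  by bdauto.
have h2 : bd 41 6 (\sum_(i | (i != k) && (i != l)) mean I (fun G => (cod k l G - cod k i G) ^+ 4)).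
  apply: (bd_le w_ge u_ge1 (bd_sum w_ge u_ge1 (k' := 0) (e' := 2) (k := 40) (e := 4) _ _)) => //.
    apply: (bd_norm_le w_ge u_ge1 (y := n%:R)); last by bdauto.
    by rewrite normr_nat ler_nat -[X in (_ <= X)%N]card_ord max_card.
  by move=> i /andP[h3 h4]; apply: mean_cod_diff4; rewrite // eq_sym.
by bdauto.
Qed.

End Pointwise.

(** * Cell probabilities to order zero *)

Section Ratio.
Context {R : realFieldType}.
Variables (d z t : R).
Hypotheses (t0 : 0 < t) (dz : `|d| <= z).

(** For small [z] the relative deviation is at least 1/2, so 16 times its fourth power pays for the
    trivial bound [|d / z| <= 1]. *)
Lemma small_quot : z < t / 2 -> 1 <= 16 * ((z - t) / t) ^+ 4.
Proof.
move=> h; have h1 : (t - z) / t >= 1 / 2 by rewrite ler_pdivlMr //; lra.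
have h2 : ((t - z) / t) ^+ 4 >= (1 / 2) ^+ 4.
  have h0 : 0 <= 1 / 2 :> R by lra.
  by apply: lerXn2r; rewrite ?nnegrE // (le_trans h0 h1).
have -> : (z - t) / t = - ((t - z) / t) by field; rewrite gt_eqF.
have -> : (- ((t - z) / t)) ^+ 4 = ((t - z) / t) ^+ 4 by ring.
by lra.
Qed.

Lemma z_ge0 : 0 <= z. Proof. exact: le_trans dz. Qed.

Lemma quot_le1 : `|d / z| <= 1.
Proof.
have [->|z0] := eqVneq z 0; first by rewrite invr0 mulr0 normr0.
have zp : 0 < z by rewrite lt_def z0 z_ge0.
by rewrite normrM normfV [`|z|]gtr0_norm // ler_pdivrMr // mul1r.
Qed.

Lemma quot_le : z >= t / 2 -> `|d / z| <= 2 * `|d| / t.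
Proof.
move=> h; have t0' := t0; have zp : 0 < z by lra.
rewrite normrM normfV [`|z|]gtr0_norm // ler_pdivrMr //.
have -> : 2 * `|d| / t * z = `|d| * (z * 2 / t) by field; rewrite gt_eqF.
by rewrite ler_peMr // ler_pdivlMr // mul1r; lra.
Qed.

Lemma quot_bound0 : `|d / z| <= 2 * `|d| / t + 16 * ((z - t) / t) ^+ 4.
Proof.
have p1 : 0 <= 2 * `|d| / t by rewrite !mulr_ge0 ?invr_ge0 ?(ltW t0).
have p2 : 0 <= 16 * ((z - t) / t) ^+ 4 by rewrite mulr_ge0 // exprn_even_ge0.
have [h|h] := lerP (t / 2) z; first by have := quot_le h; lra.
have := small_quot h; have := quot_le1; lra.
Qed.

Lemma quot_expand1 : d / z - d / t = - (d / z) * ((z - t) / t).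
Proof.
have [z0|z0] := eqVneq z 0.
  have d0 : d = 0 by apply/eqP; rewrite -normr_le0 -z0.
  by rewrite d0 !mul0r !oppr0 mul0r addr0.
by field; rewrite z0 gt_eqF.
Qed.

Lemma quot_bound1 :
  `|d / z - d / t| <= 2 * `|d| / t * (`|z - t| / t) + 16 * ((z - t) / t) ^+ 4.
Proof.
have p1 : 0 <= 2 * `|d| / t * (`|z - t| / t) by rewrite !mulr_ge0 ?invr_ge0 ?(ltW t0).
have p2 : 0 <= 16 * ((z - t) / t) ^+ 4 by rewrite mulr_ge0 // exprn_even_ge0.
rewrite quot_expand1 normrM normrN [`|(z - t) / t|]normrM [`|t^-1|]gtr0_norm ?invr_gt0 //.
have p3 : 0 <= `|z - t| / t by rewrite mulr_ge0 // invr_ge0 (ltW t0).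
have [h|h] := lerP (t / 2) z; first by have := ler_wpM2r p3 (quot_le h); lra.
have h1 : `|z - t| / t <= 1.
  by rewrite ler_pdivrMr // mul1r ler_norml; have := z_ge0; have := t0; move=> ? ?; apply/andP; split; lra.
have := ler_pM (normr_ge0 _) p3 quot_le1 h1; have := small_quot h; lra.
Qed.

Lemma quot_bound2 : `|d / z - d / t + d * (z - t) / t ^+ 2| <=
  2 * `|d| / t * ((z - t) ^+ 2 / t ^+ 2) + 16 * ((z - t) / t) ^+ 4.
Proof.
have p3 : 0 <= (z - t) ^+ 2 / t ^+ 2 by rewrite mulr_ge0 ?invr_ge0 ?sqr_ge0.
have p1 : 0 <= 2 * `|d| / t * ((z - t) ^+ 2 / t ^+ 2).
  by rewrite mulr_ge0 // !mulr_ge0 ?invr_ge0 ?(ltW t0).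
have p2 : 0 <= 16 * ((z - t) / t) ^+ 4 by rewrite mulr_ge0 // exprn_even_ge0.
have -> : d / z - d / t + d * (z - t) / t ^+ 2 = (d / z) * ((z - t) ^+ 2 / t ^+ 2).
  rewrite quot_expand1.
  have -> : d * (z - t) / t ^+ 2 = (d / z - (d / z - d / t)) * ((z - t) / t).
    have E (a b : R) : a - (a - b) = b by ring.
    by rewrite E; field; rewrite gt_eqF.
  by rewrite quot_expand1; move: (d / z) => e; field; rewrite gt_eqF.
rewrite normrM (ger0_norm p3).
have [h|h] := lerP (t / 2) z; first by have := ler_wpM2r p3 (quot_le h); lra.
have h1 : (z - t) ^+ 2 / t ^+ 2 <= 1.
  rewrite ler_pdivrMr ?exprn_gt0 // mul1r; have := z_ge0; have t0' := t0; nra.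
have := ler_pM (normr_ge0 _) p3 quot_le1 h1; have := small_quot h; lra.
Qed.
End Ratio.

Section ZerothOrder.
Context {R : realFieldType} (w u lam : R) (m n : nat).
Hypothesis sc : scale w u lam m n.
Let w_ge := w_ge16 sc.
Let u_ge1 := u_ge1' sc.
Notation bd := (bd w u).
Notation Lam := (lam * (1 - lam)).
Notation zeta := (zeta lam m).
Variables (r : nat) (I : inst m n).
Hypothesis cl : cls w u lam r I.
Notation graph := {ffun 'I_m * 'I_n -> bool}.
Implicit Types (G : graph) (i j : 'I_m) (k l : 'I_n).

Lemma zeta_gt0 : 0 < zeta.
Proof. by rewrite /zeta !mulr_gt0 ?(sc_Lam0 sc) ?(sc_m0 sc) // ?(lam_gt0 sc) ?subr_gt0 ?(lam_lt1 sc). Qed.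

Lemma bd_zeta : bd 4 2 zeta.
Proof. rewrite /zeta; bdauto. Qed.

Lemma bd_zetainv : bd 3 (-2) zeta^-1.
Proof. rewrite /zeta invfM [(2 * _)^-1]invfM; bdauto. Qed.

Section Pair.
Variables (k l : 'I_n).
Hypothesis neq : k != l.

Lemma bd_mean_quot4 : bd 100 (-4) (mean I (fun G => 16 * ((nfree I k l G - zeta) / zeta) ^+ 4)).
Proof.
have h := mean_nfree4 sc cl neq; have hz := bd_zetainv.
rewrite (@eq_mean _ _ _ _ _ (fun G => (16 * zeta^-1 ^+ 4) * (nfree I k l G - zeta) ^+ 4)); last first.
  by move=> G _; rewrite [_ / zeta]mulrC exprMn mulrA.
rewrite meanZ; bdauto.
Qed.

Lemma bd_mean_dev2 : bd 90 2 (mean I (fun G => (nfree I k l G - zeta) ^+ 2)).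
Proof.
have h := mean_nfree4 sc cl neq.
have u0 := sc_u0 sc; have u2 : 0 < u ^+ 2 by rewrite exprn_gt0.
(* [y ^+ 2 <= u ^+ 2 + y ^+ 4 / u ^+ 2] takes the place of the Cauchy-Schwarz inequality. *)
apply: (bd_mean_le sc (g := fun G => u ^+ 2 + (u^-1) ^+ 2 * (nfree I k l G - zeta) ^+ 4)).
  move=> G _; rewrite ger0_norm ?sqr_ge0 //; set y := _ - _.
  have -> : u^-1 ^+ 2 * y ^+ 4 = y ^+ 4 / u ^+ 2 by field; rewrite gt_eqF.
  rewrite -(ler_pM2r u2) mulrDl divfK ?gt_eqF //.
  have := sqr_ge0 (y ^+ 2 - u ^+ 2); have := sqr_ge0 (y ^+ 2 * 1); have := sqr_ge0 (u ^+ 2).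
  have -> : y ^+ 4 = (y ^+ 2) ^+ 2 by ring.
  nra.
have hu : bd 0 (-1) u^-1 by rewrite /bd mul1r ger0_norm ?invr_ge0 ?(ltW u0) // exprN1.
have h2 : bd 0 2 (mean I (fun=> u ^+ 2)) by apply: (bd_mean sc) => G _; bdauto.
rewrite meanD [X in _ + X]meanZ; bdauto.
Qed.

Lemma bd_mean_dev1 : bd 95 1 (mean I (fun G => `|nfree I k l G - zeta|)).
Proof.
have h := bd_mean_dev2.
have u0 := sc_u0 sc.
have hu : bd 0 (-1) u^-1 by rewrite /bd mul1r ger0_norm ?invr_ge0 ?(ltW u0) // exprN1.
apply: (bd_mean_le sc (g := fun G => u + u^-1 * (nfree I k l G - zeta) ^+ 2)).
  move=> G _; rewrite normr_id; set y := _ - _.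
  have -> : y ^+ 2 = `|y| ^+ 2 by rewrite real_normK ?num_real.
  have -> : u^-1 * `|y| ^+ 2 = `|y| ^+ 2 / u by rewrite mulrC.
  rewrite -(ler_pM2r u0) mulrDl divfK ?gt_eqF //.
  by have := sqr_ge0 (`|y| - u); have := normr_ge0 y; nra.
have h2 : bd 0 1 (mean I (fun=> u)) by apply: (bd_mean sc) => G _; bdauto.
rewrite meanD [X in _ + X]meanZ; bdauto.
Qed.

Lemma Pr_diff0 j : ~~ blocked I k l j -> bd 110 (-1) (Pr I (j, k) - Pr I (j, l) : R).
Proof.
move=> hj.
have -> : Pr I (j, k) - Pr I (j, l) = mean I (fun G => df k l G j) :> R by rewrite /Pr -meanB.
rewrite (mean_df neq hj).
apply: (bd_mean_le sc (g := fun G => 2 * (w ^+ 5 * u ^ 1) / zeta + 16 * ((nfree I k l G - zeta) / zeta) ^+ 4)).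
  move=> G hG; rewrite normrM normr_nat.
  apply: (@le_trans _ _ `|diff I k l G / nfree I k l G|).
    by case: (free _ _ _ _ _); rewrite ?mul1r ?mul0r.
  apply: le_trans (quot_bound0 zeta_gt0 (diff_le_nfree I k l G)) _.
  rewrite lerD2r ler_wpM2r ?invr_ge0 ?(ltW zeta_gt0) // ler_wpM2l //.
  exact: (bd_diff sc cl).
rewrite meanD; have hz := bd_zetainv; have h4 := bd_mean_quot4.
have h : bd 20 (-1) (mean I (fun=> 2 * (w ^+ 5 * u ^ 1) / zeta)).
  apply: (bd_mean sc) => G _.
  have h : bd 5 1 (w ^+ 5 * u ^ 1).
    by rewrite /bd ger0_norm // mulr_ge0 ?(we_ge0 w_ge) ?(ue_ge0 u_ge1).
  bdauto.
bdauto.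
Qed.
End Pair.

Lemma card_row_avail j : #|[pred l | (j, l) \notin forb I]|%:R = n%:R - (hrow I j)%:R :> R.
Proof.
have E : #|[predC [pred l | (j, l) \notin forb I]]| = hrow I j.
  by rewrite -sum1_card big_mkcond; apply: eq_bigr => l _; rewrite !inE /= negbK; case: (_ \in _).
have := cardC [pred l | (j, l) \notin forb I]; rewrite E card_ord => h.
by apply/eqP; rewrite eq_sym subr_eq -natrD h.
Qed.

(** Turns differences within a row into values: the row sum is the missing equation. *)
Lemma row_balance j k : nonempty I ->
  (n%:R - (hrow I j)%:R) * Pr I (j, k) =
  (rs I j)%:R + \sum_(l | (j, l) \notin forb I) (Pr I (j, k) - Pr I (j, l)) :> R.
Proof.
move=> h; rewrite sumrB -(sum_row_Pr (R := R) j h).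
have -> : \sum_(l | (j, l) \notin forb I) Pr I (j, k) = (n%:R - (hrow I j)%:R) * Pr I (j, k) :> R.
  by rewrite -card_row_avail -sum1_card natr_sum mulr_suml; apply: eq_big => l; rewrite ?inE ?mul1r.
rewrite [\sum_l Pr _ _](bigID (fun l => (j, l) \notin forb I)) /= [X in _ + X + _]big1; first by ring.
by move=> l; rewrite negbK => hl; rewrite Pr_forb.
Qed.

Lemma bd_row_avail j : bd 0 2 #|[pred l | (j, l) \notin forb I]|%:R.
Proof.
apply: (bd_norm_le w_ge u_ge1 (y := n%:R)); last by bdauto.
by rewrite normr_nat ler_nat -[X in (_ <= X)%N]card_ord max_card.
Qed.

Lemma nx_neq0 j : n%:R - (hrow I j)%:R != 0 :> R.
Proof. by have := nx_ge sc cl j; have := sc_n0 sc => h1 h2; rewrite lt0r_neq0 //; lra. Qed.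

Lemma blockedE j k l : (j, k) \notin forb I -> (j, l) \notin forb I -> ~~ blocked I k l j.
Proof. by rewrite /blocked negb_or => -> ->. Qed.

Lemma Pr_zeroth j k : nonempty I -> (j, k) \notin forb I -> bd 120 (-1) (Pr I (j, k) - lam).
Proof.
move=> h0 hjk.
have -> : Pr I (j, k) - lam = (n%:R - (hrow I j)%:R)^-1 * (((rs I j)%:R - lam * n%:R) + lam * (hrow I j)%:R
   + \sum_(l | (j, l) \notin forb I) (Pr I (j, k) - Pr I (j, l))).
  have := row_balance j k h0; set S := \sum_(l | _) _ => E.
  have -> : S = (n%:R - (hrow I j)%:R) * Pr I (j, k) - (rs I j)%:R by rewrite E addrC addKr.
  by field; exact: nx_neq0.
have hs : bd 110 1 (\sum_(l | (j, l) \notin forb I) (Pr I (j, k) - Pr I (j, l)) : R).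
  apply: (bd_le w_ge u_ge1 (bd_sum w_ge u_ge1 (bd_row_avail j) (k := 110) (e := -1) _)) => // l hl.
  have [->|ne] := eqVneq k l; first by rewrite subrr; bdauto.
  by apply: Pr_diff0; rewrite // blockedE.
bdauto.
Qed.

End ZerothOrder.

(** * Joint probabilities of several cells *)

Section Joint.
Context {R : realFieldType} {m n : nat}.
Notation graph := {ffun 'I_m * 'I_n -> bool}.
Notation cell := ('I_m * 'I_n)%type.
Notation inst := (inst m n).
Implicit Types (G : graph) (es : seq cell) (I : inst).

Definition prodc es G : R := \prod_(e <- es) (G e)%:R.

(** [Q r I] says that [r] more cells of [I] may be exposed; along the way [q] predicts every single
    cell up to [B]. *)
Variables (Q : nat -> inst -> Prop) (q : cell -> R) (B : R).
Hypotheses (B0 : 0 <= B) (q1 : forall e, `|q e| <= 1).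
Hypothesis Qpos : forall r I e, Q r.+1 I -> (0 < rs I e.1)%N /\ (0 < cs I e.2)%N.
Hypothesis Qocc : forall r I e, Q r.+1 I -> e \notin forb I -> Q r (occ I e).
Hypothesis QB : forall r I e, Q r.+1 I -> nonempty I -> e \notin forb I -> `|Pr I e - q e| <= B.

Lemma prod_norm_le1 es : `|\prod_(e <- es) q e| <= 1.
Proof.
elim: es => [|e es IH]; first by rewrite big_nil normr1.
by rewrite big_cons normrM mulr_ile1.
Qed.

(* expose the cells one at a time: an occupied cell only changes the instance *)
Lemma joint_approx es r I : Q (size es + r) I -> nonempty I -> uniq es ->
  all (fun e => e \notin forb I) es ->
  `|mean I (prodc es) - \prod_(e <- es) q e| <= (size es)%:R * B.
Proof.
elim: es r I => [|e es IH] r I hQ h0 /=.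
  move=> _ _; rewrite big_nil mul0r (@eq_mean _ _ _ _ _ (fun=> 1)) ?mean_cst ?subrr ?normr0 //.
  by move=> G _; rewrite /prodc big_nil.
move=> /andP[he hu] /andP[hI hall]; rewrite big_cons.
have [hr hc] := Qpos e hQ.
have hocc := Qocc hQ hI.
have E : mean I (prodc (e :: es)) = Pr I e * mean (occ I e) (prodc es).
  rewrite -mean_occ //; last first.
    move=> G; rewrite /prodc; apply: eq_big_seq => e' he'; rewrite ffunE.
    by case: eqP he' he => // -> ->.
  by apply: eq_mean => G _; rewrite /prodc big_cons.
have hP := QB hQ h0 hI.
have hM : `|mean (occ I e) (prodc es)| <= 1.
  apply: mean_norm_le1 => G _; rewrite /prodc -natr_prod normr_nat.
  by rewrite (_ : 1 = 1%:R) // ler_nat; elim: (es) => [|a s IHs]; rewrite ?big_nil // big_cons; case: (G a); rewrite ?mul1n.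
(* If no graph occupies [e], its probability is 0, so the prediction [q e] is itself at most [B] in
   absolute value. *)
rewrite E; case: (posnP #|graphs (occ I e)|) => [hz|hp].
  have M0 : forall f : graph -> R, mean (occ I e) f = 0 by move=> f; rewrite /mean hz invr0 mulr0.
  have P0 : Pr I e = 0 :> R.
    have := mean_occ hI hr hc (f := fun=> 1 : R) (fun=> erefl).
    by rewrite M0 mulr0 => <-; apply: eq_mean => G _; rewrite mulr1.
  rewrite M0 mulr0 sub0r normrN normrM; rewrite P0 sub0r normrN in hP.
  apply: (@le_trans _ _ (B * 1)); first by apply: ler_pM => //; exact: prod_norm_le1.
  by rewrite mulr1 ler_peMl // ler1n.
have hIH := IH r (occ I e) hocc hp hu.
have {hIH}hIH : `|mean (occ I e) (prodc es) - \prod_(e0 <- es) q e0| <= (size es)%:R * B.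
  apply: hIH; apply/allP => e' he'; rewrite /= in_setU1 negb_or (allP hall) // andbT.
  by apply: contraNneq he => <-.
have -> : Pr I e * mean (occ I e) (prodc es) - q e * \prod_(j <- es) q j =
   (Pr I e - q e) * mean (occ I e) (prodc es) +
   q e * (mean (occ I e) (prodc es) - \prod_(j <- es) q j) by ring.
apply: le_trans (ler_normD _ _) _; rewrite normrM [X in _ + X]normrM.
have h1 := ler_pM (normr_ge0 _) (normr_ge0 _) hP hM.
have h2 := ler_pM (normr_ge0 _) (normr_ge0 _) (q1 e) hIH.
by apply: le_trans (lerD h1 h2) _; rewrite mulr1 mul1r -[X in X + _]mul1r -mulrDl -natr1 addrC.
Qed.
End Joint.

(** * How exposing a cell changes the class of instances and the predictions *)

Section Occ.
Context {R : realFieldType} (w u lam : R) (m n : nat).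
Hypothesis sc : scale w u lam m n.
Let w_ge := w_ge16 sc.
Let u_ge1 := u_ge1' sc.
Notation bd := (bd w u).
Notation Lam := (lam * (1 - lam)).
Implicit Types (I : inst m n) (e : 'I_m * 'I_n).

Lemma cls_mono r r' I : cls w u lam r I -> (r <= r')%N -> (r' <= 16)%N -> cls w u lam r' I.
Proof.
move=> [h1 h2 h3 h4 h5 h6 h7 h8] hr hr'.
have hR : r%:R <= r'%:R :> R by rewrite ler_nat.
by split => // [|j|k|j|k|]; [have := h3 | have := h4 j | have := h5 k | have := h6 j | have := h7 k | have := h8];
  move=> h; apply: le_trans h _; rewrite ?lerD2l.
Qed.

Lemma lam_big : w ^+ 4 * u <= w ^+ 2 * (lam * m%:R) /\ w ^+ 4 * u <= w ^+ 2 * (lam * n%:R).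
Proof.
have hl : 1 <= w * lam.
  apply: le_trans (lam_var sc) _; rewrite ler_pM2l ?(sc_w0 sc) // ler_piMr ?(ltW (lam_gt0 sc)) //.
  by rewrite lerBlDr lerDl (ltW (lam_gt0 sc)).
have hu : w ^+ 4 * u <= n%:R.
  by rewrite -(u_sqr sc) expr2 ler_wpM2r ?(ltW (sc_u0 sc)) // (w_pow_le sc).
have w0 := sc_w0 sc.
have h1 : n%:R <= w * (lam * (w * n%:R)).
  have -> : w * (lam * (w * n%:R)) = (w * lam) * (w * n%:R) by ring.
  apply: (@le_trans _ _ (1 * (1 * n%:R))); first by rewrite !mul1r.
  by apply: ler_pM; rewrite ?mul1r // ler_peMl ?ler0n // (sc_w1 sc).
have h2 : n%:R <= w * (lam * (w * m%:R)).
  have -> : w * (lam * (w * m%:R)) = (w * lam) * (w * m%:R) by ring.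
  apply: le_trans (n_le sc) _; rewrite ler_peMl // mulr_ge0 //; exact: ltW.
by split; apply: le_trans hu _; [apply: le_trans h2 _ | apply: le_trans h1 _]; rewrite le_eqVlt; apply/orP; left; apply/eqP; ring.
Qed.

Lemma cls_pos r I e : cls w u lam r I -> (0 < rs I e.1)%N /\ (0 < cs I e.2)%N.
Proof.
move=> cl; have [h1 h2] := lam_big; have hw := wur_bd sc cl.
have w0 := sc_w0 sc; have u0 := sc_u0 sc.
have hw3 : w ^+ 2 * (2 * w * u) < w ^+ 4 * u.
  have -> : w ^+ 2 * (2 * w * u) = (w ^+ 3 * u) * 2 by ring.
  have -> : w ^+ 4 * u = (w ^+ 3 * u) * w by ring.
  rewrite ltr_pM2l ?mulr_gt0 ?exprn_gt0 //; apply: lt_le_trans w_ge; by rewrite ltr_nat.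
have P x y : w ^+ 4 * u <= w ^+ 2 * y -> `|x - y| <= w * u + r%:R -> 0 < x.
  move=> hy; rewrite ler_norml => /andP[hx _].
  have : w ^+ 2 * (2 * w * u) < w ^+ 2 * y by apply: lt_le_trans hy.
  by rewrite ltr_pM2l ?exprn_gt0 // => h; lra.
by split; rewrite -(ltr_nat R); [apply: (P _ _ h2 (row_dev cl e.1)) | apply: (P _ _ h1 (col_dev cl e.2))].
Qed.

Lemma hrow_occ I e j : e \notin forb I -> hrow (occ I e) j = (hrow I j + (j == e.1))%N.
Proof.
case: e => a b hab; rewrite /hrow /=; case: (eqVneq j a) => [->|ne]; last first.
  by rewrite addn0; apply: eq_bigr => k _; rewrite in_setU1 xpair_eqE (negbTE ne).
rewrite (bigD1 b) //= [in RHS](bigD1 b) //= in_setU1 eqxx (negbTE hab) /= add0n addnC; congr (_ + _)%N.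
by apply: eq_bigr => k hk; rewrite in_setU1 xpair_eqE (negbTE hk) andbF.
Qed.

Lemma hcol_occ I e k : e \notin forb I -> hcol (occ I e) k = (hcol I k + (k == e.2))%N.
Proof.
case: e => a b hab; rewrite /hcol /=; case: (eqVneq k b) => [->|ne]; last first.
  by rewrite addn0; apply: eq_bigr => j _; rewrite in_setU1 xpair_eqE (negbTE ne) andbF.
rewrite (bigD1 a) //= [in RHS](bigD1 a) //= in_setU1 eqxx (negbTE hab) /= add0n addnC; congr (_ + _)%N.
by apply: eq_bigr => j hj; rewrite in_setU1 xpair_eqE (negbTE hj).
Qed.

Lemma sum_sub1 (p : nat) (f : 'I_p -> nat) (a : 'I_p) : (0 < f a)%N ->
  (\sum_i (f i - (i == a)) = (\sum_i f i).-1)%N.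
Proof.
move=> h; rewrite (bigD1 a) //= [in RHS](bigD1 a) //= eqxx.
have -> : (\sum_(i < p | i != a) (f i - (i == a)) = \sum_(i < p | i != a) f i)%N.
  by apply: eq_bigr => i /negbTE ->; rewrite subn0.
by case: (f a) h => // x _; rewrite subn1 addSn.
Qed.

Lemma natr_sub_bool (x : nat) (b : bool) : (b -> 0 < x)%N -> (x - b)%:R = x%:R - b%:R :> R.
Proof. by case: b => h; rewrite ?subn0 ?subr0 // natrB //; exact: h. Qed.

Lemma cls_occ r I e : cls w u lam r I -> (r < 16)%N -> e \notin forb I ->
  cls w u lam r.+1 (occ I e).
Proof.
move=> cl hr he; have [pr pc] := cls_pos e cl.
have step (x y c : R) (b : bool) : `|x - y| <= c -> `|x - b%:R - y| <= c + 1.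
  move=> h; have -> : x - b%:R - y = (x - y) - b%:R by ring.
  apply: le_trans (ler_normB _ _) _; apply: lerD => //.
  by rewrite normr_nat; case: b.
have prs j : ((rs I j - (j == e.1))%N%:R = (rs I j)%:R - (j == e.1)%:R :> R).
  by apply: natr_sub_bool => /eqP ->.
have pcs k : ((cs I k - (k == e.2))%N%:R = (cs I k)%:R - (k == e.2)%:R :> R).
  by apply: natr_sub_bool => /eqP ->.
case: cl => [h1 h2 h3 h4 h5 h6 h7 h8]; split => //.
- by rewrite /= !sum_sub1 // h2.
- rewrite /= sum_sub1 // -subn1 natrB; last by rewrite (bigD1 e.1) //= ltn_addr.
  by rewrite -[r.+1%:R]natr1; exact: (step _ _ _ true h3).
- by move=> j /=; rewrite prs -[r.+1%:R]natr1 addrA; apply: step.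
- by move=> k /=; rewrite pcs -[r.+1%:R]natr1 addrA; apply: step.
- by move=> j; rewrite hrow_occ // natrD -[r.+1%:R]natr1 addrA lerD //; case: (_ == _).
- by move=> k; rewrite hcol_occ // natrD -[r.+1%:R]natr1 addrA lerD //; case: (_ == _).
- by rewrite /= cardsU1 he natrD -[r.+1%:R]natr1 addrC addrA lerD2r.
Qed.

(** The prediction of a cell probability to first order in the row and column deviations. *)
Definition pf I e : R := lam + idlt lam I e.1 / n%:R + ieta lam I e.2 / m%:R.

(** The shift is O~(u^-2), the error of the first order prediction itself, so boundedly many
    exposures may keep the original prediction. *)
Lemma pf_occ r I e e' : cls w u lam r I -> e \notin forb I ->
  `|pf (occ I e) e' - pf I e'| <= n%:R^-1 + m%:R^-1.
Proof.
move=> cl he; have [pr pc] := cls_pos e cl.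
have prs j : ((rs I j - (j == e.1))%N%:R = (rs I j)%:R - (j == e.1)%:R :> R).
  by apply: natr_sub_bool => /eqP ->.
have pcs k : ((cs I k - (k == e.2))%N%:R = (cs I k)%:R - (k == e.2)%:R :> R).
  by apply: natr_sub_bool => /eqP ->.
have -> : pf (occ I e) e' - pf I e' = ((lam - 1) * (e'.1 == e.1)%:R) / n%:R + ((lam - 1) * (e'.2 == e.2)%:R) / m%:R.
  by rewrite /pf /idlt /ieta /= prs pcs hrow_occ // hcol_occ // !natrD; ring.
have hb (b : bool) : `|(lam - 1) * b%:R| <= 1.
  rewrite normrM normr_nat; have := lam_gt0 sc; have := lam_lt1 sc => l1 l0.
  have hl : `|lam - 1| <= 1 by rewrite ler_norml; apply/andP; split; lra.
  by case: b; rewrite ?mulr1 ?mulr0.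
have inv_le (x p : R) : 0 < p -> `|x| <= 1 -> `|x / p| <= p^-1.
  by move=> p0 hx; rewrite normrM normfV (gtr0_norm p0) ler_piMl // invr_ge0 ltW.
apply: le_trans (ler_normD _ _) _; apply: lerD; apply: inv_le; rewrite ?(sc_n0 sc) ?(sc_m0 sc) //.
Qed.

Lemma pf_le1 r I e : cls w u lam r I -> `|pf I e| <= 1.
Proof.
move=> cl; have hb : bd 6 (-1) (idlt lam I e.1 / n%:R + ieta lam I e.2 / m%:R) by bdauto.
have w0 := sc_w0 sc; have u0 := sc_u0 sc.
have hs : w ^+ 6 * u ^ (-1) <= w^-1.
  rewrite exprN1 ler_pdivrMr // mulrC ler_pdivlMr // -exprSr; exact: (w_pow_le sc).
have hL : w^-1 <= Lam by rewrite -div1r ler_pdivrMr // mulrC (lam_var sc).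
have := le_trans hb hs; rewrite /pf -addrA ler_norml => /andP[h1 h2].
have l0 := lam_gt0 sc; have l1 := lam_lt1 sc.
have hL1 : Lam <= lam by rewrite ler_piMr ?(ltW l0) // lerBlDr lerDl ltW.
have hL2 : Lam <= 1 - lam by rewrite ler_piMl ?subr_ge0 ?(ltW l1).
clear hb hs; rewrite ler_norml; apply/andP; split; lra.
Qed.

Lemma joint0 r I (es : seq ('I_m * 'I_n)) : cls w u lam r I -> (r + size es <= 16)%N -> nonempty I ->
  uniq es -> all (fun e => e \notin forb I) es ->
  bd 122 (-1) (mean I (prodc es) - lam ^+ size es).
Proof.
move=> cl hr h0 hu hall.
pose Q k (J : inst m n) := (k <= 16)%N /\ cls w u lam (16 - k) J.
pose B := w ^+ 120 * u ^ (-1).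
have B0 : 0 <= B by rewrite mulr_ge0 ?(we_ge0 w_ge) ?(ue_ge0 u_ge1).
have hl : lam ^+ size es = \prod_(e <- es) lam by rewrite big_const_seq count_predT -Monoid.iteropE.
rewrite hl; apply: (bd_norm_le w_ge u_ge1 (y := (size es)%:R * B)); last first.
  have hB : bd 120 (-1) B by rewrite /bd ger0_norm.
  have hs : (size es <= 16)%N by apply: leq_trans hr; rewrite leq_addl.
  have hsz := bd_natr w_ge u_ge1 hs.
  by apply: (bd_le w_ge u_ge1 (bdM w_ge u_ge1 hsz hB)).
apply: (@joint_approx _ _ _ Q (fun=> lam) B _ _ _ _ _ es (16 - r - size es)) => //.
- by move=> _; rewrite ger0_norm ?(ltW (lam_gt0 sc)) ?(ltW (lam_lt1 sc)).
- by move=> k J e [_ hJ]; exact: cls_pos hJ.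
- move=> k J e [hk hJ] he; split; first exact: ltnW.
  by rewrite (_ : (16 - k = (16 - k.+1).+1)%N); [apply: cls_occ; rewrite ?ltn_subrL | lia].
- by move=> k J [a b] [hk hJ] hne he; exact: (Pr_zeroth sc hJ hne).
- split; first by lia.
  by apply: (cls_mono cl); lia.
Qed.

End Occ.

(** * Means of products of [hh], [diff] and cells, from joint cell probabilities *)

Section PairWeights.
Context {R : realFieldType} (w u lam : R) (m n : nat).
Hypothesis sc : scale w u lam m n.
Let w_ge := w_ge16 sc.
Let u_ge1 := u_ge1' sc.
Notation bd := (bd w u).
Variables (r : nat) (I : inst m n).
Hypothesis cl : cls w u lam r I.
Hypothesis ne : nonempty I.
Notation graph := {ffun 'I_m * 'I_n -> bool}.
Notation cell := ('I_m * 'I_n)%type.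
Implicit Types (G : graph) (i j : 'I_m) (es : seq cell).

Variables (q : cell -> R) (p : nat) (e0 : int).
Hypothesis q1 : forall e, `|q e| <= 1.
Hypothesis joint : forall es, (size es <= 6)%N -> uniq es ->
  all (fun e => e \notin forb I) es -> bd p e0 (mean I (prodc es) - \prod_(e <- es) q e).

Variables (k l : 'I_n).
Hypothesis neq : k != l.

(* [hh j] indicates that row [j] differs in the columns [k] and [l]; [ppi j] is its predicted mean. *)
Definition hh j G : R := (G (j, k))%:R + (G (j, l))%:R - 2 * (G (j, k))%:R * (G (j, l))%:R.
Definition ppi j : R := q (j, k) + q (j, l) - 2 * q (j, k) * q (j, l).
Definition qt e : R := (e \notin forb I)%:R * q e.

Lemma bd_q e : bd 0 0 (q e).
Proof. exact: bd_le1. Qed.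

Lemma bd_ppi j : bd 3 0 (ppi j).
Proof. have h1 := bd_q (j, k); have h2 := bd_q (j, l); rewrite /ppi; bdauto. Qed.

Lemma bd_hh j G : bd 0 0 (hh j G).
Proof.
apply: bd_le1 => //; rewrite /hh; case: (G _); case: (G _) => /=;
 rewrite ler_norml; apply/andP; split; lra.
Qed.

Lemma bd_prodq es : bd 0 0 (\prod_(e <- es) q e).
Proof. by apply: bd_le1 => //; exact: prod_norm_le1. Qed.

Definition fresh j es := all (fun e => (e.1 != j)) es.

(** Every factor [hh] expands into products of at most two cells of its row; this lowers the budget
    of 6 cells in [joint] to 4, and to 2 when two factors occur. *)
Lemma mean_hh_prod j es : (size es <= 4)%N -> uniq es -> all (fun e => e \notin forb I) es ->
  fresh j es -> ~~ blocked I k l j ->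
  bd (p + 3) e0 (mean I (fun G => hh j G * prodc es G) - ppi j * \prod_(e <- es) q e).
Proof.
move=> hs hu ha hf; rewrite /blocked negb_or => /andP[hjk hjl].
have notin b : (j, b) \notin es.
  by apply/negP => h; have := allP hf _ h; rewrite /= eqxx.
have E : mean I (fun G => hh j G * prodc es G) =
   mean I (prodc ((j, k) :: es)) + mean I (prodc ((j, l) :: es)) - 2 * mean I (prodc [:: (j, k), (j, l) & es]).
  rewrite -meanD -meanZ -meanB; apply: eq_mean => G _; rewrite /prodc !big_cons /hh; ring.
have h1 := @joint ((j, k) :: es); have h2 := @joint ((j, l) :: es).
have h3 := @joint [:: (j, k), (j, l) & es].
have {}h1 := h1 (leq_trans hs (isT : (4 <= 5)%N)).
have {}h2 := h2 (leq_trans hs (isT : (4 <= 5)%N)).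
have {}h3 := h3 (leq_trans hs (isT : (4 <= 4)%N)).
rewrite /= hjk ha hu notin /= in h1; rewrite /= hjl ha hu notin /= in h2.
rewrite /= hjk hjl ha hu !inE xpair_eqE eqxx (negbTE neq) !(negbTE (notin _)) /= in h3.
have {}h1 := h1 isT isT; have {}h2 := h2 isT isT; have {}h3 := h3 isT isT.
rewrite E /ppi; rewrite !big_cons in h1 h2 h3.
set P := \prod_(e <- es) q e in h1 h2 h3 *.
have -> : forall a b c : R, a + b - 2 * c - (q (j, k) + q (j, l) - 2 * q (j, k) * q (j, l)) * P =
  (a - q (j, k) * P) + (b - q (j, l) * P) - 2 * (c - q (j, k) * (q (j, l) * P)) by move=> *; ring.
exact: (bd_lin3 w_ge u_ge1 h1 h2 h3).
Qed.

Lemma mean_hh_hh_prod j i es : (size es <= 2)%N -> uniq es -> all (fun e => e \notin forb I) es ->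
  fresh j es -> fresh i es -> i != j -> ~~ blocked I k l j -> ~~ blocked I k l i ->
  bd (p + 6) e0 (mean I (fun G => hh j G * (hh i G * prodc es G)) - ppi j * (ppi i * \prod_(e <- es) q e)).
Proof.
move=> hs hu ha hf hf' hij hbj hbi; have := hbi.
rewrite /blocked negb_or => /andP[hik hil].
have notin b : (i, b) \notin es.
  by apply/negP => h; have := allP hf' _ h; rewrite /= eqxx.
have E : mean I (fun G => hh j G * (hh i G * prodc es G)) =
   mean I (fun G => hh j G * prodc ((i, k) :: es) G) + mean I (fun G => hh j G * prodc ((i, l) :: es) G)
   - 2 * mean I (fun G => hh j G * prodc [:: (i, k), (i, l) & es] G).
  rewrite -meanD -meanZ -meanB; apply: eq_mean => G _; rewrite /prodc !big_cons [hh i G]/hh; ring.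
have h1 := @mean_hh_prod j ((i, k) :: es); have h2 := @mean_hh_prod j ((i, l) :: es).
have h3 := @mean_hh_prod j [:: (i, k), (i, l) & es].
have {}h1 := h1 (leq_trans hs (isT : (2 <= 3)%N)).
have {}h2 := h2 (leq_trans hs (isT : (2 <= 3)%N)).
have {}h3 := h3 (leq_trans hs (isT : (2 <= 2)%N)).
rewrite /= hik ha hu notin hij hf /= in h1; rewrite /= hil ha hu notin hij hf /= in h2.
rewrite /= hik hil ha hu !inE xpair_eqE eqxx (negbTE neq) !(negbTE (notin _)) hij hf /= in h3.
have {}h1 := h1 isT isT isT hbj; have {}h2 := h2 isT isT isT hbj; have {}h3 := h3 isT isT isT hbj.
rewrite E [ppi i]/ppi; rewrite !big_cons in h1 h2 h3.
set P := \prod_(e <- es) q e in h1 h2 h3 *.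
have -> : forall a b c : R, a + b - 2 * c - ppi j * ((q (i, k) + q (i, l) - 2 * q (i, k) * q (i, l)) * P) =
  (a - ppi j * (q (i, k) * P)) + (b - ppi j * (q (i, l) * P))
  - 2 * (c - ppi j * (q (i, k) * (q (i, l) * P))) by move=> *; ring.
rewrite (_ : (p + 6 = p + 3 + 3)%N); last by rewrite -addnA.
exact: (bd_lin3 w_ge u_ge1 h1 h2 h3).
Qed.

(* [dbar], [zbar]: the values of [diff] and [nfree] if the cells were independent with
   probabilities [q] *)
Definition dbar : R := (cs I k)%:R - (cs I l)%:R
  - \sum_(i | blocked I k l i) (qt (i, k) - qt (i, l)).
Definition zbar : R := \sum_(i | ~~ blocked I k l i) ppi i.

(** By [diffE], [diff] is an O~(u) constant minus a sum over O~(u) blocked rows, so the factor costs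
    one power of [u], where a sum over all rows would cost two. *)
Lemma mean_hh_diff_gen j (F : graph -> R) (c : R) p' e1 :
  (forall i b, blocked I k l i -> (i, b) \notin forb I -> bd p' e1
      (mean I (fun G => F G * (G (i, b))%:R) - c * q (i, b))) ->
  bd p' e1 (mean I F - c) ->
  bd (p' + 7) (e1 + 1) (mean I (fun G => F G * diff I k l G) - c * dbar).
Proof.
move=> h1 h2.
have h3 i b : blocked I k l i -> bd p' e1 (mean I (fun G => F G * (G (i, b))%:R) - c * qt (i, b)).
  move=> hb; rewrite /qt; case: (boolP ((i, b) \in forb I)) => hf /=; last by rewrite mul1r; exact: h1.
  rewrite mul0r mulr0 subr0 (@eq_mean _ _ _ _ _ (fun=> 0)); last first.
    by move=> G /graphsP[_ _ ->]; rewrite ?mulr0.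
  by rewrite /mean big1 ?mul0r // /bd normr0 mulr_ge0 ?(we_ge0 w_ge) ?(ue_ge0 u_ge1).
have E : mean I (fun G => F G * diff I k l G) =
   ((cs I k)%:R - (cs I l)%:R) * mean I F -
   \sum_(i | blocked I k l i) (mean I (fun G => F G * (G (i, k))%:R) - mean I (fun G => F G * (G (i, l))%:R)).
  under eq_bigr do rewrite -meanB.
  rewrite -mean_sum -meanZ -meanB; apply: eq_mean => G hG; rewrite diffE // mulrBr mulrC mulr_sumr; congr (_ - _).
  by apply: eq_bigr => i _; rewrite /df mulrBr.
rewrite E /dbar.
set S1 := \sum_(i | _) _; set S2 := \sum_(i | _) _.
have hS : bd (p' + 4) (e1 + 1) (S1 - c * S2).
  rewrite /S1 /S2 mulr_sumr -sumrB.
  have hterm i : blocked I k l i -> bd p'.+1 e1 (mean I (fun G => F G * (G (i, k))%:R) -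
      mean I (fun G => F G * (G (i, l))%:R) - c * (qt (i, k) - qt (i, l))).
    move=> hi; have -> : forall a b : R, a - b - c * (qt (i, k) - qt (i, l)) =
      (a - c * qt (i, k)) - (b - c * qt (i, l)) by move=> *; ring.
    have := bdB w_ge u_ge1 (h3 i k hi) (h3 i l hi); by rewrite maxnn maxxx.
  apply: (bd_le w_ge u_ge1 (bd_sum w_ge u_ge1 (bd_blocked sc cl k l) hterm)).
    by lia.
  by rewrite addrC.
have hD : bd 3 1 ((cs I k)%:R - (cs I l)%:R).
  have -> : (cs I k)%:R - (cs I l)%:R = ((cs I k)%:R - lam * m%:R) - ((cs I l)%:R - lam * m%:R) by ring.
  bdauto.
have -> : forall M : R, ((cs I k)%:R - (cs I l)%:R) * M - S1 - c * ((cs I k)%:R - (cs I l)%:R - S2) =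
  ((cs I k)%:R - (cs I l)%:R) * (M - c) - (S1 - c * S2) by move=> *; ring.
apply: (bd_le w_ge u_ge1 (bdB w_ge u_ge1 (bdM w_ge u_ge1 hD h2) hS)); first by lia.
by rewrite [1 + e1]addrC maxxx.
Qed.

Lemma mean_hh j : ~~ blocked I k l j -> bd (p + 3) e0 (mean I (hh j) - ppi j).
Proof.
move=> hj; have := @mean_hh_prod j [::] isT isT isT isT hj; rewrite big_nil mulr1.
rewrite (@eq_mean _ _ _ _ _ (hh j)) // => G _; by rewrite /prodc big_nil mulr1.
Qed.

Lemma mean_hh_cell j i b : ~~ blocked I k l j -> blocked I k l i -> (i, b) \notin forb I ->
  bd (p + 3) e0 (mean I (fun G => hh j G * (G (i, b))%:R) - ppi j * q (i, b)).
Proof.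
move=> hj hi hib; have hij : i != j by apply: contraNneq hj => <-.
have := @mean_hh_prod j [:: (i, b)] isT isT; rewrite /= hib hij /= => /(_ isT isT hj).
rewrite big_seq1 (@eq_mean _ _ _ _ _ (fun G => hh j G * (G (i, b))%:R)) // => G _.
by rewrite /prodc big_seq1.
Qed.

Lemma mean_hh_diff j : ~~ blocked I k l j ->
  bd (p + 10) (e0 + 1) (mean I (fun G => hh j G * diff I k l G) - ppi j * dbar).
Proof.
move=> hj; have := @mean_hh_diff_gen j (hh j) (ppi j) (p + 3) e0.
rewrite -addnA; apply; last exact: mean_hh.
by move=> i b hi hib; apply: mean_hh_cell.
Qed.

End PairWeights.

(** * Cell probabilities to first order *)

Section FirstOrder.
Context {R : realFieldType} (w u lam : R) (m n : nat).
Hypothesis sc : scale w u lam m n.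
Let w_ge := w_ge16 sc.
Let u_ge1 := u_ge1' sc.
Notation bd := (bd w u).
Notation Lam := (lam * (1 - lam)).
Notation zeta := (zeta lam m).
Notation graph := {ffun 'I_m * 'I_n -> bool}.
Implicit Types (G : graph) (i j : 'I_m) (k l : 'I_n).

Section Inst.
Variables (r : nat) (I : inst m n).
Hypothesis cl : cls w u lam r I.

Lemma free_hh k l j G : ~~ blocked I k l j -> (free I k l G j)%:R = hh k l j G :> R.
Proof.
rewrite /free /hh => ->; case: (G _); case: (G _) => /=; ring.
Qed.

Section Quot.
Variables (k l : 'I_n) (j : 'I_m).
Hypotheses (neq : k != l) (hj : ~~ blocked I k l j).

Let D := w ^+ 5 * u ^ 1.
Let D0 : 0 <= D. Proof. by rewrite mulr_ge0 ?(we_ge0 w_ge) ?(ue_ge0 u_ge1). Qed.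
Let bdD' : bd 5 1 D. Proof. by rewrite /bd ger0_norm. Qed.

(** The remainder is the mean of [|diff| * |nfree - zeta| / zeta ^+ 2], of order u * u / u^4, plus
    the fourth moment term of order u^-4. *)
Lemma mean_quot1 : bd 112 (-2) (mean I (fun G => (free I k l G j)%:R * (diff I k l G / nfree I k l G))
   - mean I (fun G => hh k l j G * diff I k l G) / zeta).
Proof.
have hz := bd_zetainv sc; have h4 := bd_mean_quot4 sc cl neq; have h1 := bd_mean_dev1 sc cl neq.
rewrite -meanZr -meanB.
apply: (bd_mean_le sc (g := fun G => 2 * D / zeta * zeta^-1 * `|nfree I k l G - zeta| +
   16 * ((nfree I k l G - zeta) / zeta) ^+ 4)).
  move=> G hG; rewrite free_hh // -mulrA -mulrBr normrM.
  have hb : `|hh k l j G| <= 1 :> R by have := bd_hh sc k l j G; rewrite /bd expr0 expr0z mulr1.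
  apply: le_trans (ler_wpM2r (normr_ge0 _) hb) _; rewrite mul1r.
  apply: le_trans (quot_bound1 (zeta_gt0 sc) (diff_le_nfree I k l G)) _; rewrite lerD2r.
  have -> : 2 * D / zeta * zeta^-1 * `|nfree I k l G - zeta| = 2 * D / zeta * (`|nfree I k l G - zeta| / zeta).
    by rewrite -!mulrA [zeta^-1 * `|_|]mulrC.
  rewrite ler_wpM2r ?mulr_ge0 ?invr_ge0 ?(ltW (zeta_gt0 sc)) //.
  by rewrite ler_wpM2r ?invr_ge0 ?(ltW (zeta_gt0 sc)) // ler_wpM2l // (bd_diff sc cl).
rewrite meanD meanZ.
set M1 := mean I _ in h1 *; set M4 := mean I _ in h4 *; bdauto.
Qed.

Lemma mean_quot2 : bd 112 (-3) (mean I (fun G => (free I k l G j)%:R * (diff I k l G / nfree I k l G))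
   - mean I (fun G => hh k l j G * diff I k l G) / zeta
   + mean I (fun G => hh k l j G * diff I k l G * (nfree I k l G - zeta)) / zeta ^+ 2).
Proof.
have hz := bd_zetainv sc; have h4 := bd_mean_quot4 sc cl neq; have h1 := bd_mean_dev2 sc cl neq.
rewrite -!meanZr -meanB -meanD.
apply: (bd_mean_le sc (g := fun G => 2 * D / zeta * zeta^-1 ^+ 2 * (nfree I k l G - zeta) ^+ 2 +
   16 * ((nfree I k l G - zeta) / zeta) ^+ 4)).
  move=> G hG; rewrite free_hh //.
  have -> : forall x y d t : R, x * (d / y) - x * d / t + x * d * (y - t) / t ^+ 2 =
    x * (d / y - d / t + d * (y - t) / t ^+ 2) by move=> *; ring.
  rewrite normrM.
  have hb : `|hh k l j G| <= 1 :> R by have := bd_hh sc k l j G; rewrite /bd expr0 expr0z mulr1.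
  apply: le_trans (ler_wpM2r (normr_ge0 _) hb) _; rewrite mul1r.
  apply: le_trans (quot_bound2 (zeta_gt0 sc) (diff_le_nfree I k l G)) _; rewrite lerD2r.
  have -> : 2 * D / zeta * zeta^-1 ^+ 2 * (nfree I k l G - zeta) ^+ 2 =
     2 * D / zeta * ((nfree I k l G - zeta) ^+ 2 / zeta ^+ 2).
    by rewrite -[LHS]mulrA exprVn [_^-1 * _]mulrC.
  have p0 : 0 <= (nfree I k l G - zeta) ^+ 2 / zeta ^+ 2 by rewrite mulr_ge0 ?invr_ge0 ?sqr_ge0.
  apply: ler_wpM2r p0 _ _ _.
  by rewrite ler_wpM2r ?invr_ge0 ?(ltW (zeta_gt0 sc)) // ler_wpM2l // (bd_diff sc cl).
rewrite meanD meanZ.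
set M1 := mean I _ in h1 *; set M4 := mean I _ in h4 *; bdauto.
Qed.

Lemma Pr_diffE : Pr I (j, k) - Pr I (j, l) =
  mean I (fun G => (free I k l G j)%:R * (diff I k l G / nfree I k l G)) :> R.
Proof. by rewrite -(mean_df neq hj) /Pr -meanB. Qed.

End Quot.

Lemma sum_blocked_sub (f g : 'I_m -> R) k l :
  \sum_(i | blocked I k l i) (((i, k) \notin forb I)%:R * f i - ((i, l) \notin forb I)%:R * g i) =
  \sum_i (((i, l) \in forb I)%:R * f i - ((i, k) \in forb I)%:R * g i
     - ((i, k) \in forb I)%:R * ((i, l) \in forb I)%:R * (f i - g i)).
Proof.
rewrite [LHS]big_mkcond; apply: eq_bigr => i _; rewrite /blocked.
by case: ((i, k) \in forb I); case: ((i, l) \in forb I) => /=; ring.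
Qed.

Lemma hcolE k : (hcol I k)%:R = \sum_i ((i, k) \in forb I)%:R :> R.
Proof. by rewrite natr_sum. Qed.

(** With the constant prediction [lam], [ppi] is [2 * Lam] and [zeta] is [2 * Lam * m], whence the
    slope [1 / m]. The forbidden cells turn the difference of column sums in [dbar] into that of the
    [ieta]. *)
Lemma Pr_diff1 k l j : (r <= 10)%N -> nonempty I -> k != l -> ~~ blocked I k l j ->
  bd 140 (-2) (Pr I (j, k) - Pr I (j, l) - (ieta lam I k - ieta lam I l) / m%:R).
Proof.
move=> hr ne neq hj; rewrite (Pr_diffE neq hj).
have q1 (e : 'I_m * 'I_n) : `|lam| <= 1.
  by rewrite ger0_norm ?(ltW (lam_gt0 sc)) ?(ltW (lam_lt1 sc)).
have joint es : (size es <= 6)%N -> uniq es -> all (fun e => e \notin forb I) es ->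
    bd 122 (-1) (mean I (prodc es) - \prod_(e <- es) lam).
  move=> hs hu ha; rewrite big_const_seq count_predT -Monoid.iteropE.
  by apply: (joint0 sc cl) => //; rewrite -[16%N]/(10 + 6)%N leq_add.
have h1 := mean_hh_diff sc cl ne (q := fun=> lam) joint neq hj.
have h2 := mean_quot1 neq hj; have hz := bd_zetainv sc.
have E : dbar I (fun=> lam) k l = ieta lam I k - ieta lam I l.
  rewrite /dbar /qt sum_blocked_sub /ieta !hcolE.
  under eq_bigr do rewrite subrr mulr0 subr0.
  rewrite sumrB -!mulr_suml; ring.
rewrite E in h1.
set M1 := mean I _ in h1 h2 *; set M2 := mean I _ in h2 *.
have m0 : m%:R != 0 :> R by rewrite lt0r_neq0 ?(sc_m0 sc).
have l0 : lam != 0 by rewrite lt0r_neq0 ?(lam_gt0 sc).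
have l1 : 1 - lam != 0 by rewrite lt0r_neq0 // subr_gt0 (lam_lt1 sc).
have -> : M2 - (ieta lam I k - ieta lam I l) / m%:R =
  (M2 - M1 / zeta) + (M1 - ppi (fun=> lam) k l j * (ieta lam I k - ieta lam I l)) / zeta.
  rewrite /ppi /zeta; field; by rewrite m0 l0 l1.
bdauto.
Qed.

Lemma sum_hcol : (\sum_k hcol I k = #|forb I|)%N.
Proof.
rewrite /hcol exchange_big pair_big /= -sum1_card [RHS]big_mkcond.
by apply: eq_bigr => -[a b] _ /=; case: (_ \in _).
Qed.

Lemma sum_eta : \sum_k ieta lam I k = (\sum_j rs I j)%N%:R - lam * m%:R * n%:R + lam * #|forb I|%:R.
Proof.
rewrite /ieta !big_split /= sumrN sumr_const card_ord -mulr_sumr -natr_sum -(tot_eq cl) -natr_sum sum_hcol.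
by rewrite -[_ *+ n]mulr_natr.
Qed.

Lemma bd_sum_eta : bd 3 2 (\sum_k ieta lam I k).
Proof. rewrite sum_eta; bdauto. Qed.

Lemma hrowE j : #|[pred l | (j, l) \in forb I]| = hrow I j.
Proof. by rewrite -sum1_card big_mkcond; apply: eq_bigr => l _; rewrite inE; case: (_ \in _). Qed.

Lemma bd_sum_row_forb j (F : 'I_n -> R) p e : (forall l, bd p e (F l)) ->
  bd (2 + p) (1 + e) (\sum_(l | (j, l) \in forb I) F l).
Proof.
move=> h; apply: bd_sum => //; have := bd_hrow sc cl j; rewrite -hrowE.
by congr (bd _ _ _%:R); apply: eq_card => l; rewrite inE.
Qed.

Lemma card_row_availE j (c : R) : \sum_(l | (j, l) \notin forb I) c = (n%:R - (hrow I j)%:R) * c.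
Proof.
by rewrite -card_row_avail -sum1_card natr_sum mulr_suml; apply: eq_big => l; rewrite ?inE ?mul1r.
Qed.

(* Differences within a row are known; the row sum pins down the additive constant. *)
Lemma Pr_first j k : (r <= 10)%N -> nonempty I -> (j, k) \notin forb I ->
  bd 150 (-2) (Pr I (j, k) - pf lam I (j, k)).
Proof.
move=> hr ne hjk.
pose S1 := \sum_(l | (j, l) \notin forb I) (Pr I (j, k) - Pr I (j, l) - (ieta lam I k - ieta lam I l) / m%:R).
pose S2 := \sum_(l | (j, l) \in forb I) ieta lam I l.
have hS1 : bd 140 0 S1.
  apply: (bd_le w_ge u_ge1 (bd_sum w_ge u_ge1 (bd_row_avail sc I j) (k := 140) (e := -2) _)) => // l hl.
  have [<-|neq] := eqVneq k l; first by rewrite !subrr mul0r; bdauto.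
  by apply: Pr_diff1; rewrite // blockedE.
have hS2 : bd 5 2 S2.
  apply: (bd_le w_ge u_ge1 (bd_sum_row_forb j (p := 3) (e := 1) _)) => // l; bdauto.
have E := row_balance (R := R) j k ne.
have ES : \sum_(l | (j, l) \notin forb I) (Pr I (j, k) - Pr I (j, l)) =
   S1 + ((n%:R - (hrow I j)%:R) * ieta lam I k - (\sum_l ieta lam I l - S2)) / m%:R.
  have -> : \sum_l ieta lam I l - S2 = \sum_(l | (j, l) \notin forb I) ieta lam I l.
    by rewrite (bigID (fun l => (j, l) \in forb I)) /= addrC addrK.
  rewrite -card_row_availE -sumrB mulr_suml -big_split /=; apply: eq_bigr => l _.
  by rewrite subrK.
have n0 : n%:R != 0 :> R by rewrite lt0r_neq0 ?(sc_n0 sc).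
have m0 : m%:R != 0 :> R by rewrite lt0r_neq0 ?(sc_m0 sc).
have hx := nx_neq0 sc cl j.
have -> : Pr I (j, k) - pf lam I (j, k) = (n%:R - (hrow I j)%:R)^-1 *
  ((hrow I j)%:R * idlt lam I j / n%:R - (\sum_l ieta lam I l - S2) / m%:R + S1).
  have -> : Pr I (j, k) = (n%:R - (hrow I j)%:R)^-1 * ((n%:R - (hrow I j)%:R) * Pr I (j, k)) :> R by rewrite mulKf.
  rewrite E ES /pf /= /idlt; set T := \sum_l _; field; by rewrite hx n0 m0.
have hT := bd_sum_eta; set T := \sum_l _ in hT *; bdauto.
Qed.

End Inst.

Lemma joint1 r I (es : seq ('I_m * 'I_n)) : cls w u lam r I -> (r + size es <= 10)%N -> nonempty I ->
  uniq es -> all (fun e => e \notin forb I) es ->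
  bd 153 (-2) (mean I (prodc es) - \prod_(e <- es) pf lam I e).
Proof.
move=> cl hr h0 hu hall.
(* The last clause records the drift of [pf] since the start, at most [1 / n + 1 / m] per exposed
   cell. *)
pose Q (k : nat) (J : inst m n) := [/\ (k <= 10)%N, cls w u lam (10 - k) J &
  forall e, `|pf lam J e - pf lam I e| <= (10 - k)%:R * (n%:R^-1 + m%:R^-1)].
pose B := w ^+ 151 * u ^ (-2).
have B0 : 0 <= B by rewrite mulr_ge0 ?(we_ge0 w_ge) ?(ue_ge0 u_ge1).
have i0 : 0 <= n%:R^-1 + m%:R^-1 :> R by rewrite addr_ge0 ?invr_ge0.
apply: (bd_norm_le w_ge u_ge1 (y := (size es)%:R * B)); last first.
  have hB : bd 151 (-2) B by rewrite /bd ger0_norm.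
  have hs : (size es <= 16)%N by lia.
  have hsz := bd_natr w_ge u_ge1 hs.
  by apply: (bd_le w_ge u_ge1 (bdM w_ge u_ge1 hsz hB)).
apply: (@joint_approx _ _ _ Q (pf lam I) B _ _ _ _ _ es (10 - r - size es)) => //.
- by move=> e; exact: (pf_le1 sc e cl).
- by move=> p J e [_ hJ _]; exact: (cls_pos sc e hJ).
- move=> p J e [hk hJ hd] he.
  have hk1 : (10 - p = (10 - p.+1).+1)%N by lia.
  have hk2 : (10 - p.+1 < 16)%N by apply: leq_ltn_trans (leq_subr _ _) _.
  split; [exact: ltnW | by rewrite hk1; apply: (cls_occ sc hJ hk2) |].
  move=> e'; rewrite hk1 -natr1 mulrDl mul1r.
  have -> : pf lam (occ J e) e' - pf lam I e' = (pf lam J e' - pf lam I e') + (pf lam (occ J e) e' - pf lam J e') by ring.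
  by apply: le_trans (ler_normD _ _) _; apply: lerD => //; exact: (pf_occ sc e' hJ he).
- move=> p J [a b] [hk hJ hd] hne he.
  have h1 := Pr_first hJ (leq_subr _ _) hne he.
  have h2 : bd 6 (-2) (pf lam J (a, b) - pf lam I (a, b)).
    apply: (bd_norm_le w_ge u_ge1 (y := 10 * (n%:R^-1 + m%:R^-1))); last by bdauto.
    by apply: le_trans (hd _) _; rewrite ler_wpM2r // ler_nat leq_subr.
  have -> : Pr J (a, b) - pf lam I (a, b) = (Pr J (a, b) - pf lam J (a, b)) + (pf lam J (a, b) - pf lam I (a, b)) by ring.
  exact: (bd_le w_ge u_ge1 (bdD w_ge u_ge1 h1 h2)).
- split; [by lia | by apply: (cls_mono cl); lia |].
  by move=> e; rewrite subrr normr0 mulr_ge0.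
Qed.

End FirstOrder.

(** * Cell probabilities to second order *)

Section SecondOrder.
Context {R : realFieldType} (w u lam : R) (m n : nat).
Hypothesis sc : scale w u lam m n.
Let w_ge := w_ge16 sc.
Let u_ge1 := u_ge1' sc.
Notation bd := (bd w u).
Notation Lam := (lam * (1 - lam)).
Notation zeta := (zeta lam m).
Notation graph := {ffun 'I_m * 'I_n -> bool}.
Implicit Types (G : graph) (i j : 'I_m) (k l : 'I_n).

Variables (r : nat) (I : inst m n).
Hypothesis cl : cls w u lam r I.

Lemma sum_hrow : (\sum_j hrow I j = #|forb I|)%N.
Proof.
rewrite /hrow pair_big /= -sum1_card [RHS]big_mkcond.
by apply: eq_bigr => -[a b] _ /=; case: (_ \in _).
Qed.

Lemma sum_dlt : \sum_j idlt lam I j = (\sum_j rs I j)%N%:R - lam * m%:R * n%:R + lam * #|forb I|%:R.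
Proof.
rewrite /idlt !big_split /= sumrN sumr_const card_ord -mulr_sumr -natr_sum -natr_sum sum_hrow.
by rewrite -[_ *+ m]mulr_natr mulrAC.
Qed.

Lemma bd_sum_dlt : bd 3 2 (\sum_j idlt lam I j).
Proof. rewrite sum_dlt; bdauto. Qed.

Lemma bd_sum_m (F : 'I_m -> R) p e : (forall i, bd p e (F i)) -> bd (1 + p) (2 + e) (\sum_i F i).
Proof.
move=> h; apply: bd_sum => //; rewrite (_ : #|_| = m); last by rewrite -[RHS]card_ord.
exact: (bd_m sc).
Qed.

Lemma sum_affine (c d f : R) (F F' : 'I_m -> R) :
  \sum_i (c + (d * F i + f * F' i)) = c * m%:R + (d * \sum_i F i + f * \sum_i F' i).
Proof. by rewrite !big_split /= sumr_const card_ord -!mulr_sumr mulr_natr. Qed.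

Section Pair.
Variables (k l : 'I_n).
Hypotheses (neq : k != l).

(** Counts the rows forbidden in both columns. It enters both [zbar] and [dbar] and cancels in
    [gg_main]. *)
Definition cap : R := \sum_i ((i, k) \in forb I)%:R * ((i, l) \in forb I)%:R.

Lemma bd_cap : bd 2 1 cap.
Proof.
apply: (bd_norm_le w_ge u_ge1 (y := (hcol I k)%:R)); last by bdauto.
rewrite ger0_norm; last by apply: sumr_ge0 => i _; rewrite mulr_ge0.
rewrite hcolE; apply: ler_sum => i _; by case: (_ \in _); case: (_ \in _); rewrite ?mulr0 ?mulr1 ?mul0r.
Qed.

Notation a i := (idlt lam I i / n%:R).
Notation b k := (ieta lam I k / m%:R).

Lemma ppi_pf i : ppi (pf lam I) k l i = 2 * Lam + (1 - 2 * lam) * (2 * a i + (b k + b l)) - 2 * ((a i + b k) * (a i + b l)).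
Proof. rewrite /ppi /pf /=; ring. Qed.

(** An error O~(1) suffices, because [zbar - zeta] is multiplied by [dbar / zeta ^+ 2], of order
    u^-3. *)
Lemma zbar_pf : bd 20 0 (zbar I (pf lam I) k l - zeta -
   ((1 - 2 * lam) * (ieta lam I k + ieta lam I l) - 2 * Lam * ((hcol I k)%:R + (hcol I l)%:R)) - 2 * Lam * cap).
Proof.
have m0 : m%:R != 0 :> R by rewrite lt0r_neq0 ?(sc_m0 sc).
have E1 : zbar I (pf lam I) k l = \sum_i ppi (pf lam I) k l i - \sum_(i | blocked I k l i) ppi (pf lam I) k l i.
  by rewrite /zbar [\sum_i _](bigID (blocked I k l)) /= addrC addrK.
have E2 : \sum_i ppi (pf lam I) k l i = 2 * Lam * m%:R +
   (1 - 2 * lam) * (2 * ((\sum_i idlt lam I i) / n%:R) + (ieta lam I k + ieta lam I l))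
   - 2 * \sum_i ((a i + b k) * (a i + b l)).
  have n0 : n%:R != 0 :> R by rewrite lt0r_neq0 ?(sc_n0 sc).
  transitivity (\sum_i ((2 * Lam + (1 - 2 * lam) * (b k + b l)) + ((1 - 2 * lam) * 2 / n%:R * idlt lam I i
      + (- 2) * ((a i + b k) * (a i + b l))))).
    by apply: eq_bigr => i _; rewrite ppi_pf; ring.
  by rewrite sum_affine; field; rewrite m0 n0.
have E3 : \sum_(i | blocked I k l i) ppi (pf lam I) k l i =
   2 * Lam * ((hcol I k)%:R + (hcol I l)%:R - cap) +
   \sum_(i | blocked I k l i) (ppi (pf lam I) k l i - 2 * Lam).
  have -> : (hcol I k)%:R + (hcol I l)%:R - cap = \sum_(i | blocked I k l i) 1 :> R.
    rewrite !hcolE /cap -big_split -sumrB [RHS]big_mkcond; apply: eq_bigr => i _ /=; rewrite /blocked.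
    by case: (_ \in _); case: (_ \in _) => /=; ring.
  rewrite mulr_sumr -big_split; apply: eq_bigr => i _ /=; ring.
have h1 := bd_sum_dlt.
have h2 : bd 14 0 (\sum_i ((a i + b k) * (a i + b l))).
  apply: (bd_le w_ge u_ge1 (bd_sum_m (p := 12) (e := -2) _)) => // i; bdauto.
have h3 : bd 16 0 (\sum_(i | blocked I k l i) (ppi (pf lam I) k l i - 2 * Lam)).
  apply: (bd_le w_ge u_ge1 (bd_sum w_ge u_ge1 (bd_blocked sc cl k l) (k := 13) (e := -1) _)) => // i _.
  rewrite ppi_pf.
  have -> : forall x y z : R, x + y - z - x = y - z by move=> *; ring.
  bdauto.
rewrite E1 E2 E3 /zeta.
move: h1 h2 h3; set S1 := \sum_i idlt _ _ _; set S2 := \sum_i _ * _; set S3 := \sum_(i | _) (_ - _) => h1 h2 h3.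
have -> : forall x y c : R, 2 * Lam * m%:R + (1 - 2 * lam) * (2 * (S1 / n%:R) + x) - 2 * S2
   - (2 * Lam * (y - c) + S3) - 2 * Lam * m%:R - ((1 - 2 * lam) * x - 2 * Lam * y) - 2 * Lam * c =
   (1 - 2 * lam) * (2 * (S1 / n%:R)) - 2 * S2 - S3 by move=> *; ring.
bdauto.
Qed.

Definition TT (k : 'I_n) : R := \sum_i ((i, k) \in forb I)%:R * idlt lam I i.

Lemma bd_TT k' : bd 5 2 (TT k').
Proof.
have -> : TT k' = \sum_(i | (i, k') \in forb I) idlt lam I i.
  by rewrite [RHS]big_mkcond; apply: eq_bigr => i _; case: (_ \in _); rewrite ?mul1r ?mul0r.
have hc : bd 2 1 (#|(fun i : 'I_m => (i, k') \in forb I)|%:R).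
  have -> : #|(fun i : 'I_m => (i, k') \in forb I)| = hcol I k'; last by bdauto.
  rewrite -sum1_card big_mkcond /hcol; apply: eq_bigr => i _.
  by rewrite unfold_in; case: ((i, k') \in forb I).
by apply: (bd_le w_ge u_ge1 (bd_sum w_ge u_ge1 hc (k := 3) (e := 1) (fun i _ => bd_dlt sc cl i))).
Qed.

Lemma dbar_pf : dbar I (pf lam I) k l = (ieta lam I k - ieta lam I l) +
   ((TT k - TT l) / n%:R - ((hcol I l)%:R * ieta lam I k - (hcol I k)%:R * ieta lam I l) / m%:R
     + cap * ((ieta lam I k - ieta lam I l) / m%:R)).
Proof.
rewrite /dbar /qt sum_blocked_sub.
have -> : \sum_i (((i, l) \in forb I)%:R * pf lam I (i, k) - ((i, k) \in forb I)%:R * pf lam I (i, l) -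
   ((i, k) \in forb I)%:R * ((i, l) \in forb I)%:R * (pf lam I (i, k) - pf lam I (i, l))) =
  (hcol I l)%:R * (lam + b k) + TT l / n%:R - (hcol I k)%:R * (lam + b l) - TT k / n%:R - cap * (b k - b l).
  rewrite !hcolE /TT /cap !mulr_suml -!sumrN -!big_split /=; apply: eq_bigr => i _.
  rewrite /pf /=; ring.
rewrite /ieta; ring.
Qed.

(* [gg j k - gg j l] predicts the difference of two cell probabilities in row [j] *)
Definition gg (j : 'I_m) (k : 'I_n) : R :=
  b k * (1 + (1 - 2 * lam) / Lam * a j) + TT k / n%:R / m%:R + ieta lam I k * (hcol I k)%:R / m%:R / m%:R.

(** All terms mixing the two columns cancel: the sum [V] between [ppi] and [zbar], the overlap [cap]
    between [zbar] and [dbar], and the products of one column's [hcol] with the other's [ieta]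
    between [E * Y] and [dbar]. What remains is a function of [k] minus the same function of [l], as
    the summation over a row requires. *)
Lemma gg_main j : bd 60 (-3) (ppi (pf lam I) k l j * dbar I (pf lam I) k l / zeta
   - ppi (pf lam I) k l j * (zbar I (pf lam I) k l - zeta) * dbar I (pf lam I) k l / zeta ^+ 2
   - (gg j k - gg j l)).
Proof.
have m0 : m%:R != 0 :> R by rewrite lt0r_neq0 ?(sc_m0 sc).
have l0 : lam != 0 by rewrite lt0r_neq0 ?(lam_gt0 sc).
have l1 : 1 - lam != 0 by rewrite lt0r_neq0 // subr_gt0 (lam_lt1 sc).
have n0 : n%:R != 0 :> R by rewrite lt0r_neq0 ?(sc_n0 sc).
have hrest := zbar_pf; set rest := (X in bd _ _ X) in hrest.
have -> : zbar I (pf lam I) k l - zeta = ((1 - 2 * lam) * (ieta lam I k + ieta lam I l)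
   - 2 * Lam * ((hcol I k)%:R + (hcol I l)%:R)) + (2 * Lam * cap + rest) by rewrite /rest; ring.
clearbody rest; rewrite dbar_pf ppi_pf.
have hT1 := bd_TT k; have hT2 := bd_TT l; have hcap := bd_cap.
set D2 := (_ - _ / m%:R + cap * _).
have hD2 : bd 12 0 D2 by rewrite /D2; bdauto.
set E := ieta lam I k - ieta lam I l; set V := ieta lam I k + ieta lam I l.
set Y := (hcol I k)%:R + (hcol I l)%:R.
have hE : bd 4 1 E by rewrite /E; bdauto.
have hV : bd 4 1 V by rewrite /V; bdauto.
have hY : bd 3 1 Y by rewrite /Y; bdauto.
pose e1 := (1 - 2 * lam) * (2 * a j + V / m%:R) * (2^-1 * Lam^-1).
pose e2 := - ((a j + b k) * (a j + b l)) * Lam^-1.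
pose f := (1 - 2 * lam) * V - 2 * Lam * Y.
have he1 : bd 13 (-1) e1 by rewrite /e1; bdauto.
have he2 : bd 14 (-2) e2 by rewrite /e2; bdauto.
have hf : bd 9 1 f by rewrite /f; bdauto.
have hz := bd_zetainv sc.
have E1 : 2 * Lam + (1 - 2 * lam) * (2 * a j + (b k + b l)) - 2 * ((a j + b k) * (a j + b l)) =
   2 * Lam * (1 + e1 + e2) by rewrite /e1 /e2 /V; field; rewrite l0 l1 n0 m0.
have E2 : gg j k - gg j l = m%:R^-1 * (E * (1 + e1 - f * zeta^-1) + (D2 - cap * (E / m%:R))).
  rewrite /gg /e1 /f /D2 /E /V /Y /zeta; field; by rewrite l0 l1 n0 m0.
rewrite E1 E2 -/f.
have E3 : 2 * Lam * (1 + e1 + e2) * (E + D2) / zeta -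
   2 * Lam * (1 + e1 + e2) * (f + (2 * Lam * cap + rest)) * (E + D2) / zeta ^+ 2 -
   m%:R^-1 * (E * (1 + e1 - f * zeta^-1) + (D2 - cap * (E / m%:R))) =
   m%:R^-1 * (E * e2 + (e1 + e2) * D2 - E * rest * zeta^-1 - D2 * ((f + (2 * Lam * cap + rest)) * zeta^-1)
     - (e1 + e2) * (E + D2) * ((f + (2 * Lam * cap + rest)) * zeta^-1)).
  move: hE hV hY hD2 he1 he2 hf; clear E1 E2; clearbody D2 E e1 e2 f => _ _ _ _ _ _ _.
  by rewrite /zeta; field; rewrite l0 l1 m0.
rewrite E3; clear E1 E2 E3; clearbody D2 E e1 e2 f.
bdauto.
Qed.

Section Row.
Variable j : 'I_m.
Hypotheses (hj : ~~ blocked I k l j) (hr : (r <= 4)%N) (ne : nonempty I).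

Let q1 e : `|pf lam I e| <= 1. Proof. exact: (pf_le1 sc e cl). Qed.
Let joint es : (size es <= 6)%N -> uniq es -> all (fun e => e \notin forb I) es ->
    bd 153 (-2) (mean I (prodc es) - \prod_(e <- es) pf lam I e).
Proof.
move=> hs hu ha; apply: (joint1 sc cl) => //; rewrite -[10%N]/(4 + 6)%N; exact: leq_add.
Qed.
Let bdq := bd_q sc q1.
Let bdpi := bd_ppi sc q1 k l.

Lemma mean_hh_nfree es : (size es <= 1)%N -> uniq es -> all (fun e => e \notin forb I) es ->
  (forall e, e \in es -> blocked I k l e.1) ->
  bd 170 0 (mean I (fun G => hh k l j G * (nfree I k l G - zeta) * prodc es G) -
     ppi (pf lam I) k l j * (zbar I (pf lam I) k l - zeta) * \prod_(e <- es) pf lam I e).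
Proof.
move=> hs hu ha hb.
have hf i : ~~ blocked I k l i -> fresh i es.
  by move=> hi; apply/allP => e he; apply: contraNneq hi => <-; exact: hb.
set P := \prod_(e <- es) _; have hP : bd 0 0 P by apply: (bd_prodq sc q1).
have E : mean I (fun G => hh k l j G * (nfree I k l G - zeta) * prodc es G) =
   \sum_(i | ~~ blocked I k l i) mean I (fun G => hh k l j G * (hh k l i G * prodc es G))
   - zeta * mean I (fun G => hh k l j G * prodc es G).
  rewrite -mean_sum -meanZ -meanB; apply: eq_mean => G _.
  have -> : nfree I k l G = \sum_(i | ~~ blocked I k l i) hh k l i G :> R by rewrite nfreeE.
  rewrite mulrBr mulrBl; congr (_ - _); last by ring.
  by rewrite mulr_sumr mulr_suml; apply: eq_bigr => i _; rewrite mulrA.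
rewrite E; set M := mean I _.
have hM : bd 156 (-2) (M - ppi (pf lam I) k l j * P).
  exact: (mean_hh_prod sc joint neq (leq_trans hs (isT : (1 <= 4)%N)) hu ha (hf j hj) hj).
have hterm i : i != j -> ~~ blocked I k l i -> bd 159 (-2)
    (mean I (fun G => hh k l j G * (hh k l i G * prodc es G)) - ppi (pf lam I) k l j * (ppi (pf lam I) k l i * P)).
  move=> hij hi; exact: (mean_hh_hh_prod sc joint neq (leq_trans hs (isT : (1 <= 2)%N)) hu ha (hf j hj) (hf i hi) hij hj hi).
pose F i := mean I (fun G => hh k l j G * (hh k l i G * prodc es G)) - ppi (pf lam I) k l j * (ppi (pf lam I) k l i * P).
have hS : bd 165 0 (\sum_(i | ~~ blocked I k l i) F i).
  (* The diagonal row [j] is merely bounded, by O~(1); each of the other O~(u^2) rows has error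
     O~(u^-2). *)
  rewrite (bigD1 j) //=.
  have h1 : bd 8 0 (F j).
    have hm : bd 0 0 (mean I (fun G => hh k l j G * (hh k l j G * prodc es G))).
      apply: (bd_mean sc) => G _; apply: (bd_le w_ge u_ge1 (bdM w_ge u_ge1 (bd_hh sc k l j G) (bdM w_ge u_ge1 (bd_hh sc k l j G) (k2 := 0) (e2 := 0) _))) => //.
      apply: (bd_le1 w_ge u_ge1); rewrite /prodc; case: (es) hs => [|e [|//]] _; rewrite ?big_nil ?normr1 // big_seq1 normr_nat.
      by case: (G e).
    have h3 := bdpi j; rewrite /F; set M' := mean I _ in hm *; bdauto.
  have h2 : bd 161 0 (\sum_(i | ~~ blocked I k l i && (i != j)) F i).
    rewrite big_mkcond; apply: (bd_le w_ge u_ge1 (bd_sum_m (p := 160) (e := -2) _)) => // i.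
    case: ifP => [/andP[h h']|_]; last by bdauto.
    by apply: (bd_le w_ge u_ge1 (hterm i h' h)).
  move: (F j) h1 => x h1; set S := \sum_(i | _) _ in h2 *; bdauto.
have hz := bd_zeta sc.
have -> : \sum_(i | ~~ blocked I k l i) mean I (fun G => hh k l j G * (hh k l i G * prodc es G)) - zeta * M -
   ppi (pf lam I) k l j * (zbar I (pf lam I) k l - zeta) * P =
  \sum_(i | ~~ blocked I k l i) F i - zeta * (M - ppi (pf lam I) k l j * P).
  rewrite /F sumrB -mulr_sumr -mulr_suml -/(zbar I (pf lam I) k l); ring.
move: hM hS; set S := \sum_(i | _) _; set M' := M - _ => hM hS; bdauto.
Qed.

(** In the second order expansion the two means are replaced by their predictions with errors
    O~(u^-1) over [zeta] and O~(u) over [zeta ^+ 2], both of order u^-3. *)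
Lemma Pr_diff2 : bd 190 (-3) (Pr I (j, k) - Pr I (j, l) - (gg j k - gg j l)).
Proof.
rewrite (Pr_diffE neq hj).
have h1 := mean_quot2 sc cl neq hj.
have h2 := mean_hh_diff sc cl ne joint neq hj.
have h3 := @mean_hh_diff_gen _ _ _ _ _ _ sc _ _ cl ne (pf lam I) k l neq j
  (fun G => hh k l j G * (nfree I k l G - zeta)) (ppi (pf lam I) k l j * (zbar I (pf lam I) k l - zeta)) 170 0.
have {}h3 := h3 _ _.
have {}h3 : bd 177 1 (mean I (fun G => hh k l j G * (nfree I k l G - zeta) * diff I k l G) -
    ppi (pf lam I) k l j * (zbar I (pf lam I) k l - zeta) * dbar I (pf lam I) k l).
  apply: h3.
    move=> i b hi hib; have := @mean_hh_nfree [:: (i, b)] isT isT; rewrite /= hib => /(_ isT).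
    rewrite big_seq1 (@eq_mean _ _ _ _ _ (fun G => hh k l j G * (nfree I k l G - zeta) * (G (i, b))%:R)).
      by apply => e; rewrite inE => /eqP ->.
    by move=> G _; rewrite /prodc big_seq1.
  have := @mean_hh_nfree [::] isT isT isT (fun e h => False_ind _ (Bool.diff_false_true h)).
  rewrite big_nil mulr1 (@eq_mean _ _ _ _ _ (fun G => hh k l j G * (nfree I k l G - zeta))) //.
  by move=> G _; rewrite /prodc big_nil mulr1.
have h4 := gg_main j.
rewrite (@eq_mean _ _ _ _ _ (fun G => hh k l j G * diff I k l G * (nfree I k l G - zeta))) in h3; last by move=> G _; rewrite mulrAC.
have hz := bd_zetainv sc.
set M1 := mean I _ in h1 *; set M2 := mean I _ in h1 h2; set M3 := mean I _ in h1 h3.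
move: h1 h2 h3 h4; set pj := ppi _ _ _ _; set d := dbar _ _ _ _; set zz := zbar _ _ _ _ - zeta => h1 h2 h3 h4.
have -> : M1 - (gg j k - gg j l) = (M1 - M2 / zeta + M3 / zeta ^+ 2) + (M2 - pj * d) * zeta^-1
   - (M3 - pj * zz * d) * zeta^-1 ^+ 2 + (pj * d / zeta - pj * zz * d / zeta ^+ 2 - (gg j k - gg j l)).
  by rewrite exprVn; ring.
bdauto.
Qed.
End Row.
End Pair.

(** The value forced by the row sum if all differences within row [j] were [gg j k - gg j l]. *)
Definition pg j k : R := (rs I j)%:R / (n%:R - (hrow I j)%:R) + gg j k
  - (\sum_(l | (j, l) \notin forb I) gg j l) / (n%:R - (hrow I j)%:R).

Lemma Pr_second j k : (r <= 4)%N -> nonempty I -> (j, k) \notin forb I ->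
  bd 195 (-3) (Pr I (j, k) - pg j k).
Proof.
move=> hr ne hjk.
pose S1 := \sum_(l | (j, l) \notin forb I) (Pr I (j, k) - Pr I (j, l) - (gg j k - gg j l)).
have hS1 : bd 190 (-1) S1.
  apply: (bd_le w_ge u_ge1 (bd_sum w_ge u_ge1 (bd_row_avail sc I j) (k := 190) (e := -3) _)) => // l hl.
  have [<-|neq] := eqVneq k l; first by rewrite !subrr; bdauto.
  by apply: Pr_diff2; rewrite // blockedE.
have E := row_balance (R := R) j k ne.
have hx := nx_neq0 sc cl j.
have -> : Pr I (j, k) - pg j k = (n%:R - (hrow I j)%:R)^-1 * S1.
  have -> : S1 = (n%:R - (hrow I j)%:R) * Pr I (j, k) - (rs I j)%:R
      - ((n%:R - (hrow I j)%:R) * gg j k - \sum_(l | (j, l) \notin forb I) gg j l).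
    by rewrite E /S1 sumrB [X in _ - X]sumrB card_row_availE; ring.
  by rewrite /pg; field.
bdauto.
Qed.

End SecondOrder.

(** * Adding an edge to the forbidden graph *)

Lemma edge_quot (R : fieldType) (mu a b c : R) : mu != 0 -> mu - c != 0 ->
  (mu - a) * (mu - b) / (mu - c) = mu - a - b + c + a * b / mu -
      (c * a + c * b - c ^+ 2 - c * a * b * mu^-1) * (mu - c)^-1.
Proof. by move=> h1 h2; field; rewrite h1 h2. Qed.

Section Edge.
Context {R : realFieldType} (w u lam : R) (m n : nat).
Hypothesis sc : scale w u lam m n.
Let w_ge := w_ge16 sc.
Let u_ge1 := u_ge1' sc.
Notation bd := (bd w u).
Notation Lam := (lam * (1 - lam)).
Implicit Types (i j : 'I_m) (k l : 'I_n).

Lemma small_half (p : nat) (e : int) x : bd p e x -> e <= -1 -> (p < 500)%N -> `|x| <= w^-1.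
Proof.
move=> hx he hk; have {}hx : bd p (-1) x by apply: (bd_le w_ge u_ge1 hx).
apply: le_trans hx _; have w0 := sc_w0 sc; have u0 := sc_u0 sc.
rewrite exprN1 ler_pdivrMr // mulrC ler_pdivlMr // -exprSr; exact: (w_pow_le sc).
Qed.

Lemma nonempty_occ r (I : inst m n) e : cls w u lam r I -> nonempty I -> e \notin forb I -> nonempty (occ I e).
Proof.
move=> cl ne he; rewrite /nonempty lt0n; apply/negP => /eqP hz.
have [hr hc] := cls_pos sc e cl.
have P0 : Pr I e = 0 :> R.
  have := mean_occ he hr hc (f := fun=> 1 : R) (fun=> erefl).
  have -> : mean (occ I e) (fun=> 1 : R) = 0 by rewrite /mean hz invr0 mulr0.
  by rewrite mulr0 => <-; apply: eq_mean => G _; rewrite mulr1.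
have h : bd 120 (-1) (Pr I e - lam) by case: (e) he => a b; exact: (Pr_zeroth sc cl ne).
have hL : bd 121 (-1) (2 * (Pr I e - lam)).
  have h2 := bd_natr w_ge u_ge1 (isT : (2 <= 16)%N).
  exact: (bd_le w_ge u_ge1 (bdM w_ge u_ge1 h2 h)).
have := small_half hL isT isT; rewrite P0 sub0r mulrN normrN.
have l0 := lam_gt0 sc; have l1 := lam_lt1 sc; have w0 := sc_w0 sc.
have hw : w^-1 <= lam.
  rewrite -div1r ler_pdivrMr //; apply: le_trans (lam_var sc) _; rewrite mulrC ler_wpM2r ?(ltW w0) //.
  by rewrite ler_piMr ?(ltW l0) // lerBlDr lerDl ltW.
rewrite ger0_norm; last by rewrite mulr_ge0 // ltW.
move=> h3; have := le_trans h3 hw; lra.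
Qed.

Section Fixed.
Variables (r : nat) (I : inst m n).
Hypothesis cl : cls w u lam r I.
Hypotheses (hr : (r <= 4)%N) (tot0 : (\sum_j rs I j)%N%:R = lam * m%:R * n%:R).

Notation X := (#|forb I|%:R : R).
Definition SS j : R := \sum_k ((j, k) \in forb I)%:R * ieta lam I k.
(** The increment of Y when the edge joins H: its own product, formed with the shifted deviations,
    and the effect of both shifts by [lam] on the products already present. *)
Definition dY j k : R := (idlt lam I j + lam) * (ieta lam I k + lam) + lam * SS j + lam * TT lam I k.

Lemma mnX_ge : m%:R * n%:R / 2 <= m%:R * n%:R - X :> R.
Proof.
have h : bd 5 (-2) (2 * (X * (m%:R^-1 * n%:R^-1))) by bdauto.
have m0 := sc_m0 sc; have n0 := sc_n0 sc.
have := small_half h isT isT; rewrite ger0_norm; last by rewrite !mulr_ge0 ?invr_ge0.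
have hw : w^-1 <= 1 by rewrite invf_le1 ?(sc_w0 sc) // (sc_w1 sc).
move=> h2; have {h2 hw}h3 := le_trans h2 hw.
have h4 : 2 * X <= m%:R * n%:R.
  have := ler_wpM2r (ltW (mulr_gt0 m0 n0)) h3; rewrite mul1r.
  by have -> : 2 * (X * (m%:R^-1 * n%:R^-1)) * (m%:R * n%:R) = 2 * X by field; rewrite !lt0r_neq0.
lra.
Qed.

Lemma bd_mnXinv : bd 3 (-4) (m%:R * n%:R - X)^-1.
Proof.
have h := mnX_ge; have m0 := sc_m0 sc; have n0 := sc_n0 sc.
have mn0 := mulr_gt0 m0 n0.
have p0 : 0 < m%:R * n%:R - X by lra.
apply: (bd_norm_le w_ge u_ge1 (y := 2 * (m%:R^-1 * n%:R^-1))); last by bdauto.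
rewrite ger0_norm ?invr_ge0 ?(ltW p0) // -invfM -[2]invrK -invfM lef_pV2 ?posrE ?mulr_gt0 ?invr_gt0 //.
by rewrite mulrC.
Qed.

Let c := lam * X / (m%:R * n%:R - X).

Lemma bd_c : bd 6 (-2) c.
Proof. have h := bd_mnXinv; rewrite /c; bdauto. Qed.

Lemma mu_c_ge : (1 - lam) / 2 <= 1 - lam - c.
Proof.
have h : bd 8 (-2) (2 * c) by have h := bd_c; bdauto.
have := small_half h isT isT.
have l0 := lam_gt0 sc; have l1 := lam_lt1 sc; have w0 := sc_w0 sc.
have hw : w^-1 <= 1 - lam.
  rewrite -div1r ler_pdivrMr //; apply: le_trans (lam_var sc) _; rewrite mulrC ler_wpM2r ?(ltW w0) //.
  by rewrite ler_piMl ?subr_ge0 ?(ltW l1).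
rewrite ler_norml => /andP[_ h2]; have := le_trans h2 hw; lra.
Qed.

Lemma bd_muc : bd 2 0 (1 - lam - c)^-1.
Proof.
have h := mu_c_ge; have l1 := lam_lt1 sc; have m0 : 0 < 1 - lam by rewrite subr_gt0.
have p0 : 0 < 1 - lam - c by lra.
apply: (bd_norm_le w_ge u_ge1 (y := 2 * (1 - lam)^-1)); last by bdauto.
rewrite ger0_norm ?invr_ge0 ?(ltW p0) // -[2]invrK -invfM lef_pV2 ?posrE ?mulr_gt0 ?invr_gt0 //.
by rewrite mulrC.
Qed.

Lemma bd_SS j : bd 5 2 (SS j).
Proof.
have -> : SS j = \sum_(k | (j, k) \in forb I) ieta lam I k.
  by rewrite [RHS]big_mkcond; apply: eq_bigr => i _; case: (_ \in _); rewrite ?mul1r ?mul0r.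
exact: (bd_le w_ge u_ge1 (bd_sum_row_forb sc cl j (bd_eta sc cl))).
Qed.

Lemma bd_dY j k : bd 10 2 (dY j k).
Proof. have h1 := bd_SS j; have h2 := bd_TT sc cl k; rewrite /dY; bdauto. Qed.

Lemma bd_sum_TT j : bd 5 3 (\sum_(l | (j, l) \notin forb I) TT lam I l).
Proof.
apply: (bd_norm_le w_ge u_ge1 (y := X * (w ^+ 3 * u ^ 1))); last first.
  have h : bd 3 1 (w ^+ 3 * u ^ 1) by rewrite /bd ger0_norm // mulr_ge0 ?(we_ge0 w_ge) ?(ue_ge0 u_ge1).
  bdauto.
rewrite -(sum_hcol I) natr_sum mulr_suml; apply: le_trans (ler_norm_sum _ _ _) _.
rewrite big_mkcond; apply: ler_sum => l _.
have h0 : `|TT lam I l| <= (hcol I l)%:R * (w ^+ 3 * u ^ 1).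
  rewrite hcolE mulr_suml; apply: le_trans (ler_norm_sum _ _ _) _; apply: ler_sum => i _.
  by rewrite normrM normr_nat ler_wpM2l //; exact: (bd_dlt sc cl).
by case: ifP => // _; rewrite (le_trans _ h0).
Qed.

Lemma bd_sum_eta_hcol j : bd 5 3 (\sum_(l | (j, l) \notin forb I) ieta lam I l * (hcol I l)%:R).
Proof.
apply: (bd_norm_le w_ge u_ge1 (y := X * (w ^+ 3 * u ^ 1))); last first.
  have h : bd 3 1 (w ^+ 3 * u ^ 1) by rewrite /bd ger0_norm // mulr_ge0 ?(we_ge0 w_ge) ?(ue_ge0 u_ge1).
  bdauto.
rewrite -(sum_hcol I) natr_sum mulr_suml; apply: le_trans (ler_norm_sum _ _ _) _.
rewrite big_mkcond; apply: ler_sum => l _.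
have h0 : `|ieta lam I l * (hcol I l)%:R| <= (hcol I l)%:R * (w ^+ 3 * u ^ 1).
  by rewrite normrM normr_nat mulrC ler_wpM2l //; exact: (bd_eta sc cl).
by case: ifP => // _; rewrite (le_trans _ h0).
Qed.

Lemma sum_avail_eta j : \sum_(l | (j, l) \notin forb I) ieta lam I l = lam * X - SS j.
Proof.
have h := sum_eta cl; rewrite tot0 subrr add0r in h.
rewrite -h [X in _ = X - _](bigID (fun l => (j, l) \in forb I)) /=.
have -> : SS j = \sum_(k | (j, k) \in forb I) ieta lam I k.
  by rewrite [RHS]big_mkcond; apply: eq_bigr => i _; case: (_ \in _); rewrite ?mul1r ?mul0r.
by rewrite addrAC subrr add0r.
Qed.

Notation kap := ((1 - 2 * lam) / Lam).

(** The averaged term of [pg] is O~(u^-2), so keeping its leading part and dividing by [n] instead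
    of [n - x] costs only O~(u^-3). *)
Lemma pg_simpl j k : bd 30 (-3) (pg lam I j k - ((rs I j)%:R / (n%:R - (hrow I j)%:R)
   + ieta lam I k / m%:R * (1 + kap * (idlt lam I j / n%:R)) + TT lam I k / n%:R / m%:R
   + ieta lam I k * (hcol I k)%:R / m%:R / m%:R - (lam * X - SS j) / m%:R / n%:R)).
Proof.
have n0 : n%:R != 0 :> R by rewrite lt0r_neq0 ?(sc_n0 sc).
have m0 : m%:R != 0 :> R by rewrite lt0r_neq0 ?(sc_m0 sc).
have hx := nx_neq0 sc cl j.
have E : \sum_(l | (j, l) \notin forb I) gg lam I j l =
  (1 + kap * (idlt lam I j / n%:R)) * ((lam * X - SS j) / m%:R)
  + (\sum_(l | (j, l) \notin forb I) TT lam I l) / n%:R / m%:R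
  + (\sum_(l | (j, l) \notin forb I) ieta lam I l * (hcol I l)%:R) / m%:R / m%:R.
  rewrite -sum_avail_eta !mulr_suml mulr_sumr -!big_split /=; apply: eq_bigr => l _.
  by rewrite /gg; ring.
have h1 := bd_sum_TT j; have h2 := bd_sum_eta_hcol j; have h3 := bd_SS j.
rewrite /pg E /gg; move: h1 h2; set S1 := \sum_(l | _) _; set S2 := \sum_(l | _) _ => h1 h2.
set Y := lam * X - SS j.
have hY : bd 6 2 Y by rewrite /Y; bdauto.
set K := kap; have hK : bd 4 0 K by rewrite /K; bdauto.
set d := idlt lam I j; have hd : bd 3 1 d by exact: (bd_dlt sc cl).
set x := (hrow I j)%:R : R in hx *; have hxb : bd 2 1 x by exact: (bd_hrow sc cl).
have hxi : bd 1 (-2) (n%:R - x)^-1 by exact: (bd_nxinv sc cl).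
clearbody S1 S2 Y K d x.
have -> : forall p e T y : R, p / (n%:R - x) + (e / m%:R * (1 + K * (d / n%:R)) + T / n%:R / m%:R + y / m%:R / m%:R)
  - ((1 + K * (d / n%:R)) * (Y / m%:R) + S1 / n%:R / m%:R + S2 / m%:R / m%:R) / (n%:R - x)
  - (p / (n%:R - x) + e / m%:R * (1 + K * (d / n%:R)) + T / n%:R / m%:R + y / m%:R / m%:R - Y / m%:R / n%:R)
  = - (x * Y * m%:R^-1 * n%:R^-1 * (n%:R - x)^-1) - K * d * n%:R^-1 * Y * m%:R^-1 * (n%:R - x)^-1
    - S1 * n%:R^-1 * m%:R^-1 * (n%:R - x)^-1 - S2 * m%:R^-1 * m%:R^-1 * (n%:R - x)^-1.
  by move=> p e T y; field; rewrite hx n0 m0.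
bdauto.
Qed.

Notation pp j := ((rs I j)%:R / (n%:R - (hrow I j)%:R)).
Notation qq k := ((cs I k)%:R / (m%:R - (hcol I k)%:R)).
Notation rho := ((\sum_j rs I j)%N%:R / (m%:R * n%:R - X)).

Lemma my_neq0 k : m%:R - (hcol I k)%:R != 0 :> R.
Proof. by have := my_ge sc cl k; have := sc_m0 sc => h1 h2; rewrite lt0r_neq0 //; lra. Qed.

(* The cell probability agrees with the ratio by which the asserted formula changes when the
   edge [(j, k)] is added to the forbidden graph. *)
Lemma pg_edge j k : bd 60 (-3) (pg lam I j k -
  (1 - (1 - pp j) * (1 - qq k) / (1 - rho) * (1 - dY j k / (Lam * m%:R * n%:R)))).
Proof.
have n0 : n%:R != 0 :> R by rewrite lt0r_neq0 ?(sc_n0 sc).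
have m0 : m%:R != 0 :> R by rewrite lt0r_neq0 ?(sc_m0 sc).
have l0 : lam != 0 by rewrite lt0r_neq0 ?(lam_gt0 sc).
have l1 : 1 - lam != 0 by rewrite lt0r_neq0 // subr_gt0 (lam_lt1 sc).
have hx := nx_neq0 sc cl j; have hy := my_neq0 k.
have mn0 : m%:R * n%:R - X != 0.
  by have := mnX_ge; have := mulr_gt0 (sc_m0 sc) (sc_n0 sc) => h1 h2; rewrite lt0r_neq0 //; lra.
have hmuc : 1 - lam - c != 0.
  by have := mu_c_ge; have := lam_lt1 sc => h1 h2; rewrite lt0r_neq0 //; lra.
pose a := idlt lam I j / (n%:R - (hrow I j)%:R).
pose b := ieta lam I k / (m%:R - (hcol I k)%:R).
have Ea : pp j = lam + a by rewrite /a /idlt; field.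
have Eb : qq k = lam + b by rewrite /b /ieta; field.
have Ec : rho = lam + c by rewrite tot0 /c; field.
have ha : bd 4 (-1) a by rewrite /a; bdauto.
have hb : bd 5 (-1) b by rewrite /b; bdauto.
have hc := bd_c; have hmu := bd_muc; have hdY := bd_dY j k.
have hmn := bd_mnXinv.
pose y := dY j k * Lam^-1 * m%:R^-1 * n%:R^-1.
have Ey : dY j k / (Lam * m%:R * n%:R) = y by rewrite /y; field; rewrite l0 l1 n0 m0.
have hyb : bd 12 (-2) y by rewrite /y; bdauto.
rewrite Ey Ea Eb Ec.
have F1 : b - (ieta lam I k / m%:R + ieta lam I k * (hcol I k)%:R / m%:R / m%:R) =
   ieta lam I k * (hcol I k)%:R ^+ 2 * m%:R^-1 ^+ 2 * (m%:R - (hcol I k)%:R)^-1 by rewrite /b; field; rewrite hy m0.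
have F2 : c - lam * X / m%:R / n%:R = lam * X ^+ 2 * m%:R^-1 * n%:R^-1 * (m%:R * n%:R - X)^-1.
  by rewrite /c; field; rewrite mn0 m0 n0.
have F3 : a * b - idlt lam I j * ieta lam I k * m%:R^-1 * n%:R^-1 =
   idlt lam I j * ieta lam I k * ((hrow I j)%:R * m%:R + (hcol I k)%:R * n%:R - (hrow I j)%:R * (hcol I k)%:R)
    * m%:R^-1 * n%:R^-1 * (n%:R - (hrow I j)%:R)^-1 * (m%:R - (hcol I k)%:R)^-1.
  by rewrite /a /b; field; rewrite hy hx m0 n0.
pose f1 := b - (ieta lam I k / m%:R + ieta lam I k * (hcol I k)%:R / m%:R / m%:R).
pose f2 := c - lam * X / m%:R / n%:R.
pose f3 := a * b - idlt lam I j * ieta lam I k * m%:R^-1 * n%:R^-1.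
have hf1 : bd 15 (-3) f1 by rewrite /f1 F1; bdauto.
have hf2 : bd 15 (-4) f2 by rewrite /f2 F2; bdauto.
have hf3 : bd 24 (-3) f3 by rewrite /f3 F3; bdauto.
have hpg := pg_simpl j k; set f4 := (X in bd _ _ X) in hpg.
have Epg : pg lam I j k = f4 + (pp j + ieta lam I k / m%:R * (1 + kap * (idlt lam I j / n%:R)) + TT lam I k / n%:R / m%:R
   + ieta lam I k * (hcol I k)%:R / m%:R / m%:R - (lam * X - SS j) / m%:R / n%:R) by rewrite /f4 subrK.
rewrite Epg Ea.
(* All terms of lower order cancel identically; every summand of the right-hand side is O~(u^-3). *)
have EE : f4 + (lam + a + ieta lam I k / m%:R * (1 + kap * (idlt lam I j / n%:R)) + TT lam I k / n%:R / m%:R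
   + ieta lam I k * (hcol I k)%:R / m%:R / m%:R - (lam * X - SS j) / m%:R / n%:R) -
  (1 - (1 - (lam + a)) * (1 - (lam + b)) / (1 - (lam + c)) * (1 - y)) =
  f4 - f1 + f2 + f3 * (1 - lam)^-1
  + ((1 - lam)^-1 * a * b + c - a - b) * (- y)
  - (c * a + c * b - c ^+ 2 - c * a * b * (1 - lam)^-1) * (1 - lam - c)^-1 * (1 - y)
  - (idlt lam I j + ieta lam I k + lam) * m%:R^-1 * n%:R^-1.
  have -> : (1 - (lam + a)) * (1 - (lam + b)) / (1 - (lam + c)) =
    (1 - lam) - a - b + c + a * b / (1 - lam) -
      (c * a + c * b - c ^+ 2 - c * a * b * (1 - lam)^-1) * (1 - lam - c)^-1.
    by rewrite !opprD !addrA; exact: edge_quot.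
  have -> : f1 = b - (ieta lam I k / m%:R + ieta lam I k * (hcol I k)%:R / m%:R / m%:R) by [].
  have -> : f2 = c - lam * X / m%:R / n%:R by [].
  have -> : f3 = a * b - idlt lam I j * ieta lam I k * m%:R^-1 * n%:R^-1 by [].
  have Ey2 : (1 - lam) * y = ((idlt lam I j + lam) * (ieta lam I k + lam) + lam * SS j + lam * TT lam I k) * lam^-1 * m%:R^-1 * n%:R^-1.
    by rewrite /y /dY; field; rewrite l0 l1 n0 m0.
  set rem := (_ * (1 - lam - c)^-1).
  have -> : forall N : R, 1 - (1 - lam - a - b + c + N - rem) * (1 - y) =
     1 - (1 - lam - a - b + c + N) + (1 - lam) * y - (a + b - c - N) * y + rem * (1 - y) by move=> N; ring.
  rewrite Ey2; clearbody a b c y f4 rem; field; by rewrite l0 l1 n0 m0.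
rewrite EE.
clear EE F1 F2 F3 Epg Ey; clearbody a b c y f1 f2 f3 f4.
bdauto.
Qed.

Lemma Pr_edge j k : nonempty I -> (j, k) \notin forb I ->
  bd 200 (-3) (1 - Pr I (j, k) - (1 - pp j) * (1 - qq k) / (1 - rho) * (1 - dY j k / (Lam * m%:R * n%:R))).
Proof.
move=> ne hjk; have h1 := Pr_second sc cl hr ne hjk; have h2 := pg_edge j k.
have -> : forall x y : R, 1 - x - y = - ((x - pg lam I j k) + (pg lam I j k - (1 - y))) by move=> x y; ring.
have := bdN w_ge u_ge1 (bdD w_ge u_ge1 h1 h2) => h; exact: (bd_le w_ge u_ge1 h).
Qed.

End Fixed.
End Edge.

(** * Codegrees *)

Section Codegree.
Context {R : realFieldType} (w u lam : R) (m n : nat).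
Hypothesis sc : scale w u lam m n.
Let w_ge := w_ge16 sc.
Let u_ge1 := u_ge1' sc.
Notation bd := (bd w u).
Notation Lam := (lam * (1 - lam)).
Implicit Types (i j : 'I_m) (k l : 'I_n).
Notation kap := ((1 - 2 * lam) / Lam).

Variables (r : nat) (I : inst m n).
Hypothesis cl : cls w u lam r I.
Hypotheses (hr : (r <= 3)%N) (tot0 : (\sum_j rs I j)%N%:R = lam * m%:R * n%:R).
Hypotheses (forb0 : forb I = set0) (ne : nonempty I).

Let n0 : n%:R != 0 :> R. Proof. by rewrite lt0r_neq0 ?(sc_n0 sc). Qed.
Let m0 : m%:R != 0 :> R. Proof. by rewrite lt0r_neq0 ?(sc_m0 sc). Qed.
Let l0 : lam != 0. Proof. by rewrite lt0r_neq0 ?(lam_gt0 sc). Qed.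
Let l1 : 1 - lam != 0. Proof. by rewrite lt0r_neq0 // subr_gt0 (lam_lt1 sc). Qed.

Lemma hrow0 j : hrow I j = 0%N.
Proof. by rewrite /hrow big1 // => k _; rewrite forb0 inE. Qed.
Lemma hcol0 k : hcol I k = 0%N.
Proof. by rewrite /hcol big1 // => k' _; rewrite forb0 inE. Qed.
Lemma TT0 k : TT lam I k = 0.
Proof. by rewrite /TT big1 // => i _; rewrite forb0 inE mul0r. Qed.
Lemma sum_eta0 : \sum_k ieta lam I k = 0.
Proof. by rewrite (sum_eta cl) tot0 subrr forb0 cards0 mulr0 addr0. Qed.
Lemma sum_dlt0 : \sum_j idlt lam I j = 0.
Proof. by rewrite sum_dlt tot0 subrr forb0 cards0 mulr0 addr0. Qed.

Lemma pg0 j k : pg lam I j k =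
  lam + idlt lam I j / n%:R + ieta lam I k / m%:R * (1 + kap * (idlt lam I j / n%:R)).
Proof.
have -> : pg lam I j k = (rs I j)%:R / n%:R + gg lam I j k - (\sum_l gg lam I j l) / n%:R.
  rewrite /pg hrow0 subr0; congr (_ - _ / _); apply: eq_bigl => l; by rewrite forb0 inE.
have E l : gg lam I j l = ieta lam I l * (m%:R^-1 * (1 + kap * (idlt lam I j / n%:R))).
  by rewrite /gg TT0 hcol0; ring.
under eq_bigr do rewrite E.
by rewrite -mulr_suml sum_eta0 !mul0r E /idlt hrow0; field; rewrite l0 l1 n0 m0.
Qed.

Section OccPair.
Variables (i : 'I_m) (k l : 'I_n).
Hypothesis neq : k != l.
Let J := occ I (i, k).
Let notf e : e \notin forb I. Proof. by rewrite forb0 inE. Qed.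

Lemma forbJ e : (e \in forb J) = (e == (i, k)).
Proof. by rewrite /= forb0 setU0 inE. Qed.
Lemma hrowJ : hrow J i = 1%N.
Proof. by rewrite hrow_occ // hrow0 eqxx. Qed.
Lemma hcolJ k' : hcol J k' = (k' == k).
Proof. by rewrite hcol_occ // hcol0. Qed.
Lemma rsJ : (rs J i)%:R = (rs I i)%:R - 1 :> R.
Proof. by have [h _] := cls_pos sc (i, k) cl; rewrite /= eqxx natrB. Qed.
Lemma etaJ k' : ieta lam J k' = ieta lam I k' - (1 - lam) * (k' == k)%:R.
Proof.
have [_ h] := cls_pos sc (i, k) cl; rewrite /ieta hcolJ hcol0 /= natr_sub_bool; last by move=> /eqP ->.
by ring.
Qed.
Lemma dltJ : idlt lam J i = idlt lam I i - (1 - lam).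
Proof. by rewrite /idlt rsJ hrowJ hrow0; ring. Qed.

Lemma ggJ k' : k' != k -> gg lam J i k' = ieta lam I k' * (m%:R^-1 * (1 + kap * (idlt lam J i / n%:R))).
Proof.
move=> hk; rewrite /gg etaJ hcolJ (negbTE hk) /TT big1; first by rewrite /=; ring.
by move=> a _; rewrite forbJ xpair_eqE (negbTE hk) andbF mul0r.
Qed.

Lemma pgJ : bd 30 (-3) (pg lam J i l - (lam + idlt lam I i / n%:R - (1 - lam) / n%:R
   + ieta lam I l / m%:R * (1 + kap * (idlt lam I i / n%:R)))).
Proof.
have clJ : cls w u lam r.+1 J by apply: (cls_occ sc cl) => //; exact: leq_ltn_trans hr _.
have hx := nx_neq0 sc clJ i; have hxi := bd_nxinv sc clJ i.
rewrite hrowJ in hx hxi.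
have E : \sum_(l' | (i, l') \notin forb J) gg lam J i l' = - (ieta lam I k * (m%:R^-1 * (1 + kap * (idlt lam J i / n%:R)))).
  rewrite (eq_bigl (fun l' => l' != k)); last by move=> l'; rewrite forbJ xpair_eqE eqxx.
  rewrite (eq_bigr (fun l' => ieta lam I l' * (m%:R^-1 * (1 + kap * (idlt lam J i / n%:R))))); last by move=> l' /ggJ.
  rewrite -mulr_suml -[RHS]mulNr; congr (_ * _); apply/eqP; rewrite -addr_eq0 addrC.
  by have := sum_eta0; rewrite (bigD1 k) //= => ->.
rewrite /pg E ggJ 1?eq_sym // hrowJ rsJ dltJ.
have hd := bd_dlt sc cl i; have he := bd_eta sc cl k; have he' := bd_eta sc cl l.
have -> : (rs I i)%:R = idlt lam I i + lam * n%:R by rewrite /idlt hrow0; ring.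
move: hd he he'; set d := idlt lam I i; set e := ieta lam I k; set e' := ieta lam I l => hd he he'.
set K := kap; have hK : bd 4 0 K by rewrite /K; bdauto.
clearbody d e e' K.
have -> : (d + lam * n%:R - 1) / (n%:R - 1%:R) + e' * (m%:R^-1 * (1 + K * ((d - (1 - lam)) / n%:R))) -
 - (e * (m%:R^-1 * (1 + K * ((d - (1 - lam)) / n%:R)))) / (n%:R - 1%:R) -
 (lam + d / n%:R - (1 - lam) / n%:R + e' / m%:R * (1 + K * (d / n%:R))) =
  (d - (1 - lam)) * n%:R^-1 * (n%:R - 1%:R)^-1 - e' * m%:R^-1 * K * (1 - lam) * n%:R^-1
  + e * m%:R^-1 * (1 + K * ((d - (1 - lam)) * n%:R^-1)) * (n%:R - 1%:R)^-1.
  by field; rewrite n0 m0 hx.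
bdauto.
Qed.

(** The probability of [(i, k)] times that of [(i, l)] in the instance with [(i, k)] occupied, both
    to second order. The row has lost one unit and one cell, which shifts the second factor by
    [- (1 - lam) / n]. *)
Lemma mean_two : bd 240 (-3) (mean I (fun G => (G (i, k))%:R * (G (i, l))%:R) -
  (lam + idlt lam I i / n%:R + ieta lam I k / m%:R * (1 + kap * (idlt lam I i / n%:R))) *
  (lam + idlt lam I i / n%:R - (1 - lam) / n%:R + ieta lam I l / m%:R * (1 + kap * (idlt lam I i / n%:R)))).
Proof.
have clJ : cls w u lam r.+1 J by apply: (cls_occ sc cl) => //; exact: leq_ltn_trans hr _.
have neJ : nonempty J := nonempty_occ sc cl ne (notf _).
have [h1 h2] := cls_pos sc (i, k) cl.
rewrite (mean_occ (notf _) h1 h2); last first.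
  by move=> G; rewrite ffunE xpair_eqE eqxx [l == k]eq_sym (negbTE neq).
have hP := Pr_second sc cl (leq_trans hr (isT : (3 <= 4)%N)) ne (notf (i, k)).
rewrite pg0 in hP.
have hn : (i, l) \notin forb J by rewrite forbJ xpair_eqE eqxx eq_sym (negbTE neq).
have hP' := Pr_second sc clJ hr neJ hn; have hg := pgJ.
rewrite -/J -/(Pr J (i, l)).
move: hP hP' hg; set P := Pr I _; set P' := Pr J _; set A := (X in P - X); set g := pg _ _ _ _; set A' := (X in g - X).
move=> hP hP' hg.
have hP1 : bd 0 0 P'.
  by apply: (bd_le1 w_ge u_ge1); apply: mean_norm_le1 => G _; rewrite normr_nat; case: (G _).
have hA : bd 20 0 A by rewrite /A; bdauto.
have -> : P * P' - A * A' = (P - A) * P' + A * ((P' - g) + (g - A')) by ring.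
clearbody P P' A g A'; bdauto.
Qed.
End OccPair.

Definition Rdev : R := \sum_i ((rs I i)%:R - lam * n%:R) ^+ 2.

(** Sum of O~(u^2) rows with error O~(u^-3) each. Terms linear in the row deviations vanish because
    the total is exact; the quadratic ones give [Rdev], and the shift by [- (1 - lam) / n] gives
    [Lam * m / n]. *)
Lemma mean_cod k l : k != l -> bd 250 (-1) (mean I (cod k l) -
  ((cs I k)%:R * (cs I l)%:R / m%:R - (Lam * m%:R / n%:R - Rdev / n%:R ^+ 2))).
Proof.
move=> neq.
set b := ieta lam I k / m%:R; set b' := ieta lam I l / m%:R.
pose a i := idlt lam I i / n%:R.
pose A i := (lam + a i + b * (1 + kap * a i)) * (lam + a i - (1 - lam) / n%:R + b' * (1 + kap * a i)).
pose F i := mean I (fun G => (G (i, k))%:R * (G (i, l))%:R) - A i.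
have h1 : bd 241 (-1) (\sum_i F i).
  by apply: (bd_le w_ge u_ge1 (bd_sum_m sc (fun i => mean_two i neq))).
have E1 : mean I (cod k l) = \sum_i F i + \sum_i A i.
  rewrite -big_split /= /cod mean_sum; apply: eq_bigr => i _; by rewrite subrK.
have dE i : idlt lam I i = (rs I i)%:R - lam * n%:R by rewrite /idlt hrow0; ring.
have S2 : \sum_i a i ^+ 2 = Rdev / n%:R ^+ 2.
  by rewrite /Rdev mulr_suml; apply: eq_bigr => i _; rewrite /a dE expr_div_n.
have S1 : \sum_i a i = 0 by rewrite -mulr_suml sum_dlt0 mul0r.
have hb : bd 5 (-1) b by rewrite /b; bdauto.
have hb' : bd 5 (-1) b' by rewrite /b'; bdauto.
have E2 : \sum_i A i = m%:R * (lam + b) * (lam + b' - (1 - lam) / n%:R)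
   + (\sum_i a i ^+ 2) * ((1 + kap * b) * (1 + kap * b')).
  transitivity (\sum_i ((lam + b) * (lam + b' - (1 - lam) / n%:R) +
    (((lam + b) * (1 + kap * b') + (lam + b' - (1 - lam) / n%:R) * (1 + kap * b)) * a i
     + (1 + kap * b) * (1 + kap * b') * a i ^+ 2))).
    by apply: eq_bigr => i _; rewrite /A; ring.
  by rewrite sum_affine S1; ring.
have hS2 : bd 10 0 (\sum_i a i ^+ 2).
  by apply: (bd_le w_ge u_ge1 (bd_sum_m sc (p := 6) (e := -2) _)) => // i; rewrite /a; bdauto.
rewrite E1 E2.
have Ek : (cs I k)%:R = m%:R * (lam + b) by rewrite /b /ieta hcol0; field.
have El : (cs I l)%:R = m%:R * (lam + b') by rewrite /b' /ieta hcol0; field.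
rewrite Ek El -S2; move: h1 hS2; set SF := \sum_i F i; set S := \sum_i a i ^+ 2 => h1 hS2.
set K := kap; have hK : bd 4 0 K by rewrite /K; bdauto.
clear E1 E2 S1 S2 Ek El; clearbody b b' SF S K.
have -> : SF + (m%:R * (lam + b) * (lam + b' - (1 - lam) / n%:R) + S * ((1 + K * b) * (1 + K * b'))) -
   (m%:R * (lam + b) * (m%:R * (lam + b')) / m%:R - (Lam * m%:R / n%:R - S)) =
   SF + S * (K * b + K * b' + K * b * (K * b')) - m%:R * b * (1 - lam) * n%:R^-1.
  by field; rewrite n0 m0.
bdauto.
Qed.

End Codegree.

From mathcomp Require Import boolp reals sequences exp.

(** * The asserted formula *)

Section LogBounds.
Context {R : realType}.
Implicit Types x y d : R.

Lemma ln_le_sub1 x : 0 < x -> ln x <= x - 1.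
Proof.
move=> x0; have h := @le_ln1Dx R (x - 1); rewrite (_ : 1 + (x - 1) = x) in h; last by ring.
by apply: h; lra.
Qed.

Lemma ln_ge_sub1 x : 0 < x -> 1 - x^-1 <= ln x.
Proof.
move=> x0; have := @ln_le_sub1 x^-1; rewrite invr_gt0 => /(_ x0).
by rewrite lnV ?posrE //; lra.
Qed.

Lemma ln_sub_bound x y d : 0 < y -> `|x - y| <= d -> 2 * d <= y -> `|ln x - ln y| <= 2 * d / y.
Proof.
move=> y0 hd hy; have d0 : 0 <= d := le_trans (normr_ge0 _) hd.
have x0 : y / 2 <= x by move: hd; rewrite ler_norml => /andP[h1 h2]; lra.
have xp : 0 < x by lra.
rewrite -(ln_div _ _) ?posrE //.
have q0 : 0 < x / y by rewrite divr_gt0.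
have h1 := ln_le_sub1 q0; have h2 := ln_ge_sub1 q0.
move: hd; rewrite ler_norml => /andP[h3 h4].
rewrite ler_norml; apply/andP; split.
  apply: le_trans h2; rewrite invf_div lerNl opprB.
  have -> : y / x - 1 = (y - x) / x by field; rewrite gt_eqF.
  rewrite ler_pdivrMr // mulrAC ler_pdivlMr //.
  apply: (@le_trans _ _ (d * y)); first by rewrite ler_wpM2r ?(ltW y0) //; lra.
  have -> : 2 * d * x = d * (2 * x) by ring.
  by rewrite ler_wpM2l //; lra.
apply: le_trans h1 _.
have -> : x / y - 1 = (x - y) / y by field; rewrite gt_eqF.
by rewrite ler_pM2r ?invr_gt0 //; lra.
Qed.

Lemma ln1_bound y : `|y| <= 1 / 2 -> `|ln (1 - y) + y| <= 2 * y ^+ 2.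
Proof.
rewrite ler_norml => /andP[h1 h2].
have p0 : 0 < 1 - y by lra.
have h3 := ln_le_sub1 p0; have h4 := ln_ge_sub1 p0.
have h5 : (1 - y)^-1 <= 1 + y + 2 * y ^+ 2.
  rewrite -div1r ler_pdivrMr //.
  have : 0 <= y ^+ 2 * (1 - 2 * y) by rewrite mulr_ge0 ?sqr_ge0 //; lra.
  by move=> ?; nra.
have := sqr_ge0 y; rewrite ler_norml => ?; apply/andP; split; lra.
Qed.
End LogBounds.

Section Formula.
Context {R : realType} {m n : nat}.
Variable lam : R.
Implicit Types I : inst m n.
Notation Lam := (lam * (1 - lam)).

Definition mterm I : R := ('C(m * n - #|forb I|, \sum_j rs I j))%:R^-1
  * \prod_j ('C(n - hrow I j, rs I j))%:R * \prod_k ('C(m - hcol I k, cs I k))%:R.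

Definition Cdev I : R := \sum_k ((cs I k)%:R - lam * m%:R) ^+ 2.
Definition Ydev I : R := \sum_j \sum_(k | (j, k) \in forb I) idlt lam I j * ieta lam I k.

Definition expo I : R :=
  - 2^-1 * (1 - Rdev lam I / (Lam * m%:R * n%:R)) * (1 - Cdev I / (Lam * m%:R * n%:R))
  - Ydev I / (Lam * m%:R * n%:R).

(* logarithm of the ratio of the true count to the asserted formula *)
Definition lr I : R := ln (#|graphs I|%:R / mterm I) - expo I.
End Formula.

(** * Effect of one more forbidden cell on the count and on the formula *)

Section StepA.
Context {R : realType} (w u lam : R) (m n : nat).
Hypothesis sc : scale w u lam m n.
Let w_ge := w_ge16 sc.
Let u_ge1 := u_ge1' sc.
Notation bd := (bd w u).
Notation Lam := (lam * (1 - lam)).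
Implicit Types (i j : 'I_m) (k l : 'I_n).

Lemma ln_approx (p : nat) (e : int) (x y : R) : bd p e (x - y) -> e <= -1 -> (p < 498)%N ->
  (1 - lam) / 2 <= y -> bd (p + 3) e (ln x - ln y).
Proof.
move=> h he hp hy.
have m0 : 0 < 1 - lam by rewrite subr_gt0 (lam_lt1 sc).
have y0 : 0 < y by lra.
have h4 : bd p.+1 e (4 * (x - y)).
  have h4 := bd_natr w_ge u_ge1 (isT : (4 <= 16)%N).
  by apply: (bd_le w_ge u_ge1 (bdM w_ge u_ge1 h4 h)) => //; rewrite ?add1n ?add0r.
have hs := small_half sc h4 he (ltn_trans hp (isT : (498 < 499)%N)).
have hw : w^-1 <= 1 - lam.
  have l0 := lam_gt0 sc; have l1 := lam_lt1 sc; have w0 := sc_w0 sc.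
  rewrite -div1r ler_pdivrMr //; apply: le_trans (lam_var sc) _; rewrite mulrC ler_wpM2r ?(ltW w0) //.
  by rewrite ler_piMl ?subr_ge0 ?(ltW l1).
have hd : 2 * `|x - y| <= y.
  have := le_trans hs hw; rewrite normrM normr_nat; lra.
have hln := ln_sub_bound y0 (lexx _) hd.
apply: (bd_norm_le w_ge u_ge1 (y := 4 * `|x - y| * (1 - lam)^-1)).
  apply: le_trans hln _.
  rewrite ler_pdivrMr // -mulrA -mulrA.
  have -> : 2 * `|x - y| = 4 * (`|x - y| * ((1 - lam)^-1 * ((1 - lam) / 2))) by field; rewrite gt_eqF.
  by rewrite ler_wpM2l // -[leRHS]mulrA !ler_wpM2l ?normr_ge0 ?invr_ge0 ?(ltW m0).
have h4' := bd_natr w_ge u_ge1 (isT : (4 <= 16)%N).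
apply: (bd_le w_ge u_ge1 (bdM w_ge u_ge1 (bdM w_ge u_ge1 h4' (bd_norm w_ge u_ge1 h)) (bd_1laminv sc))); first by lia.
by rewrite add0r addr0.
Qed.

Variable (I : inst m n).
Hypothesis cl : cls w u lam 0 I.
Hypothesis tot0 : (\sum_j rs I j)%N%:R = lam * m%:R * n%:R.

Notation X := (#|forb I|%:R : R).
Notation pp j := ((rs I j)%:R / (n%:R - (hrow I j)%:R)).
Notation qq k := ((cs I k)%:R / (m%:R - (hcol I k)%:R)).
Notation rho := ((\sum_j rs I j)%N%:R / (m%:R * n%:R - X)).

Let nx_pos j : 0 < n%:R - (hrow I j)%:R :> R.
Proof. by have := nx_ge sc cl j; have := sc_n0 sc => h1 h2; lra. Qed.
Let my_pos k : 0 < m%:R - (hcol I k)%:R :> R.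
Proof. by have := my_ge sc cl k; have := sc_m0 sc => h1 h2; lra. Qed.
Let mnX_pos : 0 < m%:R * n%:R - X.
Proof. by have := mnX_ge sc cl; have := mulr_gt0 (sc_m0 sc) (sc_n0 sc) => h1 h2; lra. Qed.

Lemma pp_lt1 j : pp j < 1 :> R.
Proof.
have h : bd 5 (-1) (2 * (idlt lam I j / (n%:R - (hrow I j)%:R))) by bdauto.
have := small_half sc h isT isT.
have l0 := lam_gt0 sc; have l1 := lam_lt1 sc; have w0 := sc_w0 sc.
have hw : w^-1 <= 1 - lam.
  rewrite -div1r ler_pdivrMr //; apply: le_trans (lam_var sc) _; rewrite mulrC ler_wpM2r ?(ltW w0) //.
  by rewrite ler_piMl ?subr_ge0 ?(ltW l1).
rewrite ler_norml => /andP[_ h2]; have := le_trans h2 hw.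
have -> : pp j = lam + idlt lam I j / (n%:R - (hrow I j)%:R).
  by rewrite /idlt; field; rewrite gt_eqF // nx_pos.
lra.
Qed.

Lemma qq_lt1 k : qq k < 1 :> R.
Proof.
have h : bd 6 (-1) (2 * (ieta lam I k / (m%:R - (hcol I k)%:R))) by bdauto.
have := small_half sc h isT isT.
have l0 := lam_gt0 sc; have l1 := lam_lt1 sc; have w0 := sc_w0 sc.
have hw : w^-1 <= 1 - lam.
  rewrite -div1r ler_pdivrMr //; apply: le_trans (lam_var sc) _; rewrite mulrC ler_wpM2r ?(ltW w0) //.
  by rewrite ler_piMl ?subr_ge0 ?(ltW l1).
rewrite ler_norml => /andP[_ h2]; have := le_trans h2 hw.
have -> : qq k = lam + ieta lam I k / (m%:R - (hcol I k)%:R).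
  by rewrite /ieta; field; rewrite gt_eqF // my_pos.
lra.
Qed.

Lemma rho_lt1 : rho < 1 :> R.
Proof.
have := mu_c_ge sc cl; have := lam_lt1 sc.
have -> : rho = lam + lam * X / (m%:R * n%:R - X) by rewrite tot0; field; rewrite gt_eqF // mnX_pos.
lra.
Qed.

Lemma rs_le j : (rs I j < n - hrow I j)%N.
Proof.
have := pp_lt1 j; rewrite ltr_pdivrMr // mul1r ltrBrDr -natrD ltr_nat.
by rewrite ltn_subRL addnC.
Qed.

Lemma cs_le k : (cs I k < m - hcol I k)%N.
Proof.
have := qq_lt1 k; rewrite ltr_pdivrMr // mul1r ltrBrDr -natrD ltr_nat.
by rewrite ltn_subRL addnC.
Qed.

Lemma tot_le : (\sum_j rs I j < m * n - #|forb I|)%N.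
Proof.
have := rho_lt1; rewrite ltr_pdivrMr // mul1r ltrBrDr -natrD -natrM ltr_nat.
by rewrite ltn_subRL addnC.
Qed.

Lemma mterm_gt0 : 0 < mterm I :> R.
Proof.
rewrite /mterm !mulr_gt0 ?invr_gt0 ?ltr0n ?bin_gt0 ?(ltnW tot_le) //.
  by apply: prodr_gt0 => j _; rewrite ltr0n bin_gt0 ltnW // rs_le.
by apply: prodr_gt0 => j _; rewrite ltr0n bin_gt0 ltnW // cs_le.
Qed.

Lemma bin_step (N x s : nat) : (s < N - x)%N ->
  ('C(N - (x + 1), s))%:R = (1 - s%:R / (N%:R - x%:R)) * ('C(N - x, s))%:R :> R.
Proof.
move=> h; have hN : (x < N)%N by rewrite -subn_gt0; apply: leq_ltn_trans h.
have := mul_bin_down (N - x) s; rewrite -subnS -addn1 => E.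
have hp : (0 : R) < (N - x)%N%:R by rewrite ltr0n subn_gt0.
have : ((N - x) * 'C(N - (x + 1), s))%N%:R = ((N - x - s) * 'C(N - x, s))%N%:R :> R by rewrite E.
have e1 : (N - x)%N%:R = N%:R - x%:R :> R by rewrite natrB // ltnW.
have e2 : (N - x - s)%N%:R = N%:R - x%:R - s%:R :> R by rewrite natrB ?e1 // ltnW.
rewrite !natrM e2; rewrite e1 in hp *; move=> E2.
apply: (mulfI (lt0r_neq0 hp)); rewrite E2; field; exact: lt0r_neq0.
Qed.

Section AddEdge.
Variables (j : 'I_m) (k : 'I_n).
Hypotheses (ne : nonempty I) (hjk : (j, k) \notin forb I).
Let J := emp I (j, k).

Lemma hrow_emp i : hrow J i = (hrow I i + (i == j))%N.
Proof. exact: (hrow_occ i hjk). Qed.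
Lemma hcol_emp l : hcol J l = (hcol I l + (l == k))%N.
Proof. exact: (hcol_occ l hjk). Qed.

Lemma mterm_emp : mterm J = mterm I * ((1 - pp j) * (1 - qq k) / (1 - rho)) :> R.
Proof.
rewrite /mterm /= cardsU1 hjk add1n -addn1.
rewrite (bin_step tot_le) natrM.
have -> : \prod_(j0 < m) ('C(n - hrow J j0, rs I j0))%:R = (1 - pp j) * \prod_(j0 < m) ('C(n - hrow I j0, rs I j0))%:R :> R.
  rewrite (bigD1 j) //= [in RHS](bigD1 j) //= hrow_emp eqxx (bin_step (rs_le j)) mulrA; congr (_ * _).
  by apply: eq_bigr => i /negbTE hi; rewrite hrow_emp hi addn0.
have -> : \prod_(k0 < n) ('C(m - hcol J k0, cs I k0))%:R = (1 - qq k) * \prod_(k0 < n) ('C(m - hcol I k0, cs I k0))%:R :> R.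
  rewrite (bigD1 k) //= [in RHS](bigD1 k) //= hcol_emp eqxx (bin_step (cs_le k)) mulrA; congr (_ * _).
  by apply: eq_bigr => i /negbTE hi; rewrite hcol_emp hi addn0.
by rewrite invfM; ring.
Qed.

Lemma Ydev_emp : Ydev lam J = Ydev lam I + dY lam I j k.
Proof.
have dE i : idlt lam J i = idlt lam I i + lam * (i == j)%:R by rewrite /idlt hrow_emp natrD; ring.
have eE l : ieta lam J l = ieta lam I l + lam * (l == k)%:R by rewrite /ieta hcol_emp natrD; ring.
have mk (S : {set 'I_m * 'I_n}) (f : 'I_m -> R) (g : 'I_n -> R) :
    \sum_i \sum_(l | (i, l) \in S) f i * g l = \sum_(e in S) f e.1 * g e.2.
  by rewrite pair_big_dep /=; apply: eq_bigl => -[a b].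
rewrite /Ydev !mk /= big_setU1 //= !dE !eE !eqxx !mulr1.
have E1 : SS lam I j = \sum_(e in forb I) (e.1 == j)%:R * ieta lam I e.2.
  rewrite -(mk (forb I) (fun i => (i == j)%:R) (ieta lam I)) (bigD1 j) //= eqxx.
  rewrite [X in _ + X]big1 ?addr0; last by move=> i /negbTE ->; rewrite big1 // => l _; rewrite mul0r.
  by rewrite /SS [RHS]big_mkcond; apply: eq_bigr => l _; case: (_ \in _); rewrite ?mul1r ?mul0r.
have E2 : TT lam I k = \sum_(e in forb I) idlt lam I e.1 * (e.2 == k)%:R.
  rewrite -(mk (forb I) (idlt lam I) (fun l => (l == k)%:R)) /TT; apply: eq_bigr => i _.
  rewrite big_mkcond (bigD1 k) //= eqxx big1 ?addr0; last by move=> l /negbTE ->; rewrite mulr0 if_same.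
  by case: (_ \in _); rewrite ?mul1r ?mul0r ?mulr1.
have -> : \sum_(e in forb I) idlt lam J e.1 * ieta lam J e.2 =
   \sum_(e in forb I) idlt lam I e.1 * ieta lam I e.2 + lam * SS lam I j + lam * TT lam I k.
  rewrite E1 E2 !mulr_sumr -!big_split /=; apply: eq_bigr => -[a b] hab /=.
  (* The edge is new, so no old edge has both its ends shifted. *)
  rewrite dE eE; suff h : (a == j)%:R * (b == k)%:R = 0 :> R.
    have -> : (idlt lam I a + lam * (a == j)%:R) * (ieta lam I b + lam * (b == k)%:R) =
      idlt lam I a * ieta lam I b + lam * ((a == j)%:R * ieta lam I b) + lam * (idlt lam I a * (b == k)%:R)
      + lam ^+ 2 * ((a == j)%:R * (b == k)%:R) by ring.
    by rewrite h mulr0 addr0.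
  case: eqP => [ea|]; last by rewrite mul0r.
  case: eqP => [eb|]; last by rewrite mulr0.
  by rewrite ea eb (negbTE hjk) in hab.
rewrite /dY; ring.
Qed.

(** The count is multiplied by [1 - Pr], the formula by [Q * expR (- y)]. [Pr_edge] compares the
    former with [Q * (1 - y)], and [ln (1 - y)] is [- y] up to O~(u^-4). *)
Lemma edge_step : nonempty J /\ bd 215 (-3) (lr lam J - lr lam I).
Proof.
pose Q := (1 - pp j) * (1 - qq k) / (1 - rho).
pose y := dY lam I j k / (Lam * m%:R * n%:R).
have Q0 : 0 < Q by rewrite /Q divr_gt0 ?mulr_gt0 ?subr_gt0 ?pp_lt1 ?qq_lt1 ?rho_lt1.
have n0 : n%:R != 0 :> R by rewrite lt0r_neq0 ?(sc_n0 sc).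
have m0 : m%:R != 0 :> R by rewrite lt0r_neq0 ?(sc_m0 sc).
have L0 := sc_Lam0 sc.
have l0 := lam_gt0 sc; have l1 := lam_lt1 sc; have w0 := sc_w0 sc.
have hw : w^-1 <= 1 - lam.
  rewrite -div1r ler_pdivrMr //; apply: le_trans (lam_var sc) _; rewrite mulrC ler_wpM2r ?(ltW w0) //.
  by rewrite ler_piMl ?subr_ge0 ?(ltW l1).
have hy : bd 13 (-2) y.
  have h : bd 10 2 (dY lam I j k) := bd_dY sc cl j k.
  have -> : y = dY lam I j k * Lam^-1 * m%:R^-1 * n%:R^-1.
    rewrite /y; field; rewrite n0 m0 !lt0r_neq0 ?subr_gt0 //.
  bdauto.
have hP := Pr_zeroth sc cl ne hjk.
have hE := Pr_edge sc cl isT tot0 ne hjk; rewrite -/Q -/y in hE.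
have hP2 : bd 121 (-1) (2 * (Pr I (j, k) - lam)).
  have h2 := bd_natr w_ge u_ge1 (isT : (2 <= 16)%N).
  exact: (bd_le w_ge u_ge1 (bdM w_ge u_ge1 h2 hP)).
have P1 : (1 - lam) / 2 <= 1 - Pr I (j, k).
  have := le_trans (small_half sc hP2 isT isT) hw; rewrite ler_norml => /andP[_ h]; lra.
have neJ : nonempty J.
  rewrite /nonempty -(ltr0n R) card_emp // mulr_gt0 ?ltr0n //; lra.
split=> //.
have hln : bd 203 (-3) (ln (Q * (1 - y)) - ln (1 - Pr I (j, k))).
  apply: (@ln_approx 200 (-3)) => //.
  by have := bdN w_ge u_ge1 hE; rewrite opprB.
have hy2 : `|y| <= 1 / 2.
  have h2y : bd 14 (-2) (2 * y) by bdauto.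
  have := small_half sc h2y isT isT.
  have h1 : w^-1 <= 1 by rewrite invf_le1 ?(sc_w1 sc).
  move=> h; have := le_trans h h1; rewrite normrM normr_nat; lra.
have hl := ln1_bound hy2.
have hl2 : bd 28 (-4) (ln (1 - y) + y).
  have hq : bd 28 (-4) (2 * y ^+ 2) by bdauto.
  exact: (bd_norm_le w_ge u_ge1 hl hq).
have y1 : 0 < 1 - y by move: hy2; rewrite ler_norml => /andP[_ h]; lra.
have -> : lr lam J - lr lam I = (ln (1 - y) + y) - (ln (Q * (1 - y)) - ln (1 - Pr I (j, k))).
  have M0 := mterm_gt0.
  have N0 : (0 : R) < #|graphs I|%:R by rewrite ltr0n.
  have PP : 0 < 1 - Pr I (j, k) :> R by lra.
  have EN : #|graphs J|%:R / mterm J = (#|graphs I|%:R / mterm I) * ((1 - Pr I (j, k)) / Q).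
    rewrite card_emp // mterm_emp -/Q; field; by rewrite (gt_eqF Q0) (gt_eqF M0).
  have q0 : 0 < (1 - Pr I (j, k)) / Q by rewrite divr_gt0.
  have nm0 : 0 < #|graphs I|%:R / mterm I :> R by rewrite divr_gt0.
  have EL : ln (#|graphs J|%:R / mterm J) = ln (#|graphs I|%:R / mterm I) + (ln (1 - Pr I (j, k)) - ln Q) :> R.
    by rewrite EN (lnM nm0 q0) (ln_div PP Q0).
  have EQ : ln (Q * (1 - y)) = ln Q + ln (1 - y) by rewrite (lnM Q0 y1).
  rewrite /lr EL EQ.
  have -> : expo lam J = expo lam I - y.
    rewrite /expo Ydev_emp mulrDl -/y opprD addrA //.
  ring.
exact: (bd_le w_ge u_ge1 (bdB w_ge u_ge1 hl2 hln)).
Qed.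
End AddEdge.
End StepA.

(** * Moving a unit between two columns *)

Section AddForbidden.
Context {R : realType} (w u lam : R) (m n : nat).
Hypothesis sc : scale w u lam m n.
Let w_ge := w_ge16 sc.
Let u_ge1 := u_ge1' sc.
Notation bd := (bd w u).
Variables (s : 'I_m -> nat) (t : 'I_n -> nat).
Hypothesis tot0 : (\sum_j s j)%N%:R = lam * m%:R * n%:R.

Lemma cls_sub (H H' : {set 'I_m * 'I_n}) : H' \subset H -> cls w u lam 0 (Inst s t H) -> cls w u lam 0 (Inst s t H').
Proof.
move=> hH [h1 h2 h3 h4 h5 h6 h7 h8]; split => //.
- move=> j; apply: le_trans (h6 j); rewrite ler_nat; apply: leq_sum => k _ /=.
  by case: (boolP ((j, k) \in H')) => // /(subsetP hH) ->.
- move=> k; apply: le_trans (h7 k); rewrite ler_nat; apply: leq_sum => j _ /=.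
  by case: (boolP ((j, k) \in H')) => // /(subsetP hH) ->.
- by apply: le_trans h8; rewrite ler_nat; exact: subset_leq_card.
Qed.

Lemma forbid_chain (H : {set 'I_m * 'I_n}) : cls w u lam 0 (Inst s t H) ->
  nonempty (Inst s t set0) ->
  nonempty (Inst s t H) /\ bd 220 (-1) (lr lam (Inst s t H) - lr lam (Inst s t set0)).
Proof.
move=> cl ne.
suff : nonempty (Inst s t H) /\ `|lr lam (Inst s t H) - lr lam (Inst s t set0)| <= #|H|%:R * (w ^+ 215 * u ^ (-3)).
  move=> [h1 h2]; split => //; apply: (bd_norm_le w_ge u_ge1 h2).
  have h3 : bd 215 (-3) (w ^+ 215 * u ^ (-3)) by rewrite /bd ger0_norm // mulr_ge0 ?(we_ge0 w_ge) ?(ue_ge0 u_ge1).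
  by apply: (bd_le w_ge u_ge1 (bdM w_ge u_ge1 (bd_card sc cl) h3)).
elim: {H}#|H| {-2}H (erefl #|H|) cl => [|d IH] H hd cl.
  move/eqP: hd; rewrite cards_eq0 => /eqP hd; rewrite hd in cl *.
  by split => //; rewrite subrr normr0 cards0 mul0r.
have [[j k] he] : exists e, e \in H by apply/set0Pn; rewrite -cards_eq0 hd.
pose e := (j, k).
have hH : H = e |: (H :\ e) by rewrite setD1K.
have hn : e \notin H :\ e by rewrite !inE eqxx.
have hc : #|H :\ e| = d by move: hd; rewrite (cardsD1 e) he add1n => -[].
have cl' := cls_sub (subD1set H e) cl.
have [h1 h2] := IH (H :\ e) hc cl'.
have [h3 h4] : nonempty (Inst s t H) /\ bd 215 (-3) (lr lam (Inst s t H) - lr lam (Inst s t (H :\ e))).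
  have -> : Inst s t H = emp (Inst s t (H :\ e)) e by rewrite /emp /= -hH.
  exact: (edge_step sc cl' tot0 h1 hn).
split => //.
have -> : lr lam (Inst s t H) - lr lam (Inst s t set0) =
  (lr lam (Inst s t H) - lr lam (Inst s t (H :\ e))) + (lr lam (Inst s t (H :\ e)) - lr lam (Inst s t set0)) by ring.
apply: le_trans (ler_normD _ _) _; apply: le_trans (lerD h4 h2) _.
by rewrite hc hd -[d.+1%:R]natr1 mulrDl mul1r addrC.
Qed.

End AddForbidden.

(** * A single unit moved from column [l] to column [k], for H empty *)

Section MoveUnit.
Context {R : realType} (w u lam : R) (m n : nat).
Hypothesis sc : scale w u lam m n.
Let w_ge := w_ge16 sc.
Let u_ge1 := u_ge1' sc.
Notation bd := (bd w u).
Notation Lam := (lam * (1 - lam)).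
Variable (s : 'I_m -> nat).
Hypothesis tot0 : (\sum_j s j)%N%:R = lam * m%:R * n%:R.
Notation II t := (Inst s t set0).
Notation box t := (cls w u lam 0 (II t)).
Variables (k l : 'I_n).
Hypothesis neq : k != l.

Let n0 : n%:R != 0 :> R. Proof. by rewrite lt0r_neq0 ?(sc_n0 sc). Qed.
Let m0 : m%:R != 0 :> R. Proof. by rewrite lt0r_neq0 ?(sc_m0 sc). Qed.
Let l0 : lam != 0. Proof. by rewrite lt0r_neq0 ?(lam_gt0 sc). Qed.
Let l1 : 1 - lam != 0. Proof. by rewrite lt0r_neq0 // subr_gt0 (lam_lt1 sc). Qed.
Let mp : 0 < m%:R :> R := sc_m0 sc.
Let Lm0 : 0 < Lam * m%:R. Proof. by rewrite mulr_gt0 ?(sc_Lam0 sc). Qed.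

(** The factor [1 - R / (2 A m n)] of the exponent, with [2 A] equal to [Lam]; [Rdev] reads the
    rows, and the zero column sums are a filler. Times [Lam * m / n] it becomes [xi0], the deficit
    of the mean codegree against [t k * t l / m] found in [mean_cod]. *)
Definition theta : R := 1 - Rdev lam (II (fun _ : 'I_n => 0%N)) / (Lam * m%:R * n%:R).
Definition xi0 : R := Lam * m%:R / n%:R - Rdev lam (II (fun _ : 'I_n => 0%N)) / n%:R ^+ 2.
Definition xi (t : 'I_n -> nat) : R := (t k)%:R * (t l)%:R / m%:R - mean (II t) (cod k l).
(* leading terms of the expected numbers of rows occupied in column [k] only, resp. [l] only *)
Definition Ah (t : 'I_n -> nat) : R := (t k)%:R * (m%:R - (t l)%:R) / m%:R.
Definition Bh (t : 'I_n -> nat) : R := (t l)%:R * (m%:R - (t k)%:R) / m%:R.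
(* Double counting the moves of a unit from column [l] to column [k] shows that [gl] changes by
   only [O~(u^-4)] along such a move, where [lr] itself may change more. *)
Definition gl (t : 'I_n -> nat) : R := lr lam (II t) + ln (1 + xi t / Ah t).

Lemma xi0E : xi0 = theta * (Lam * m%:R / n%:R).
Proof. by rewrite /xi0 /theta; field; rewrite n0 m0 l0 l1. Qed.

Section OneBox.
Variable t : 'I_n -> nat.
Hypothesis bt : box t.
Hypothesis ne : nonempty (II t).

Lemma bd_Rdev : bd 6 4 (Rdev lam (II (fun _ : 'I_n => 0%N))).
Proof.
by apply: (bd_le w_ge u_ge1 (bd_sum_m sc (F := fun i => ((s i)%:R - lam * n%:R) ^+ 2) (p := 4) (e := 2) _)) => // i;
  exact: (bd_le w_ge u_ge1 (bdX w_ge u_ge1 2 (bd_row sc bt i))).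
Qed.

Lemma bd_theta : bd 9 0 theta.
Proof.
have h := bd_Rdev; rewrite /theta.
have -> : forall x : R, x / (Lam * m%:R * n%:R) = x * Lam^-1 * m%:R^-1 * n%:R^-1 by move=> x; field; rewrite n0 m0 l0 l1.
bdauto.
Qed.

Lemma bd_xi0 : bd 11 0 xi0.
Proof. have h := bd_theta; rewrite xi0E; bdauto. Qed.

Lemma bd_xi : bd 250 (-1) (xi t - xi0).
Proof.
have h : bd 250 (-1) (mean (II t) (cod k l) - ((t k)%:R * (t l)%:R / m%:R - xi0)).
  exact: (mean_cod sc bt isT tot0 erefl ne neq).
have -> : xi t - xi0 = - (mean (II t) (cod k l) - ((t k)%:R * (t l)%:R / m%:R - xi0)) by rewrite /xi; ring.
exact: bdN.
Qed.

Notation a := ((t k)%:R - lam * m%:R).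
Notation b := ((t l)%:R - lam * m%:R).
Let ha : bd 2 1 a. Proof. exact: (bd_col sc bt k). Qed.
Let hb : bd 2 1 b. Proof. exact: (bd_col sc bt l). Qed.

Lemma AhE : Ah t = Lam * m%:R + ((1 - lam) * a - lam * b - a * b * m%:R^-1).
Proof. by rewrite /Ah; field. Qed.
Lemma BhE : Bh t = Lam * m%:R + ((1 - lam) * b - lam * a - a * b * m%:R^-1).
Proof. by rewrite /Bh; field. Qed.

Lemma half_Lm (x : R) : bd 8 1 x -> Lam * m%:R / 2 <= Lam * m%:R + x.
Proof.
move=> hx.
have h : bd 11 (-1) (2 * (x * Lam^-1 * m%:R^-1)) by bdauto.
have hs := small_half sc h isT isT.
have hw : w^-1 <= 1 by rewrite invf_le1 ?(sc_w0 sc) // (sc_w1 sc).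
have := le_trans hs hw; rewrite ler_norml => /andP[h1 _].
have E : x = (2 * (x * Lam^-1 * m%:R^-1)) * (Lam * m%:R / 2) by field; rewrite m0 l0 l1.
have L2 : 0 <= Lam * m%:R / 2 by rewrite divr_ge0 ?(ltW Lm0).
have := ler_wpM2r L2 h1; rewrite -E; lra.
Qed.

Lemma Ah_ge : Lam * m%:R / 2 <= Ah t.
Proof. rewrite AhE; apply: half_Lm; bdauto. Qed.
Lemma Bh_ge : Lam * m%:R / 2 <= Bh t.
Proof. rewrite BhE; apply: half_Lm; bdauto. Qed.

Lemma bd_half_inv (x : R) : Lam * m%:R / 2 <= x -> bd 3 (-2) x^-1.
Proof.
move=> h; have x0 : 0 < x by apply: lt_le_trans h; rewrite divr_gt0.
apply: (bd_norm_le w_ge u_ge1 (y := 2 * (Lam^-1 * m%:R^-1))); last by bdauto.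
have p0 : 0 < 2^-1 * (Lam * m%:R) by rewrite mulr_gt0 ?invr_gt0.
by rewrite ger0_norm ?invr_ge0 ?(ltW x0) // -invfM -[2]invrK -invfM lef_pV2 ?posrE // mulrC.
Qed.

Lemma Ah_gt0 : 0 < Ah t. Proof. by apply: lt_le_trans Ah_ge; rewrite divr_gt0. Qed.
Lemma Bh_gt0 : 0 < Bh t. Proof. by apply: lt_le_trans Bh_ge; rewrite divr_gt0. Qed.

Lemma bd_Ahinv : bd 3 (-2) (Ah t)^-1. Proof. exact: bd_half_inv Ah_ge. Qed.
Lemma bd_Bhinv : bd 3 (-2) (Bh t)^-1. Proof. exact: bd_half_inv Bh_ge. Qed.

Lemma bd_xit : bd 251 0 (xi t).
Proof.
have -> : xi t = (xi t - xi0) + xi0 by rewrite subrK.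
exact: (bd_le w_ge u_ge1 (bdD w_ge u_ge1 bd_xi bd_xi0)).
Qed.

Lemma ln1_approx (p : nat) (z : R) : (p < 490)%N -> bd p (-2) z -> 0 < 1 + z /\ bd (p + p + 1) (-4) (ln (1 + z) - z).
Proof.
move=> hp hz.
have h2 : bd p.+1 (-2) (2 * z).
  have h2 := bd_natr w_ge u_ge1 (isT : (2 <= 16)%N).
  by apply: (bd_le w_ge u_ge1 (bdM w_ge u_ge1 h2 hz)).
have hs := small_half sc h2 isT (leq_trans hp (isT : (490 <= 499)%N)).
have hw : w^-1 <= 1 by rewrite invf_le1 ?(sc_w0 sc) // (sc_w1 sc).
have hz2 : `|- z| <= 1 / 2 by rewrite normrN; have := le_trans hs hw; rewrite normrM normr_nat; lra.
split; first by move: hz2; rewrite normrN ler_norml => /andP[h _]; lra.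
have := ln1_bound hz2; rewrite opprK sqrrN => h.
have h3 := bd_natr w_ge u_ge1 (isT : (2 <= 16)%N).
have hq : bd (p + p + 1) (-4) (2 * z ^+ 2).
  by eapply bd_le; [wu|wu|bdt| |by vm_compute]; rewrite addnC muln2 -addnn.
exact: (bd_norm_le w_ge u_ge1 h hq).
Qed.

(** The correction is a constant independent of [t], up to O~(u^-3). It cancels between the two ends
    of a chain of moves, so this error is incurred once per chain and not once per move. *)
Lemma gl_lr : bd 530 (-3) (gl t - lr lam (II t) - xi0 / (Lam * m%:R)).
Proof.
have h1 := bd_xit; have h2 := bd_Ahinv.
have hz : bd 254 (-2) (xi t / Ah t) by bdauto.
have [_ h3] := ln1_approx (isT : (254 < 490)%N) hz.
have h4 := bd_xi; have h5 := bd_xi0.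
rewrite /gl; set LL := ln _ in h3 *.
have -> : lr lam (II t) + LL - lr lam (II t) - xi0 / (Lam * m%:R) =
  (LL - xi t / Ah t) + (xi t - xi0) * (Ah t)^-1
    - xi0 * ((1 - lam) * a - lam * b - a * b * m%:R^-1) * Lam^-1 * m%:R^-1 * (Ah t)^-1.
  have hA : Ah t != 0 by rewrite lt0r_neq0 // Ah_gt0.
  have E : (1 - lam) * a - lam * b - a * b * m%:R^-1 = Ah t - Lam * m%:R by rewrite AhE; ring.
  by rewrite E; field; rewrite hA m0 l0 l1.
bdauto.
Qed.

(** Both logarithms contain the same [xi t], and [Ah t - Bh t] is [t k - t l], of order u. The error
    u^-1 of [xi t] thus enters as u^-1 * u / u^4, a factor [u] better than in either logarithm
    alone. *)
Lemma gl_incr : 0 < 1 + xi t / Ah t /\ 0 < 1 + xi t / Bh t /\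
  bd 530 (-4) (ln (1 + xi t / Bh t) - ln (1 + xi t / Ah t) - theta * ((t k)%:R - (t l)%:R) / (Lam * m%:R * n%:R)).
Proof.
have h1 := bd_xit; have h2 := bd_Ahinv; have h2' := bd_Bhinv.
have hz : bd 254 (-2) (xi t / Ah t) by bdauto.
have hz' : bd 254 (-2) (xi t / Bh t) by bdauto.
have [pA h3] := ln1_approx (isT : (254 < 490)%N) hz.
have [pB h3'] := ln1_approx (isT : (254 < 490)%N) hz'.
split => //; split => //.
have h4 := bd_xi; have h5 := bd_xi0; have h6 := bd_theta.
set LA := ln (1 + xi t / Ah t) in h3 *; set LB := ln _ in h3' *.
have hA : Ah t != 0 by rewrite lt0r_neq0 // Ah_gt0.
have hB : Bh t != 0 by rewrite lt0r_neq0 // Bh_gt0.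
pose dA := (1 - lam) * a - lam * b - a * b * m%:R^-1.
pose dB := (1 - lam) * b - lam * a - a * b * m%:R^-1.
have hdA : bd 8 1 dA by rewrite /dA; bdauto.
have hdB : bd 8 1 dB by rewrite /dB; bdauto.
have EA : Ah t = Lam * m%:R + dA by exact: AhE.
have EB : Bh t = Lam * m%:R + dB by exact: BhE.
have ED : Ah t - Bh t = a - b by rewrite EA EB /dA /dB; ring.
have ED2 : (t k)%:R - (t l)%:R = a - b by ring.
have E : LB - LA - theta * ((t k)%:R - (t l)%:R) / (Lam * m%:R * n%:R) =
   (LB - xi t / Bh t) - (LA - xi t / Ah t) + (xi t - xi0) * (a - b) * (Ah t)^-1 * (Bh t)^-1
   - xi0 * (a - b) * (Lam * m%:R * dA + Lam * m%:R * dB + dA * dB) * Lam^-1 ^+ 2 * m%:R^-1 ^+ 2 * (Ah t)^-1 * (Bh t)^-1.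
  have E1 : Lam * m%:R * dA + Lam * m%:R * dB + dA * dB = Ah t * Bh t - (Lam * m%:R) ^+ 2 by rewrite EA EB; ring.
  have E2 : theta = xi0 * n%:R * Lam^-1 * m%:R^-1 by rewrite xi0E; field; rewrite n0 m0 l0 l1.
  rewrite E1 E2 ED2 -ED; field; by rewrite hA hB n0 m0 l0 l1.
rewrite E; clearbody dA dB; bdauto.
Qed.

End OneBox.

Section Step.
Variables (t t' : 'I_n -> nat).
Hypotheses (bt : box t) (bt' : box t').
Hypotheses (tk : (t' k = (t k).+1)%N) (tl : (t l = (t' l).+1)%N).
Hypothesis tother : forall c, c != k -> c != l -> t' c = t c.

(** Occupying [(i, l)] and forbidding [(i, k)] leaves from [t] the same instance as the reverse
    leaves from [t']. *)
Lemma switch_count :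
  \sum_(G in graphs (II t)) \sum_i (G (i, l))%:R * (1 - (G (i, k))%:R) =
  \sum_(G in graphs (II t')) \sum_i (G (i, k))%:R * (1 - (G (i, l))%:R) :> R.
Proof.
have side (t1 : 'I_n -> nat) (b1 : box t1) c d : c != d ->
    \sum_(G in graphs (II t1)) \sum_i (G (i, c))%:R * (1 - (G (i, d))%:R) =
    \sum_i #|graphs (occ (emp (II t1) (i, d)) (i, c))|%:R :> R.
  move=> hcd; rewrite exchange_big; apply: eq_bigr => i _.
  have [p1 _] := cls_pos sc (i, c) b1; have [_ p2] := cls_pos sc (i, c) b1.
  rewrite card_occ //; last by rewrite !inE /= xpair_eqE eqxx /= (negbTE hcd).
  rewrite big_mkcond [RHS]big_mkcond; apply: eq_bigr => G _; rewrite graphs_emp.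
  by case: (G \in _) => //=; case: (G (i, d)) => /=; rewrite ?subrr ?mulr0 ?subr0 ?mulr1.
rewrite (side t bt l k) 1?eq_sym // (side t' bt' k l) //.
apply: eq_bigr => i _; congr (#|graphs _|%:R).
rewrite /occ /emp /=; congr (Inst _ _ _); last by rewrite setUCA.
apply/funext => c; have [->|ck] := eqVneq c k.
  by rewrite (negbTE neq) tk subn0 subn1.
have [->|cl] := eqVneq c l; first by rewrite tl subn1 subn0.
by rewrite !subn0 tother.
Qed.

Lemma mean_only (t1 : 'I_n -> nat) c d : nonempty (II t1) ->
  \sum_(G in graphs (II t1)) \sum_i (G (i, c))%:R * (1 - (G (i, d))%:R) =
  #|graphs (II t1)|%:R * ((t1 c)%:R - mean (II t1) (cod c d)) :> R.
Proof.
move=> ne; have N0 : #|graphs (II t1)|%:R != 0 :> R by rewrite pnatr_eq0 -lt0n.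
have -> : #|graphs (II t1)|%:R * ((t1 c)%:R - mean (II t1) (cod c d)) =
    \sum_(G in graphs (II t1)) (t1 c)%:R - \sum_(G in graphs (II t1)) cod c d G :> R.
  by rewrite sumr_const mulrBr mulr_natl /mean mulrCA mulfV // mulr1.
rewrite -sumrB; apply: eq_bigr => G hG; rewrite -(sum_col_cells c hG) /cod -sumrB.
by apply: eq_bigr => i _; ring.
Qed.

Lemma cod_sym (G : {ffun 'I_m * 'I_n -> bool}) : cod l k G = cod k l G :> R.
Proof. by apply: eq_bigr => i _; rewrite mulrC. Qed.

Hypothesis ne : nonempty (II t).

Let M := mterm (II t) : R.
Let M' := mterm (II t') : R.

Lemma Bh_E : (t l)%:R - mean (II t) (cod k l) = Bh t + xi t.
Proof. by rewrite /Bh /xi; field. Qed.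

Lemma move_nonempty : nonempty (II t').
Proof.
have [pA [pB _]] := gl_incr bt ne.
have h : 0 < \sum_(G in graphs (II t)) \sum_i (G (i, l))%:R * (1 - (G (i, k))%:R) :> R.
  rewrite mean_only // mulr_gt0 ?ltr0n //.
  rewrite (eq_mean (g := cod k l)); last by move=> G _; exact: cod_sym.
  rewrite Bh_E.
  have -> : Bh t + xi t = Bh t * (1 + xi t / Bh t) by field; rewrite lt0r_neq0 // Bh_gt0.
  by rewrite mulr_gt0 // Bh_gt0.
rewrite switch_count in h; rewrite /nonempty lt0n; apply/negP => /eqP hz.
by rewrite big1 ?ltxx // in h => G hG; move: (card0_eq hz G); rewrite hG.
Qed.

(** The binomials change by the factor [(m - t k) * t l / ((t k + 1) * (m - t l + 1))], which is
    exactly [Bh t / Ah t']. *)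
Lemma mterm_move : M * Bh t = M' * Ah t'.
Proof.
have h1 : (m - t k)%N%:R = m%:R - (t k)%:R :> R.
  rewrite natrB //; have := cs_le sc bt k; rewrite hcol0 // subn0; exact: ltnW.
have tl' : (t' l)%:R = (t l)%:R - 1 :> R by rewrite tl -natr1 addrK.
have tk' : (t' k)%:R = (t k)%:R + 1 :> R by rewrite tk natr1.
have h2 : (m - (t' l))%N%:R = m%:R - (t l)%:R + 1 :> R.
  rewrite natrB ?tl'; first by ring.
  have := cs_le sc bt' l; rewrite hcol0 // subn0; exact: ltnW.
have e1 : ((t k)%:R + 1) * ('C(m, t' k))%:R = (m%:R - (t k)%:R) * ('C(m, t k))%:R :> R.
  by rewrite -h1 -natrM -mul_bin_left -tk natrM tk'.
have e2 : (t l)%:R * ('C(m, t l))%:R = (m%:R - (t l)%:R + 1) * ('C(m, t' l))%:R :> R.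
  by rewrite -h2 -natrM tl -natrM -mul_bin_left.
have P (t1 : 'I_n -> nat) : \prod_c ('C(m - hcol (II t1) c, t1 c))%:R =
    ('C(m, t1 k))%:R * (('C(m, t1 l))%:R * \prod_(c | (c != k) && (c != l)) ('C(m, t1 c))%:R) :> R.
  rewrite (bigD1 k) //= (bigD1 l) 1?eq_sym //= !hcol0 // !subn0; congr (_ * (_ * _)).
  by apply: eq_bigr => c _; rewrite hcol0 // subn0.
rewrite /M /M' /mterm !P /Ah /Bh tk' tl'.
have -> : \prod_(c | (c != k) && (c != l)) ('C(m, t' c))%:R = \prod_(c | (c != k) && (c != l)) ('C(m, t c))%:R :> R.
  by apply: eq_bigr => c /andP[h h']; rewrite tother.
set PP := \prod_(c | (c != k) && (c != l)) _; set C0 := _^-1; set P1 := \prod_(j < m) _.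
have e3 : (m%:R - (t k)%:R) * ('C(m, t k))%:R * ((t l)%:R * ('C(m, t l))%:R) =
   ((t k)%:R + 1) * ('C(m, t' k))%:R * ((m%:R - (t l)%:R + 1) * ('C(m, t' l))%:R) :> R by rewrite e1 e2.
have -> : C0 * P1 * (('C(m, t k))%:R * (('C(m, t l))%:R * PP)) * ((t l)%:R * (m%:R - (t k)%:R) / m%:R) =
  C0 * P1 * PP / m%:R * ((m%:R - (t k)%:R) * ('C(m, t k))%:R * ((t l)%:R * ('C(m, t l))%:R)) by ring.
rewrite e3; ring.
Qed.

Lemma expo_move : expo lam (II t') - expo lam (II t) = theta * ((t k)%:R - (t l)%:R + 1) / (Lam * m%:R * n%:R).
Proof.
have tl' : (t' l)%:R = (t l)%:R - 1 :> R by rewrite tl -natr1 addrK.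
have tk' : (t' k)%:R = (t k)%:R + 1 :> R by rewrite tk natr1.
have Y0 t1 : Ydev lam (II t1) = 0.
  by rewrite /Ydev big1 // => j _; rewrite big1 // => c; rewrite /= in_set0.
have E : Cdev lam (II t') = Cdev lam (II t) + 2 * ((t k)%:R - (t l)%:R + 1).
  rewrite /Cdev (bigD1 k) //= (bigD1 l) 1?eq_sym //= [in RHS](bigD1 k) //= [in RHS](bigD1 l) 1?eq_sym //= tk' tl'.
  have -> : \sum_(c | (c != k) && (c != l)) ((t' c)%:R - lam * m%:R) ^+ 2 =
      \sum_(c | (c != k) && (c != l)) ((t c)%:R - lam * m%:R) ^+ 2.
    by apply: eq_bigr => c /andP[h h']; rewrite tother.
  ring.
have e1 : Rdev lam (II t) = Rdev lam (II (fun _ : 'I_n => 0%N)) by [].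
have e2 : Rdev lam (II t') = Rdev lam (II (fun _ : 'I_n => 0%N)) by [].
rewrite /expo !Y0 E /theta e1 e2.
by field; rewrite n0 m0 l0 l1.
Qed.

(** Double counting balances the counts against [Bh t + xi t] and [Ah t' + xi t']. Division by
    [mterm_move] leaves only the factors [1 + xi / Bh] and [1 + xi / Ah], whose quotient by
    [gl_incr] matches the change of the exponent, except for the [+ 1] in [expo_move], an
    O~(u^-4). *)
Lemma move_step : bd 535 (-4) (gl t' - gl t).
Proof.
have ne' := move_nonempty.
have [pA [pB hin]] := gl_incr bt ne.
have [pA' _] := gl_incr bt' ne'.
have N0 : 0 < #|graphs (II t)|%:R :> R by rewrite ltr0n.
have N0' : 0 < #|graphs (II t')|%:R :> R by rewrite ltr0n.
have M0 : 0 < M by exact: (mterm_gt0 sc bt tot0).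
have M0' : 0 < M' by exact: (mterm_gt0 sc bt' tot0).
have A0' := Ah_gt0 bt'; have B0 := Bh_gt0 bt.
have key : #|graphs (II t)|%:R * (Bh t + xi t) = #|graphs (II t')|%:R * (Ah t' + xi t') :> R.
  have := switch_count; rewrite !mean_only //.
  rewrite (eq_mean (g := cod k l)); last by move=> G _; exact: cod_sym.
  by rewrite Bh_E => ->; congr (_ * _); rewrite /Ah /xi; field.
have E : #|graphs (II t')|%:R / M' * (1 + xi t' / Ah t') = #|graphs (II t)|%:R / M * (1 + xi t / Bh t).
  have -> : 1 + xi t' / Ah t' = (Ah t' + xi t') / Ah t' by field; rewrite lt0r_neq0.
  have -> : 1 + xi t / Bh t = (Bh t + xi t) / Bh t by field; rewrite lt0r_neq0.
  apply: (mulIf (lt0r_neq0 (mulr_gt0 M0' A0'))).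
  rewrite -{2}mterm_move.
  have -> : #|graphs (II t')|%:R / M' * ((Ah t' + xi t') / Ah t') * (M' * Ah t') = #|graphs (II t')|%:R * (Ah t' + xi t').
    by field; rewrite !lt0r_neq0.
  rewrite -key; by field; rewrite !lt0r_neq0.
have q1 : 0 < #|graphs (II t')|%:R / M' by rewrite divr_gt0.
have q2 : 0 < #|graphs (II t)|%:R / M by rewrite divr_gt0.
have EL : ln (#|graphs (II t')|%:R / M') + ln (1 + xi t' / Ah t') = ln (#|graphs (II t)|%:R / M) + ln (1 + xi t / Bh t).
  by rewrite -(lnM q1 pA') -(lnM q2 pB) E.
have -> : gl t' - gl t = (ln (1 + xi t / Bh t) - ln (1 + xi t / Ah t) - theta * ((t k)%:R - (t l)%:R) / (Lam * m%:R * n%:R))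
   - theta * Lam^-1 * m%:R^-1 * n%:R^-1.
  have Ee := expo_move.
  have -> : gl t' - gl t = (ln (#|graphs (II t')|%:R / M') + ln (1 + xi t' / Ah t')) - ln (#|graphs (II t)|%:R / M)
     - ln (1 + xi t / Ah t) - (expo lam (II t') - expo lam (II t)) by rewrite /gl /lr -/M -/M'; ring.
  rewrite EL Ee; field; by rewrite n0 m0 l0 l1.
have hth : bd 9 0 theta := bd_theta bt.
move: hin; set Z := (_ - _ - _) => hin; bdauto.
Qed.
End Step.
End MoveUnit.

(** * Comparing degree sequences *)

Section Columns.
Context {R : realType} (w u lam : R) (m n : nat).
Hypothesis sc : scale w u lam m n.
Let w_ge := w_ge16 sc.
Let u_ge1 := u_ge1' sc.
Notation bd := (bd w u).
Notation Lam := (lam * (1 - lam)).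
Variable (s : 'I_m -> nat).
Hypothesis tot0 : (\sum_j s j)%N%:R = lam * m%:R * n%:R.
Notation II t := (Inst s t set0).
Notation box t := (cls w u lam 0 (II t)).
Implicit Types t : 'I_n -> nat.

Lemma box_between t t' t1 : box t -> box t' ->
  (forall c, (minn (t c) (t' c) <= t1 c <= maxn (t c) (t' c))%N) ->
  (\sum_c t1 c = \sum_c t c)%N -> box t1.
Proof.
move=> [h1 h2 h3 h4 h5 h6 h7 h8] [_ _ _ _ g5 _ _ _] hb hs; split => //=; first by rewrite hs.
move=> c; have := h5 c; have := g5 c; have /andP[b1 b2] := hb c; move: b1 b2 => /=.
rewrite !ler_norml addr0 -(ler_nat R) -(ler_nat R (t1 c)) /minn /maxn.
by case: ltnP => _ b1 b2 /andP[? ?] /andP[? ?]; apply/andP; split; lra.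
Qed.

Section Pair.
Variables (k l : 'I_n).
Hypothesis neq : k != l.

Lemma pair_gl d t t' : box t -> box t' -> (t' k = t k + d)%N -> (t l = t' l + d)%N ->
  (forall c, c != k -> c != l -> t' c = t c) -> nonempty (II t) ->
  nonempty (II t') /\ `|gl lam s k l t' - gl lam s k l t| <= d%:R * (w ^+ 535 * u ^ (-4)).
Proof.
elim: d t => [|d IH] t bt bt' hk hl ho ne.
  have -> : t' = t.
    apply/funext => c; have [->|ck] := eqVneq c k; first by rewrite hk addn0.
    by have [->|cl] := eqVneq c l; [rewrite hl addn0 | exact: ho].
  by split => //; rewrite subrr normr0 mul0r.
pose t1 c := if c == k then (t k).+1 else if c == l then (t l).-1 else t c.
have neq' : l != k by rewrite eq_sym.
have t1k : t1 k = (t k).+1 by rewrite /t1 eqxx.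
have t1l : t l = (t1 l).+1 by rewrite /t1 eqxx (negbTE neq') hl addnS.
have t1o c : c != k -> c != l -> t1 c = t c by rewrite /t1 => /negbTE -> /negbTE ->.
have bt1 : box t1.
  apply: (box_between bt bt').
    move=> c; have [->|ck] := eqVneq c k; first by rewrite t1k hk; lia.
    have [->|cl] := eqVneq c l; first by move: t1l; rewrite hl; lia.
    by rewrite t1o // ho // minnn maxnn leqnn.
  rewrite (bigD1 k) //= (bigD1 l) //= [in RHS](bigD1 k) //= [in RHS](bigD1 l) //= t1k t1l.
  rewrite (eq_bigr t); last by move=> c /andP[h1 h2]; exact: t1o.
  by rewrite !addnA !addSn addnS.
have ne1 := move_nonempty sc tot0 neq bt bt1 t1k t1l t1o ne.
have h1 := move_step sc tot0 neq bt bt1 t1k t1l t1o ne.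
have hk1 : (t' k = t1 k + d)%N by rewrite t1k hk addSn addnS.
have hl1 : (t1 l = t' l + d)%N by move: t1l; rewrite hl addnS => -[].
have ho1 c : c != k -> c != l -> t' c = t1 c by move=> ck cl; rewrite t1o // ho.
have [h2 h3] := IH t1 bt1 bt' hk1 hl1 ho1 ne1.
split => //.
have -> : gl lam s k l t' - gl lam s k l t = (gl lam s k l t1 - gl lam s k l t) + (gl lam s k l t' - gl lam s k l t1) by ring.
apply: le_trans (ler_normD _ _) _; apply: le_trans (lerD h1 h3) _.
by rewrite -[d.+1%:R]natr1 mulrDl mul1r addrC.
Qed.

(** The O~(u) moves within one pair of columns cost O~(u^-3) in [gl], the same order as passing from
    [lr] to [gl] and back. *)
Lemma pair_lr d t t' : box t -> box t' -> (t' k = t k + d)%N -> (t l = t' l + d)%N ->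
  (forall c, c != k -> c != l -> t' c = t c) -> nonempty (II t) ->
  nonempty (II t') /\ bd 545 (-3) (lr lam (II t') - lr lam (II t)).
Proof.
move=> bt bt' hk hl ho ne; have [h1 h2] := pair_gl bt bt' hk hl ho ne; split => //.
have hd : bd 3 1 (d%:R : R).
  have -> : (d%:R : R) = ((t' k)%:R - lam * m%:R) - ((t k)%:R - lam * m%:R) by rewrite hk natrD; ring.
  have b1 : bd 2 1 ((t' k)%:R - lam * m%:R) := bd_col sc bt' k.
  have b2 : bd 2 1 ((t k)%:R - lam * m%:R) := bd_col sc bt k.
  exact: (bd_le w_ge u_ge1 (bdB w_ge u_ge1 b1 b2)).
have hB : bd 535 (-4) (w ^+ 535 * u ^ (-4)) by rewrite /bd ger0_norm // mulr_ge0 ?(we_ge0 w_ge) ?(ue_ge0 u_ge1).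
have h3 : bd 538 (-3) (gl lam s k l t' - gl lam s k l t) := bd_norm_le w_ge u_ge1 h2 (bdM w_ge u_ge1 hd hB).
have g1 := gl_lr sc tot0 neq bt ne; have g2 := gl_lr sc tot0 neq bt' h1.
set c0 := _ / _ in g1 g2.
have -> : lr lam (II t') - lr lam (II t) = (gl lam s k l t' - gl lam s k l t) -
   (gl lam s k l t' - lr lam (II t') - c0) + (gl lam s k l t - lr lam (II t) - c0) by ring.
exact: (bd_le w_ge u_ge1 (bdD w_ge u_ge1 (bdB w_ge u_ge1 h3 g2) g1)).
Qed.
End Pair.

Lemma exists_gt t t' : (\sum_c t c = \sum_c t' c)%N -> t <> t' ->
  exists k, (t k < t' k)%N.
Proof.
move=> hs hn; apply/existsP; apply: contra_notT hn; rewrite negb_exists => /forallP h.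
apply/funext => c; have hle i : (t' i <= t i)%N by have := h i; rewrite -leqNgt.
apply/eqP; rewrite eqn_leq hle andbT leqNgt; apply/negP => hlt.
have : (\sum_c t' c < \sum_c t c)%N.
  rewrite (bigD1 c) //= [X in (_ < X)%N](bigD1 c) //= -addSn leq_add //; exact: leq_sum.
by rewrite hs ltnn.
Qed.

(** Each round pairs a column below its target with one above and moves the smaller of the two gaps,
    which settles at least one column for good. At most [n] rounds of O~(u^-3) give O~(u^-1). *)
Lemma cols_equiv t t' : box t -> box t' -> nonempty (II t) ->
  nonempty (II t') /\ bd 550 (-1) (lr lam (II t') - lr lam (II t)).
Proof.
move=> bt bt' ne.
pose D t1 := #|[pred c | t1 c != t' c]|.
suff : nonempty (II t') /\ `|lr lam (II t') - lr lam (II t)| <= (D t)%:R * (w ^+ 545 * u ^ (-3)).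
  move=> [h1 h2]; split => //.
  have hD : bd 0 2 ((D t)%:R : R).
    apply: (bd_norm_le w_ge u_ge1 (y := n%:R)); last by bdauto.
    by rewrite normr_nat ler_nat -[X in (_ <= X)%N]card_ord max_card.
  have hB : bd 545 (-3) (w ^+ 545 * u ^ (-3)) by rewrite /bd ger0_norm // mulr_ge0 ?(we_ge0 w_ge) ?(ue_ge0 u_ge1).
  exact: (bd_le w_ge u_ge1 (bd_norm_le w_ge u_ge1 h2 (bdM w_ge u_ge1 hD hB))).
move: {2}(D t) (leqnn (D t)) => N; elim: N t bt ne => [|N IH] t bt ne hN.
  have -> : t' = t.
    apply/funext => c; apply/eqP; rewrite eq_sym; apply: contraTT hN => h.
    by rewrite -ltnNge; apply/card_gt0P; exists c; rewrite inE.
  by split => //; rewrite subrr normr0 mulr_ge0 // mulr_ge0 ?(we_ge0 w_ge) ?(ue_ge0 u_ge1).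
have [<-|hn] := pselect (t = t').
  by split => //; rewrite subrr normr0 mulr_ge0 // mulr_ge0 ?(we_ge0 w_ge) ?(ue_ge0 u_ge1).
have hs : (\sum_c t c = \sum_c t' c)%N by have := tot_eq bt; have := tot_eq bt' => /= -> ->.
have [k hk] := exists_gt hs hn.
have [l hl] := exists_gt (esym hs) (fun h => hn (esym h)).
have neq : k != l by apply/eqP => E; rewrite E in hk; lia.
have neq' : l != k by rewrite eq_sym.
pose d := minn (t' k - t k) (t l - t' l).
pose t1 c := if c == k then (t k + d)%N else if c == l then (t l - d)%N else t c.
have t1k : t1 k = (t k + d)%N by rewrite /t1 eqxx.
have t1l : t1 l = (t l - d)%N by rewrite /t1 eqxx (negbTE neq').
have t1o c : c != k -> c != l -> t1 c = t c by rewrite /t1 => /negbTE -> /negbTE ->.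
have bt1 : box t1.
  apply: (box_between bt bt').
    move=> c; have [->|ck] := eqVneq c k; first by rewrite t1k /d; lia.
    have [->|cl] := eqVneq c l; first by rewrite t1l /d; lia.
    by rewrite t1o // geq_minl leq_maxl.
  rewrite (bigD1 k) //= (bigD1 l) //= [in RHS](bigD1 k) //= [in RHS](bigD1 l) //= t1k t1l.
  rewrite (eq_bigr t); last by move=> c /andP[h1 h2]; exact: t1o.
  have : (d <= t l)%N by rewrite /d; lia.
  by move=> h; lia.
have hdl : t l = (t1 l + d)%N by rewrite t1l /d; lia.
have [ne1 h1] := pair_lr neq bt bt1 t1k hdl t1o ne.
have hD : (D t1 < D t)%N.
  apply: proper_card; apply/properP; split.
    apply/subsetP => c; rewrite !inE; have [->|ck] := eqVneq c k; first by lia.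
    by have [->|cl] := eqVneq c l; [lia | rewrite t1o].
  have [h|h] := leqP (t' k - t k) (t l - t' l).
    exists k; rewrite inE; first by lia.
    by rewrite negbK t1k /d (minn_idPl h); apply/eqP; lia.
  exists l; rewrite inE; first by lia.
  by rewrite negbK t1l /d (minn_idPr (ltnW h)); apply/eqP; lia.
have [ne2 h2] := IH t1 bt1 ne1 (leq_trans hD hN).
split => //.
have -> : lr lam (II t') - lr lam (II t) = (lr lam (II t') - lr lam (II t1)) + (lr lam (II t1) - lr lam (II t)) by ring.
apply: le_trans (ler_normD _ _) _; apply: le_trans (lerD h2 h1) _.
have B0 : 0 <= w ^+ 545 * u ^ (-3) by rewrite mulr_ge0 ?(we_ge0 w_ge) ?(ue_ge0 u_ge1).
have hDr : (D t1)%:R + 1 <= (D t)%:R :> R by rewrite natr1 ler_nat.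
apply: le_trans (ler_wpM2r B0 hDr).
by rewrite mulrDl mul1r lerD2l; move: h1; rewrite /bd.
Qed.

End Columns.

(** * Exchanging the roles of rows and columns *)

Section Transpose.
Context {R : realType} {m n : nat}.
Variable lam : R.
Implicit Types (s : 'I_m -> nat) (t : 'I_n -> nat).

Definition trg (p q : nat) (G : {ffun 'I_p * 'I_q -> bool}) : {ffun 'I_q * 'I_p -> bool} :=
  [ffun e => G (e.2, e.1)].

Lemma trgK p q : cancel (@trg p q) (@trg q p).
Proof. by move=> G; apply/ffunP => -[a b]; rewrite !ffunE. Qed.

Lemma card_transpose s t : #|graphs (Inst s t set0)| = #|graphs (Inst t s set0)|.
Proof.
rewrite -(card_imset _ (can_inj (@trgK m n))); apply: eq_card => G.
apply/imsetP/graphsP => [[G' /graphsP[h1 h2 h3] ->]|[h1 h2 h3]].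
  split => [j|k|e] /=; last by rewrite in_set0.
  - by rewrite -[RHS]h2; apply: eq_bigr => i _; rewrite ffunE.
  - by rewrite -[RHS]h1; apply: eq_bigr => i _; rewrite ffunE.
exists (trg G); last by rewrite trgK.
apply/graphsP; split => [j|k|e] /=; last by rewrite in_set0.
- by rewrite -[RHS]h2; apply: eq_bigr => i _; rewrite ffunE.
- by rewrite -[RHS]h1; apply: eq_bigr => i _; rewrite ffunE.
Qed.

Lemma lr_transpose s t : (\sum_j s j = \sum_k t k)%N ->
  lr lam (Inst s t set0) = lr lam (Inst t s set0).
Proof.
move=> hs; rewrite /lr card_transpose.
have h0 a b (s1 : 'I_a -> nat) (t1 : 'I_b -> nat) j : hrow (Inst s1 t1 set0) j = 0%N by exact: hrow0.
have k0 a b (s1 : 'I_a -> nat) (t1 : 'I_b -> nat) k : hcol (Inst s1 t1 set0) k = 0%N by exact: hcol0.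
have -> : mterm (Inst s t set0) = mterm (Inst t s set0) :> R.
  rewrite /mterm /= !cards0 hs [(n * m)%N]mulnC -!mulrA; congr (_ * _); rewrite mulrC.
  by congr (_ * _); apply: eq_bigr => i _; rewrite h0 k0.
congr (_ - _); rewrite /expo.
have Y0 a b (s1 : 'I_a -> nat) (t1 : 'I_b -> nat) : Ydev lam (Inst s1 t1 set0) = 0.
  by rewrite /Ydev big1 // => j _; rewrite big1 // => c; rewrite /= in_set0.
have E : lam * (1 - lam) * m%:R * n%:R = lam * (1 - lam) * n%:R * m%:R by rewrite mulrAC.
by rewrite !Y0 E /Rdev /Cdev /=; ring.
Qed.
End Transpose.

Section Rows.
Context {R : realType} (w u lam : R) (m n : nat).
Hypothesis sc : scale w u lam m n.
Hypothesis wu : w ^+ 1200 <= u.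
Let w_ge := w_ge16 sc.
Let u_ge1 := u_ge1' sc.
Notation bd := (bd w u).
Let u' := Num.sqrt (m%:R : R).

Lemma u'_sqr : u' ^+ 2 = m%:R.
Proof. by rewrite sqr_sqrtr. Qed.

Lemma u'_gt0 : 0 < u'.
Proof. by rewrite sqrtr_gt0 (sc_m0 sc). Qed.

Lemma u_le : u <= w * u'.
Proof.
have w0 := sc_w0 sc; have u0 := sc_u0 sc.
rewrite -(@ler_pXn2r _ 2) ?nnegrE ?(ltW u0) ?mulr_ge0 ?(ltW w0) ?(ltW u'_gt0) //.
rewrite exprMn u'_sqr (u_sqr sc); apply: le_trans (n_le sc) _.
by rewrite ler_wpM2r // expr2 ler_peMr ?(ltW w0) // (sc_w1 sc).
Qed.

(** By [u <= w * u'], a box of radius [w * u] lies in one of radius [w ^+ 2 * u']. Replacing [w] by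
    its square is what calls for [wu], with an exponent above 2 * 500. *)
Lemma scale_transpose : scale (w ^+ 2) u' lam n m.
Proof.
have w0 := sc_w0 sc; have u0 := sc_u0 sc; have w1 := sc_w1 sc.
have ww : w <= w ^+ 2 by rewrite expr2 ler_peMr ?(ltW w0).
have hpow : (w ^+ 2) ^+ 500 <= u'.
  rewrite -(ler_pM2l w0) -exprM -exprS; apply: le_trans u_le; apply: le_trans wu.
  exact: (ler_weXn2l w1).
split.
- exact: le_trans w_ge ww.
- by apply: le_trans hpow; rewrite exprn_ege1 // exprn_ege1.
- exact: hpow.
- exact: u'_sqr.
- exact: lam_gt0 sc.
- exact: lam_lt1 sc.
- apply: le_trans (lam_var sc) _; rewrite ler_wpM2r ?(ltW (sc_Lam0 sc)) //.
- by apply: le_trans (n_le sc) _; rewrite ler_wpM2r.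
- by apply: le_trans (m_le sc) _; rewrite ler_wpM2r.
Qed.

Lemma cls_transpose (s : 'I_m -> nat) (t : 'I_n -> nat) : cls w u lam 0 (Inst s t set0) ->
  cls (w ^+ 2) u' lam 0 (Inst t s set0).
Proof.
have w0 := sc_w0 sc; have w1 := sc_w1 sc.
have hwu : w * u + 0%:R <= w ^+ 2 * u' + 0%:R.
  by rewrite !addr0 expr2 -mulrA ler_wpM2l ?(ltW w0) // u_le.
have p0 : 0 <= w ^+ 2 * u' + 0%:R by rewrite addr0 mulr_ge0 ?exprn_ge0 ?(ltW w0) ?(ltW u'_gt0).
move=> [h1 h2 h3 h4 h5 h6 h7 h8]; split => //=.
- by rewrite -h2 mulrAC.
- by move=> j; apply: le_trans (h5 j) hwu.
- by move=> j; apply: le_trans (h4 j) hwu.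
- by move=> j; rewrite hrow0.
- by move=> j; rewrite hcol0.
- by rewrite cards0 addr0 mulr_ge0 ?exprn_ge0 ?(ltW w0).
Qed.

Lemma rows_equiv (s s' : 'I_m -> nat) (t : 'I_n -> nat) :
  cls w u lam 0 (Inst s t set0) -> cls w u lam 0 (Inst s' t set0) ->
  (\sum_k t k)%N%:R = lam * m%:R * n%:R -> nonempty (Inst s t set0) ->
  nonempty (Inst s' t set0) /\ bd 1101 (-1) (lr lam (Inst s' t set0) - lr lam (Inst s t set0)).
Proof.
move=> b b' tot ne.
have tot' : (\sum_k t k)%N%:R = lam * n%:R * m%:R by rewrite tot mulrAC.
have ne' : nonempty (Inst t s set0) by rewrite /nonempty -card_transpose.
have [h1 h2] := cols_equiv scale_transpose tot' (cls_transpose b) (cls_transpose b') ne'.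
split; first by rewrite /nonempty card_transpose.
have e1 : (\sum_j s j = \sum_k t k)%N := tot_eq b.
have e2 : (\sum_j s' j = \sum_k t k)%N := tot_eq b'.
rewrite (lr_transpose _ e1) (lr_transpose _ e2).
apply: le_trans h2 _.
have w0 := sc_w0 sc; have u0 := sc_u0 sc.
rewrite -exprM !exprN1.
have -> : w ^+ 1101 = w ^+ (2 * 550) * w by rewrite -exprSr.
rewrite -[leRHS]mulrA; apply: ler_wpM2l; first by rewrite exprn_ge0 ?(ltW w0).
by rewrite ler_pdivlMr // ler_pdivrMl ?u'_gt0 // mulrC u_le.
Qed.
End Rows.

(** * Graphs with given row sums *)

Section RowModel.
Context {m n : nat}.
Notation graph := {ffun 'I_m * 'I_n -> bool}.
Implicit Types (G : graph) (s : 'I_m -> nat) (t : 'I_n -> nat).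

Definition rowset G j : {set 'I_n} := [set k | G (j, k)].
Definition rowg s : {set graph} := [set G : graph | [forall j, (\sum_k G (j, k) == s j)%N]].
Definition colsum G k : nat := (\sum_j G (j, k))%N.

Lemma card_rowset G j : #|rowset G j| = (\sum_k G (j, k))%N.
Proof. by rewrite -sum1_card big_mkcond; apply: eq_bigr => k _; rewrite inE; case: (G _). Qed.

(** A graph is a free choice of one set of columns per row, so product weights factorise. *)
Lemma sum_rowsets (R : comPzSemiRingType) (f : 'I_m -> {set 'I_n} -> R) :
  \sum_(G : graph) \prod_j f j (rowset G j) = \prod_j \sum_(S : {set 'I_n}) f j S.
Proof.
rewrite bigA_distr_bigA.
pose h (F : {ffun 'I_m -> {set 'I_n}}) : graph := [ffun e => e.2 \in F e.1].
have hK : cancel h (fun G => [ffun j => rowset G j]).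
  by move=> F; apply/ffunP => j; rewrite ffunE; apply/setP => k; rewrite inE ffunE.
have Kh : cancel (fun G => [ffun j => rowset G j]) h.
  by move=> G; apply/ffunP => -[j k]; rewrite !ffunE inE.
rewrite (reindex h) /=; last by exists (fun G => [ffun j => rowset G j]) => x _.
apply: eq_bigr => F _; apply: eq_bigr => j _; congr (f j _).
by apply/setP => k; rewrite inE ffunE.
Qed.

Lemma prod_bool (I : finType) (p : pred I) (R : comPzSemiRingType) :
  \prod_(i : I) (p i)%:R = ([forall i, p i])%:R :> R.
Proof.
case: forallP => [h|h]; first by rewrite big1 // => i _; rewrite h.
have /existsP[i hi] : [exists i, ~~ p i].
  by rewrite -negb_forall; apply/negP => /forallP.
by rewrite (bigD1 i) //= (negbTE hi) mul0r.
Qed.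

Lemma sum_sets (R : fieldType) (p : nat) (k : 'I_n) (z : R) : (p <= n)%N -> n%:R != 0 :> R ->
  \sum_(S : {set 'I_n}) (#|S| == p)%:R * z ^+ (k \in S) = ('C(n, p))%:R * (1 + p%:R / n%:R * (z - 1)).
Proof.
move=> hp n0.
have c1 : \sum_(S : {set 'I_n}) (#|S| == p)%:R = ('C(n, p))%:R :> R.
  rewrite -natr_sum; congr (_%:R).
  by rewrite -[n in RHS]card_ord -card_draws -sum1_card [RHS]big_mkcond; apply: eq_bigr => S _; rewrite inE; case: eqP.
have c2 : \sum_(S : {set 'I_n}) (#|S| == p)%:R * (k \notin S)%:R = ('C(n.-1, p))%:R :> R.
  transitivity (\sum_(S : {set 'I_n}) ((S \subset [set~ k]) && (#|S| == p))%:R : R).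
    apply: eq_bigr => S _; rewrite -natrM mulnb; congr ((_ : bool)%:R); rewrite andbC; congr (_ && _).
    by rewrite subsetC sub1set inE.
  rewrite -natr_sum; congr (_%:R).
  have hc : #|[set~ k]| = n.-1 by rewrite cardsC1 card_ord.
  by rewrite -[in RHS]hc -cards_draws -sum1_card [RHS]big_mkcond; apply: eq_bigr => S _; rewrite inE; case: ifP.
have c3 : n%:R * ('C(n.-1, p))%:R = (n%:R - p%:R) * ('C(n, p))%:R :> R.
  by rewrite -natrB // -!natrM mul_bin_down.
have -> : \sum_(S : {set 'I_n}) (#|S| == p)%:R * z ^+ (k \in S) =
  \sum_(S : {set 'I_n}) ((#|S| == p)%:R * z - (z - 1) * ((#|S| == p)%:R * (k \notin S)%:R)).
  by apply: eq_bigr => S _; case: (k \in S) => /=; ring.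
rewrite sumrB -mulr_suml -mulr_sumr c1 c2.
have -> : ('C(n.-1, p))%:R = (n%:R - p%:R) * ('C(n, p))%:R / n%:R :> R by rewrite -c3 mulrC mulKf.
by field.
Qed.

(** With the row sums fixed, the rows are independent uniform sets, so a column sum is a sum of
    independent Bernoulli variables with parameters [s j / n]. *)
Lemma mgf_row (R : fieldType) s (k : 'I_n) (z : R) : (forall j, (s j <= n)%N) -> n%:R != 0 :> R ->
  \sum_(G in rowg s) z ^+ colsum G k =
  \prod_j (('C(n, s j))%:R * (1 + (s j)%:R / n%:R * (z - 1))).
Proof.
move=> hs n0; under [RHS]eq_bigr => j _ do rewrite -(sum_sets k) //.
rewrite -sum_rowsets big_mkcond; apply: eq_bigr => G _.
rewrite big_split prod_bool /=.
have -> : [forall j, #|rowset G j| == s j] = (G \in rowg s).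
  by rewrite inE; apply: eq_forallb => j; rewrite card_rowset.
case: ifP => _; last by rewrite mul0r.
rewrite mul1r -expr_sum; congr (_ ^+ _).
by apply: eq_bigr => j _; rewrite inE.
Qed.

Lemma card_rowg s : (forall j, (s j <= n)%N) -> #|rowg s| = (\prod_j 'C(n, s j))%N.
Proof.
move=> hs; have := @sum_rowsets nat (fun j S => (#|S| == s j : nat)).
have -> : \sum_(G : graph) \prod_j (#|rowset G j| == s j : nat) = #|rowg s|.
  rewrite -sum1_card [RHS]big_mkcond; apply: eq_bigr => G _.
  have := @prod_bool _ (fun j => #|rowset G j| == s j) nat.
  have -> : [forall j, #|rowset G j| == s j] = (G \in rowg s).
    by rewrite inE; apply: eq_forallb => j; rewrite card_rowset.
  under eq_bigr do rewrite natn.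
  by move=> ->; rewrite natn; case: (_ \in _).
move=> ->; apply: eq_bigr => j _.
rewrite -[n in RHS]card_ord -card_draws -sum1_card [RHS]big_mkcond.
by apply: eq_bigr => S _; rewrite inE; case: eqP.
Qed.

(** The model prescribing the total alone; its size is the binomial whose inverse stands in [mterm]
    for H empty. *)
Definition totg (M : nat) : {set graph} := [set G : graph | (\sum_j \sum_k G (j, k) == M)%N].

Lemma card_totg M : #|totg M| = 'C(m * n, M).
Proof.
have -> : (m * n)%N = #|{: 'I_m * 'I_n}| by rewrite card_prod !card_ord.
rewrite -card_draws.
pose h (G : graph) : {set 'I_m * 'I_n} := [set e | G e].
have hi : injective h.
  by move=> G G' /setP E; apply/ffunP => e; have := E e; rewrite !inE.
rewrite -(card_imset _ hi); apply: eq_card => S; rewrite inE.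
have key G : #|h G| = (\sum_j \sum_k G (j, k))%N.
  rewrite pair_bigA -sum1_card big_mkcond; apply: eq_bigr => -[j k] _ /=.
  by rewrite inE; case: (G _).
apply/imsetP/idP => [[G hG ->]|hS]; first by move: hG; rewrite inE key.
exists [ffun e => e \in S]; last by apply/setP => e; rewrite inE ffunE.
rewrite inE -key; rewrite (_ : h _ = S) //; by apply/setP => e; rewrite inE ffunE.
Qed.

End RowModel.

(** * Chernoff bounds *)

Lemma expR_quad (R : realType) (h : R) : `|h| <= 1 / 2 -> expR h <= 1 + h + 2 * h ^+ 2.
Proof.
rewrite ler_norml => /andP[h1 h2].
have p0 : 0 < 1 - h by lra.
have h3 : 1 - h <= expR (- h) := expR_ge1Dx (- h).
rewrite -[h in expR h]opprK expRN.
apply: (@le_trans _ _ (1 - h)^-1); first by rewrite lef_pV2 ?posrE ?expR_gt0.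
rewrite -div1r ler_pdivrMr // -subr_ge0.
have -> : (1 + h + 2 * h ^+ 2) * (1 - h) - 1 = h ^+ 2 * (1 - 2 * h) by ring.
by rewrite mulr_ge0 ?sqr_ge0 //; lra.
Qed.

Section Tail.
Context {R : realType} (w u lam : R) (m n : nat).
Hypothesis sc : scale w u lam m n.
Let w_ge := w_ge16 sc.
Let u_ge1 := u_ge1' sc.
Notation bd := (bd w u).
Notation graph := {ffun 'I_m * 'I_n -> bool}.
Implicit Types (G : graph) (s : 'I_m -> nat).

Definition colgood : {set graph} :=
  [set G | [forall k, `|(colsum G k)%:R - lam * m%:R| <= w * u]].

Section OneRow.
Variable s : 'I_m -> nat.
Hypotheses (hs : forall j, (s j <= n)%N) (tot0 : (\sum_j s j)%N%:R = lam * m%:R * n%:R).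

Lemma mgf_row_le (k : 'I_n) (h : R) :
  \sum_(G in rowg s) expR (h * (colsum G k)%:R) <= #|@rowg m n s|%:R * expR (lam * m%:R * (expR h - 1)).
Proof.
have n0 : n%:R != 0 :> R by rewrite lt0r_neq0 ?(sc_n0 sc).
under eq_bigr => G _ do rewrite mulrC expRM_natl.
rewrite (mgf_row _ _ hs n0) card_rowg // big_split /= natr_prod ler_wpM2l ?prodr_ge0 //.
have -> : lam * m%:R * (expR h - 1) = \sum_j ((s j)%:R / n%:R * (expR h - 1)).
  by rewrite -mulr_suml -mulr_suml -natr_sum tot0; field.
rewrite expR_sum; apply: ler_prod => j _; rewrite expR_ge1Dx andbT.
have p0 : 0 <= (s j)%:R / n%:R :> R by rewrite divr_ge0.
have p1 : (s j)%:R / n%:R <= 1 :> R by rewrite ler_pdivrMr ?(sc_n0 sc) // mul1r ler_nat.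
have e0 : 0 <= expR h := expR_ge0 h.
have -> : 1 + (s j)%:R / n%:R * (expR h - 1) = (1 - (s j)%:R / n%:R) + (s j)%:R / n%:R * expR h by ring.
by rewrite addr_ge0 ?subr_ge0 // mulr_ge0.
Qed.

Lemma tail_one (k : 'I_n) (sg : R) : `|sg| = 1 ->
  #|[set G in @rowg m n s | w * u < sg * ((colsum G k)%:R - lam * m%:R)]|%:R <=
  #|@rowg m n s|%:R * expR (- (w / 8)).
Proof.
move=> hsg; have w0 := sc_w0 sc; have u0 := sc_u0 sc; have m0 := sc_m0 sc.
have sg2 : sg ^+ 2 = 1 by rewrite -real_normK ?num_real // hsg expr1n.
(* Minimises [2 * m * th ^+ 2 - th * (w * u)]; the minimum [- (w * u) ^+ 2 / (8 * m)] is at most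
   [- w / 8] by [m <= w * n]. *)
pose th := w * u / (4 * m%:R).
have th0 : 0 < th by rewrite /th divr_gt0 ?mulr_gt0.
have th1 : th <= 1 / 2.
  rewrite /th ler_pdivrMr ?mulr_gt0 //.
  have h1 : w ^+ 2 <= u := w_pow_le sc (isT : (2 <= 500)%N).
  have h2 : w * u <= m%:R.
    rewrite -(ler_pM2l w0); apply: le_trans (n_le sc); rewrite -(u_sqr sc) mulrA -expr2 expr2.
    by rewrite expr2 ler_wpM2r ?(ltW u0) // -expr2.
  by move: h2; lra.
have wn : w / 8 <= w ^+ 2 * u ^+ 2 / (8 * m%:R).
  rewrite ler_pdivlMr ?mulr_gt0 // (u_sqr sc).
  have -> : w / 8 * (8 * m%:R) = w * m%:R by field.
  by rewrite expr2 -mulrA ler_wpM2l ?(ltW w0) // (m_le sc).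
set A := [set _ in _ | _].
have h1 : #|A|%:R <= \sum_(G in rowg s) expR (th * (sg * ((colsum G k)%:R - lam * m%:R) - w * u)).
  rewrite -sum1_card natr_sum big_mkcond [leRHS]big_mkcond /=; apply: ler_sum => G _.
  rewrite inE; case: (G \in _) => //=; case: ifP => h; last exact: expR_ge0.
  rewrite -[1%:R]expR0 ler_expR mulr_ge0 ?(ltW th0) //.
  by move: h; lra.
apply: le_trans h1 _.
have E G : expR (th * (sg * ((colsum G k)%:R - lam * m%:R) - w * u)) =
  expR (- (th * sg * lam * m%:R + th * (w * u))) * expR ((th * sg) * (colsum G k)%:R).
  by rewrite -expRD; congr expR; ring.
under eq_bigr => G _ do rewrite E.
rewrite -mulr_sumr; apply: le_trans (ler_wpM2l (expR_ge0 _) (mgf_row_le k (th * sg))) _.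
rewrite mulrCA ler_wpM2l // -expRD ler_expR.
have hq : expR (th * sg) <= 1 + th * sg + 2 * (th * sg) ^+ 2.
  by apply: expR_quad; rewrite normrM hsg mulr1 ger0_norm ?(ltW th0).
have hq2 : expR (th * sg) - 1 <= th * sg + 2 * th ^+ 2.
  by move: hq; rewrite exprMn sg2; lra.
have lm0 : 0 <= lam * m%:R by rewrite mulr_ge0 ?(ltW (lam_gt0 sc)).
have h2 := ler_wpM2l lm0 hq2.
have h3 : lam * m%:R * (2 * th ^+ 2) <= m%:R * (2 * th ^+ 2).
  by rewrite -mulrA ler_piMl ?(ltW (lam_lt1 sc)) // mulr_ge0 // mulr_ge0 ?sqr_ge0.
have h4 : m%:R * (2 * th ^+ 2) - th * (w * u) = - (w ^+ 2 * u ^+ 2 / (8 * m%:R)).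
  by rewrite /th; field; rewrite lt0r_neq0.
have -> : th * sg * lam * m%:R + th * (w * u) = lam * m%:R * (th * sg) + th * (w * u) by ring.
move: h2; rewrite [leRHS]mulrDr => h2.
move: h2 h3 h4 wn.
set e1 := lam * m%:R * (_ - 1); set e2 := lam * m%:R * (th * sg); set e3 := lam * m%:R * (2 * _).
set e4 := m%:R * (2 * _); set e5 := _ / _; set e6 := th * (w * u); clear => h2 h3 h4 wn; lra.
Qed.

Lemma tail_row : #|@rowg m n s :\: colgood|%:R <= 2 * n%:R * expR (- (w / 8)) * #|@rowg m n s|%:R.
Proof.
pose A (k : 'I_n) (sg : R) := [set G in @rowg m n s | w * u < sg * ((colsum G k)%:R - lam * m%:R)].
have hsub : @rowg m n s :\: colgood \subset \bigcup_k (A k 1 :|: A k (-1)).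
  apply/subsetP => G; rewrite 3!inE negb_forall => /andP[/existsP[k hk] hG].
  apply/bigcupP; exists k => //; move: hk; rewrite -ltNge ltr_normr /A !inE mul1r mulN1r.
  by rewrite hG.
have h1 : (#|@rowg m n s :\: colgood| <= \sum_k (#|A k 1%R| + #|A k (-1)%R|))%N.
  apply: leq_trans (subset_leq_card hsub) _.
  apply: (big_ind2 (fun (X : {set graph}) N => (#|X| <= N)%N)); first by rewrite cards0.
    by move=> X1 N1 X2 N2 h1 h2; apply: leq_trans (leq_card_setU X1 X2) (leq_add h1 h2).
  by move=> k _; exact: leq_card_setU.
apply: (@le_trans _ _ ((\sum_k (#|A k 1%R| + #|A k (-1)%R|))%N)%:R); first by rewrite ler_nat.
rewrite natr_sum.
apply: (@le_trans _ _ (\sum_(k < n) 2 * (#|@rowg m n s|%:R * expR (- (w / 8))))).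
  apply: ler_sum => k _; rewrite natrD mulr2n mulrDl !mul1r lerD //; apply: tail_one.
    by rewrite normr1.
  by rewrite normrN1.
by rewrite sumr_const card_ord -mulr_natl le_eqVlt; apply/orP; left; apply/eqP; ring.
Qed.
End OneRow.

(* Every row vector with the right total obeys the same tail bound, so the
   bound passes to the mixture [totg M] of the row models. *)
Lemma tail_tot (M : nat) : M%:R = lam * m%:R * n%:R ->
  #|@totg m n M :\: colgood|%:R <= 2 * n%:R * expR (- (w / 8)) * #|@totg m n M|%:R.
Proof.
move=> hM.
pose rv (G : graph) : {ffun 'I_m -> 'I_n.+1} := [ffun j => inord (\sum_k G (j, k))%N].
have rvE (G : graph) (f : {ffun 'I_m -> 'I_n.+1}) : (rv G == f) = (G \in rowg (fun j => f j : nat)).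
  have hle j : (\sum_k G (j, k) <= n)%N by rewrite -card_rowset -[n in X in (_ <= X)%N]card_ord max_card.
  rewrite inE; apply/eqP/forallP => [<- j|h]; first by rewrite ffunE inordK ?ltnS.
  by apply/ffunP => j; apply: val_inj; rewrite /= ffunE inordK ?ltnS //; apply/eqP; exact: h.
have part (X : {set graph}) : #|@totg m n M :&: X| =
    (\sum_(f : {ffun 'I_m -> 'I_n.+1} | (\sum_j f j == M)%N) #|@rowg m n (fun j => f j : nat) :&: X|)%N.
  rewrite -sum1_card (partition_big rv (fun f => (\sum_j f j == M)%N)).
    apply: eq_bigr => f /eqP hf; rewrite -sum1_card; apply: eq_bigl => G.
    rewrite !inE rvE andbAC; congr (_ && _); rewrite inE; apply: andb_idl => /forallP h.
    by rewrite -hf; apply/eqP; apply: eq_bigr => j _; apply/eqP.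
  move=> G; rewrite !inE => /andP[/eqP hG _]; rewrite -[X in _ == X]hG.
  have : G \in rowg (fun j => rv G j : nat) by rewrite -rvE.
  by rewrite inE => /forallP h; apply/eqP; apply: eq_bigr => j _; apply/eqP; rewrite eq_sym.
have p1 := part (~: colgood); have p2 := part setT; rewrite setIT in p2.
rewrite setDE p1 p2 !natr_sum mulr_sumr; apply: ler_sum => f /eqP hf.
rewrite -setDE setIT; apply: tail_row; first by move=> j; rewrite -ltnS.
by rewrite hf.
Qed.
End Tail.

(** * Normalisation *)

Lemma sum_ltn (m p : nat) : (p <= m)%N -> (\sum_(j < m) (j < p)%N = p)%N.
Proof. by move=> h; rewrite -big_mkcond /= (big_ord_narrow h) sum1_card card_ord. Qed.

Section BaseRow.
Context {R : realType} (w u lam : R) (m n : nat).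
Hypothesis sc : scale w u lam m n.
Let w_ge := w_ge16 sc.
Let u_ge1 := u_ge1' sc.
Notation bd := (bd w u).
Notation Lam := (lam * (1 - lam)).

(* Half of the rows deviate by about [+ sqrt (Lam * n)] and half by about
   [- sqrt (Lam * n)], so that [1 - R / (Lam m n)] is nearly zero and the
   formula is insensitive to the column degrees. *)
Lemma base_row (M : nat) : M%:R = lam * m%:R * n%:R ->
  exists s : 'I_m -> nat, [/\ (\sum_j s j = M)%N, forall j, `|(s j)%:R - lam * n%:R| <= w * u &
    bd 8 (-1) (1 - \sum_j ((s j)%:R - lam * n%:R) ^+ 2 / (Lam * m%:R * n%:R))].
Proof.
move=> hM.
have w0 := sc_w0 sc; have u0 := sc_u0 sc; have m0 := sc_m0 sc; have n0 := sc_n0 sc.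
have l0 := lam_gt0 sc; have l1 := lam_lt1 sc; have L0 := sc_Lam0 sc.
have L1 : Lam <= 1 by nra.
have mn : (0 < m)%N by rewrite -(ltr_nat R).
pose q := (M %/ m)%N; pose rho := (M %% m)%N.
have hq : (M = q * m + rho)%N := divn_eq M m.
have hrho : (rho < m)%N by rewrite ltn_mod.
have ln_q : lam * n%:R = q%:R + rho%:R / m%:R.
  have : M%:R / m%:R = lam * n%:R by rewrite hM; field; rewrite lt0r_neq0.
  by move=> <-; rewrite {1}hq natrD natrM; field; rewrite lt0r_neq0.
have rho0 : 0 <= rho%:R / m%:R :> R by rewrite divr_ge0.
have rho1 : rho%:R / m%:R <= 1 :> R by rewrite ler_pdivrMr // mul1r ler_nat ltnW.
pose x := Num.sqrt (Lam * n%:R); pose h := Num.truncn x.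
have x0 : 0 <= x by rewrite sqrtr_ge0.
have x2 : x ^+ 2 = Lam * n%:R by rewrite sqr_sqrtr // mulr_ge0 ?(ltW L0).
have xu : x <= u.
  by rewrite -(@ler_pXn2r _ 2) ?nnegrE ?(ltW u0) // x2 (u_sqr sc) ler_piMl.
have /andP[hx1 hx2] : h%:R <= x < h.+1%:R := truncn_itv x0.
have hh : (h <= q)%N.
  rewrite -(ler_nat R); apply: le_trans hx1 _; apply: le_trans xu _.
  have h2 : w ^+ 2 <= u := w_pow_le sc (isT : (2 <= 500)%N).
  have h3 : 2 * u <= lam * n%:R.
    rewrite -(ler_pM2l w0); apply: (@le_trans _ _ (u ^+ 2)).
      by rewrite [leRHS]expr2 mulrA ler_wpM2r ?(ltW u0) //; apply: le_trans h2; rewrite expr2 ler_wpM2l ?(ltW w0) //; apply: le_trans w_ge; rewrite ler_nat.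
    rewrite (u_sqr sc) mulrA ler_peMl //; apply: le_trans (lam_var sc) _.
    rewrite ler_wpM2l ?(ltW w0) //; by rewrite ler_piMr ?(ltW l0) // lerBlDr lerDl ltW.
  by move: h3 rho1 u_ge1; rewrite ln_q; move: (_ / _) => y; lra.
pose p := m./2.
have hp : (2 * p <= m)%N by rewrite mul2n -[X in (_ <= X)%N](odd_double_half m) leq_addl.
have hp1 : (m <= 2 * p + 1)%N by rewrite mul2n -[X in (X <= _)%N](odd_double_half m) addnC leq_add2l; case: odd.
(* The first [rho] rows take up the remainder of [M] modulo [m]; the first [p] rows gain [h] and the
   next [p] lose [h]. This is written as one subtraction, exact by [hh]. *)
pose s (j : 'I_m) := (q + (j < rho) + 2 * h * (j < p) - h * (j < 2 * p))%N.
pose dl (j : 'I_m) : R := (j < rho)%:R - rho%:R / m%:R.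
pose sg (j : 'I_m) : R := 2 * (j < p)%:R - (j < 2 * p)%:R.
have sE j : (s j)%:R = lam * n%:R + dl j + sg j * h%:R :> R.
  have hle : (h * (j < 2 * p) <= q + (j < rho) + 2 * h * (j < p))%N.
    apply: leq_trans (_ : q <= _)%N; last by rewrite -addnA leq_addr.
    by apply: leq_trans hh; rewrite -[X in (_ <= X)%N]muln1 leq_mul2l leq_b1 orbT.
  by rewrite /s natrB // !natrD !natrM ln_q /dl /sg; ring.
have sg2 j : sg j ^+ 2 = (j < 2 * p)%:R.
  rewrite /sg; case: (ltnP j p) => h1.
    have -> : (j < 2 * p)%N by apply: leq_trans h1 _; rewrite mul2n -addnn leq_addr.
    by rewrite /=; ring.
  by case: ltnP => _ /=; ring.
have sumnat a : (a <= m)%N -> \sum_(j < m) (j < a)%:R = a%:R :> R.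
  by move=> ha; rewrite -natr_sum sum_ltn.
have pm : (p <= m)%N by apply: leq_trans hp; rewrite mul2n -addnn leq_addr.
have ssg : \sum_j sg j = 0.
  by rewrite /sg big_split /= sumrN -mulr_sumr !sumnat // natrM subrr.
have ssg2 : \sum_j sg j ^+ 2 = (2 * p)%:R.
  by under eq_bigr => j _ do rewrite sg2; rewrite sumnat.
have sdl : \sum_j dl j = 0.
  rewrite /dl big_split /= sumrN sumr_const card_ord sumnat ?(ltnW hrho) //.
  by rewrite -[X in _ - X]mulr_natr mulfVK ?subrr // lt0r_neq0.
have dl1 j : `|dl j| <= 1.
  by rewrite ler_norml /dl; move: rho0 rho1; move: (_ / _) => y; case: ltnP => _ /= h1 h2; apply/andP; split; lra.
have sg1 j : `|sg j| <= 1.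
  by rewrite -(@ler_pXn2r _ 2) ?nnegrE // real_normK ?num_real // sg2 expr1n; case: ltnP.
have hu : h%:R <= u := le_trans hx1 xu.
exists s; split.
- apply/eqP; rewrite -(eqr_nat R) natr_sum; apply/eqP.
  under eq_bigr => j _ do rewrite sE.
  rewrite big_split big_split /= -[X in _ + X]mulr_suml ssg sdl mul0r !addr0 sumr_const card_ord hM.
  by rewrite -[LHS]mulr_natr mulrAC.
- move=> j; rewrite sE.
  have -> : lam * n%:R + dl j + sg j * h%:R - lam * n%:R = dl j + sg j * h%:R by ring.
  apply: le_trans (ler_normD _ _) _; rewrite normrM normr_nat.
  have h1 := ler_pM (normr_ge0 _) (ler0n _ _) (sg1 j) hu.
  have h2 : 2 * u <= w * u by rewrite ler_wpM2r ?(ltW u0) //; apply: le_trans w_ge; rewrite ler_nat.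
  move: (dl1 j) h1 h2 u_ge1; move: `|dl j| (`|sg j| * _) => y z; lra.
- rewrite -mulr_suml.
  have E : \sum_j ((s j)%:R - lam * n%:R) ^+ 2 =
     \sum_j (dl j ^+ 2 + 2 * (dl j * sg j) * h%:R) + (2 * p)%:R * h%:R ^+ 2.
    rewrite -ssg2 mulr_suml -big_split /=; apply: eq_bigr => j _; rewrite sE.
    have -> : lam * n%:R + dl j + sg j * h%:R - lam * n%:R = dl j + sg j * h%:R by ring.
    by ring.
  set S := \sum_j _ in E *.
  set T1 := \sum_j _ in E.
  have m0' : m%:R != 0 :> R by rewrite lt0r_neq0.
  have n0' : n%:R != 0 :> R by rewrite lt0r_neq0.
  have l0' : lam != 0 by rewrite lt0r_neq0.
  have l1' : 1 - lam != 0 by rewrite lt0r_neq0 // subr_gt0.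
  (* Three errors: a row left over when [m] is odd, the rounding of [x] to [h], and the terms with
     the remainder. Each is at most O~(u^3), against u^4 in the denominator. *)
  have -> : 1 - S / (Lam * m%:R * n%:R) =
    ((m%:R - (2 * p)%:R) * h%:R ^+ 2 + m%:R * (x ^+ 2 - h%:R ^+ 2) - T1) * (Lam^-1 * m%:R^-1 * n%:R^-1).
    by rewrite E x2; field; rewrite m0' n0' l0' l1'.
  have bh : bd 0 1 (h%:R : R) by rewrite /bd mul1r expr1z normr_nat.
  have bx : bd 0 1 x by rewrite /bd mul1r expr1z ger0_norm.
  have bdiff : bd 2 1 (x ^+ 2 - h%:R ^+ 2).
    have -> : x ^+ 2 - h%:R ^+ 2 = (x - h%:R) * (x + h%:R) by ring.
    have b1 : bd 0 0 (x - h%:R).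
      by apply: (bd_le1 w_ge u_ge1); rewrite ger0_norm ?subr_ge0 //; move: hx2; rewrite -natr1; lra.
    by have := bdM w_ge u_ge1 b1 (bdD w_ge u_ge1 bx bh); move/(bd_le w_ge u_ge1); apply.
  have b2p : bd 0 0 (m%:R - (2 * p)%:R : R).
    apply: (bd_le1 w_ge u_ge1); rewrite -natrB // normr_nat -[1]/(1%:R) ler_nat leq_subLR; exact: hp1.
  have bT : bd 3 3 T1.
    have bdl j : bd 0 0 (dl j) := bd_le1 w_ge u_ge1 (dl1 j).
    have bsg j : bd 0 0 (sg j) := bd_le1 w_ge u_ge1 (sg1 j).
    have bj j : bd 2 1 (dl j ^+ 2 + 2 * (dl j * sg j) * h%:R).
      have b2 := bd_natr w_ge u_ge1 (isT : (2 <= 16)%N).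
      have := bdD w_ge u_ge1 (bdX w_ge u_ge1 2 (bdl j)) (bdM w_ge u_ge1 (bdM w_ge u_ge1 b2 (bdM w_ge u_ge1 (bdl j) (bsg j))) bh).
      by move/(bd_le w_ge u_ge1); apply.
    exact: (bd_sum_m sc bj).
  have bm : bd 1 2 (m%:R : R) := bd_m sc.
  have bmi : bd 1 (-2) (m%:R^-1 : R) := bd_minv sc.
  have bni : bd 0 (-2) (n%:R^-1 : R) := bd_ninv sc.
  have bL : bd 1 0 Lam^-1 := bd_Laminv sc.
  have bh2 : bd 0 2 (h%:R ^+ 2 : R) := bdX w_ge u_ge1 2 bh.
  have b3 := bdB w_ge u_ge1 (bdD w_ge u_ge1 (bdM w_ge u_ge1 b2p bh2) (bdM w_ge u_ge1 bm bdiff)) bT.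
  have := bdM w_ge u_ge1 b3 (bdM w_ge u_ge1 (bdM w_ge u_ge1 bL bmi) bni).
  by move/(bd_le w_ge u_ge1); apply.
Qed.
End BaseRow.

Section ColumnClasses.
Context {m n : nat}.
Notation graph := {ffun 'I_m * 'I_n -> bool}.
Implicit Types (G : graph) (s : 'I_m -> nat) (t : 'I_n -> nat).

Definition colg t : {set graph} := [set G : graph | [forall k, colsum G k == t k]].

Lemma card_colg t : (forall k, (t k <= m)%N) -> #|colg t| = (\prod_k 'C(m, t k))%N.
Proof.
move=> ht; rewrite -card_rowg // -(card_imset _ (can_inj (@trgK n m))).
apply: eq_card => G; apply/idP/imsetP => [hG|[G' hG' ->]].
  exists (trg G); last by rewrite trgK.
  rewrite inE in hG; rewrite inE; apply/forallP => k; rewrite -(eqP (forallP hG k)).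
  by apply/eqP; apply: eq_bigr => j _; rewrite ffunE.
rewrite inE in hG'; rewrite inE; apply/forallP => k; rewrite -(eqP (forallP hG' k)).
by apply/eqP; apply: eq_bigr => j _; rewrite ffunE.
Qed.

Lemma graphs_rowcol s t : graphs (Inst s t set0) = rowg s :&: colg t.
Proof.
apply/setP => G; rewrite !inE; congr (_ && _); rewrite andb_idr // => _.
by apply/forallP => e; rewrite inE.
Qed.

Lemma colsum_tot G : (\sum_k colsum G k = \sum_j \sum_k G (j, k))%N.
Proof. by rewrite exchange_big. Qed.

Lemma colsum_le G k : (colsum G k <= m)%N.
Proof. by rewrite -[m in X in (_ <= X)%N]card_ord -sum1_card leq_sum // => j _; exact: leq_b1. Qed.

End ColumnClasses.

Section Normalise.
Context {R : realType} (w u lam : R) (m n : nat).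
Hypothesis sc : scale w u lam m n.
Hypothesis wu : w ^+ 1200 <= u.
Hypothesis tail : u ^+ 4 * expR (- (w / 8)) <= 1.
Let w_ge := w_ge16 sc.
Let u_ge1 := u_ge1' sc.
Notation bd := (bd w u).
Notation Lam := (lam * (1 - lam)).
Notation graph := {ffun 'I_m * 'I_n -> bool}.
Notation colgood := (@colgood R w u lam m n).

Definition goodt (t : 'I_n -> nat) := [forall k, `|(t k)%:R - lam * m%:R| <= w * u].

Lemma card_goodcols (X : {set graph}) : #|X :&: colgood| =
  (\sum_(f : {ffun 'I_n -> 'I_m.+1} | goodt (fun k => f k)) #|X :&: colg (fun k => f k : nat)|)%N.
Proof.
pose cv (G : graph) : {ffun 'I_n -> 'I_m.+1} := [ffun k => inord (colsum G k)].
have cvE (G : graph) k : cv G k = colsum G k :> nat by rewrite ffunE inordK ?ltnS ?colsum_le.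
rewrite -sum1_card (partition_big cv (fun f => goodt (fun k => f k))).
  apply: eq_bigr => f hf; rewrite -sum1_card; apply: eq_bigl => G.
  rewrite [RHS]inE [X in X && _]inE -andbA; congr (_ && _); apply/andP/idP.
    move=> [_ /eqP <-]; rewrite inE; apply/forallP => k; exact/eqP/esym/cvE.
  rewrite inE => /forallP h; have E : cv G = f.
    by apply/ffunP => k; apply: val_inj; rewrite [LHS]cvE; exact/eqP.
  split; last exact/eqP.
  by rewrite inE; apply/forallP => k; rewrite (eqP (h k)); exact: (forallP hf).
move=> G; rewrite !inE => /andP[_ /forallP h]; apply/forallP => k; rewrite cvE; exact: h.
Qed.

Lemma n_row_le (a : nat) : `|a%:R - lam * n%:R| <= w * u -> (a <= n)%N.
Proof.
move=> h; rewrite -(ler_nat R).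
have w0 := sc_w0 sc; have u0 := sc_u0 sc.
have h2 : w ^+ 2 <= u := w_pow_le sc (isT : (2 <= 500)%N).
have h3 : w * u <= (1 - lam) * n%:R.
  rewrite -(ler_pM2l w0) mulrA -expr2 mulrA.
  apply: (@le_trans _ _ (u ^+ 2)); first by rewrite [leRHS]expr2 ler_wpM2r ?(ltW u0).
  rewrite (u_sqr sc) ler_peMl //; apply: le_trans (lam_var sc) _; rewrite ler_wpM2l ?(ltW w0) //.
  by rewrite ler_piMl ?subr_ge0 ?(ltW (lam_lt1 sc)).
move: h; rewrite ler_norml => /andP[_ h]; move: h h3; rewrite mulrBl mul1r; lra.
Qed.

Lemma box_cls (s : 'I_m -> nat) (t : 'I_n -> nat) : (\sum_j s j = \sum_k t k)%N ->
  (\sum_j s j)%N%:R = lam * m%:R * n%:R ->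
  (forall j, `|(s j)%:R - lam * n%:R| <= w * u) -> goodt t -> cls w u lam 0 (Inst s t set0).
Proof.
move=> h1 h2 h3 /forallP h4.
have p0 : 0 <= w * u by rewrite mulr_ge0 ?(ltW (sc_w0 sc)) ?(ltW (sc_u0 sc)).
split => //=.
- by rewrite h2 subrr normr0.
- by move=> j; rewrite addr0.
- by move=> j; rewrite addr0.
- by move=> j; rewrite hrow0 // addr0.
- by move=> j; rewrite hcol0 // addr0.
- by rewrite cards0 addr0 mulr_ge0 ?(ltW (sc_w0 sc)).
Qed.

Lemma tau_le : 2 * n%:R * expR (- (w / 8)) <= u^-1.
Proof.
have u0 := sc_u0 sc; rewrite -[leRHS]div1r ler_pdivlMr //; apply: le_trans tail.
rewrite mulrAC ler_wpM2r ?expR_ge0 // -(u_sqr sc).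
have h : 2 <= u by apply: le_trans (w_pow_le sc (isT : (1 <= 500)%N)); apply: le_trans w_ge; rewrite ler_nat.
have -> : u ^+ 4 = u * u ^+ 2 * u by ring.
by rewrite ler_wpM2r ?(ltW u0) // ler_wpM2r // exprn_ge0 ?(ltW u0).
Qed.

Section Base.
Variable s : 'I_m -> nat.
Hypotheses (tot0 : (\sum_j s j)%N%:R = lam * m%:R * n%:R)
  (rowdev : forall j, `|(s j)%:R - lam * n%:R| <= w * u)
  (flat : bd 8 (-1) (1 - \sum_j ((s j)%:R - lam * n%:R) ^+ 2 / (Lam * m%:R * n%:R))).
Notation box t := (cls w u lam 0 (Inst s t set0)).

Lemma expo_flat (t : 'I_n -> nat) : box t -> bd 30 (-1) (expo lam (Inst s t set0)).
Proof.
move=> bt; rewrite /expo.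
have Y0 : Ydev lam (Inst s t set0) = 0.
  by rewrite /Ydev big1 // => j _; rewrite big1 // => c; rewrite /= in_set0.
have bC : bd 4 4 (Cdev lam (Inst s t set0)).
  have bc k : bd 4 2 (((t k)%:R - lam * m%:R) ^+ 2) := bdX w_ge u_ge1 2 (bd_col sc bt k).
  have bn : bd 0 2 (#|'I_n|%:R : R) by rewrite card_ord; exact: bd_n sc.
  exact: (bd_sum w_ge u_ge1 bn (fun k _ => bc k)).
have bm : bd 1 (-2) (m%:R^-1 : R) := bd_minv sc.
have bn : bd 0 (-2) (n%:R^-1 : R) := bd_ninv sc.
have bL : bd 1 0 Lam^-1 := bd_Laminv sc.
have bi := bdM w_ge u_ge1 bC (bdM w_ge u_ge1 (bdM w_ge u_ge1 bL bm) bn).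
have bh : bd 0 0 (- 2^-1) := bdN w_ge u_ge1 (bd_natinv w_ge u_ge1 2).
have := bdM w_ge u_ge1 (bdM w_ge u_ge1 bh flat) (bdB w_ge u_ge1 (bd1 w_ge u_ge1) bi).
rewrite Y0 mul0r -!invfM /Rdev /= -mulr_suml => h.
rewrite [Z in bd _ _ Z]subr0; exact: (bd_le w_ge u_ge1 h).
Qed.

(** For H empty the formula says that, within the graphs of the given total, prescribing the rows
    and prescribing the columns are independent events up to the exponential factor. *)
Lemma graphs_lr (t : 'I_n -> nat) : box t -> nonempty (Inst s t set0) ->
  #|graphs (Inst s t set0)|%:R * ('C(m * n, \sum_j s j))%:R =
  #|@rowg m n s|%:R * #|@colg m n t|%:R *
    expR (lr lam (Inst s t set0) + expo lam (Inst s t set0)) :> R.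
Proof.
move=> bt ne; have M0 := mterm_gt0 sc bt tot0.
have hr j : (s j <= n)%N := n_row_le (rowdev j).
have ht k : (t k <= m)%N.
  have := cs_le sc bt k; rewrite hcol0 // subn0; exact: ltnW.
have C0 : (0 < 'C(m * n, \sum_j s j))%N.
  have := tot_le sc bt tot0; rewrite /= cards0 subn0 => h.
  by rewrite bin_gt0 ltnW.
rewrite /lr subrK lnK ?posrE ?divr_gt0 ?ltr0n //.
rewrite card_rowg // card_colg // /mterm /= cards0 subn0 !natr_prod.
under [X in _ / (_ * X * _)]eq_bigr => j _ do rewrite hrow0 // subn0.
under [X in _ / (_ * X)]eq_bigr => k _ do rewrite hcol0 // subn0.
have P0 : \prod_j ('C(n, s j))%:R != 0 :> R.
  by apply/prodf_neq0 => j _; rewrite pnatr_eq0 -lt0n bin_gt0.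
have Q0 : \prod_k ('C(m, t k))%:R != 0 :> R.
  by apply/prodf_neq0 => k _; rewrite pnatr_eq0 -lt0n bin_gt0.
have c0 : ('C(m * n, \sum_j s j))%:R != 0 :> R by rewrite pnatr_eq0 -lt0n.
by field; rewrite P0 Q0 c0.
Qed.


Lemma big_good (X : {set graph}) :
  #|X :\: colgood|%:R <= 2 * n%:R * expR (- (w / 8)) * #|X|%:R :> R ->
  (1 - u^-1) * #|X|%:R <= #|X :&: colgood|%:R :> R.
Proof.
move=> h; have h1 : (#|X :\: colgood|%:R : R) <= u^-1 * #|X|%:R.
  by apply: le_trans h _; rewrite ler_wpM2r // tau_le.
have h2 : #|X|%:R = #|X :&: colgood|%:R + #|X :\: colgood|%:R :> R by rewrite -natrD cardsID.
by rewrite mulrBl mul1r lerBlDr h2 lerD2l -h2.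
Qed.

(** All good column vectors share one log-ratio [kp] up to [E]. Summing [graphs_lr] over them
    compares [A * C] with [P * B * expR kp]; the tail bounds put [A / P] and [B / C] between
    [1 - u^-1] and 1, so [kp] is O~(u^-1). *)
Lemma normal_base (t : 'I_n -> nat) : box t ->
  nonempty (Inst s t set0) /\ bd 560 (-1) (lr lam (Inst s t set0)).
Proof.
pose M := (\sum_j s j)%N.
have w0 := sc_w0 sc; have u0 := sc_u0 sc.
have ui : u^-1 <= 1 / 2.
  have h : 2 <= u by apply: le_trans (w_pow_le sc (isT : (1 <= 500)%N)); apply: le_trans w_ge; rewrite ler_nat.
  by rewrite -[leLHS]div1r ler_pdivrMr //; lra.
have ui0 : 0 <= u^-1 by rewrite invr_ge0 ltW.
pose P : R := #|@rowg m n s|%:R; pose C : R := ('C(m * n, M))%:R.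
have hr j : (s j <= n)%N := n_row_le (rowdev j).
have P0 : 0 < P by rewrite ltr0n card_rowg // prodn_gt0 // => j; rewrite bin_gt0.
have hA := big_good (tail_row sc hr tot0).
have hB := big_good (tail_tot sc tot0).
rewrite card_totg in hB.
set A := #|_ :&: _|%:R in hA; set B := #|_ :&: _|%:R in hB.
have A0 : 0 < A by apply: lt_le_trans hA; rewrite mulr_gt0 //; lra.
(* The tail bound supplies the first graph: most graphs with row sums [s] have good column sums. Its
   column vector is the reference for all others. *)
have [G0] : exists G, G \in @rowg m n s :&: colgood.
  by apply/set0Pn; rewrite -card_gt0 -(ltr_nat R).
rewrite inE => /andP[hG1 hG2].
have tots G : G \in @rowg m n s -> (\sum_k colsum G k = M)%N.
  rewrite inE => /forallP h; rewrite colsum_tot; apply: eq_bigr => j _; exact/eqP.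
pose t0 : 'I_n -> nat := colsum G0.
have bt0 : box t0.
  by apply: box_cls; rewrite ?tots //; move: hG2; rewrite inE.
have ne0 : nonempty (Inst s t0 set0).
  rewrite /nonempty graphs_rowcol; apply/card_gt0P; exists G0; rewrite inE hG1 inE.
  by apply/forallP.
have eqv (t1 : 'I_n -> nat) (b1 : box t1) := cols_equiv sc tot0 bt0 b1 ne0.
set kp := lr lam (Inst s t0 set0) in eqv.
pose E := w ^+ 551 * u ^ (-1).
have dev (t1 : 'I_n -> nat) : box t1 ->
    `|lr lam (Inst s t1 set0) + expo lam (Inst s t1 set0) - kp| <= E.
  move=> b1; have [_ h1] := eqv _ b1; have h2 := expo_flat b1.
  have := bdD w_ge u_ge1 h1 h2; rewrite addrAC => h3.
  exact: (bd_le w_ge u_ge1 h3).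
have E0 : 0 <= E by rewrite mulr_ge0 ?(we_ge0 w_ge) ?(ue_ge0 u_ge1).
pose a (f : {ffun 'I_n -> 'I_m.+1}) : R := #|@rowg m n s :&: colg (fun k => f k : nat)|%:R.
pose b (f : {ffun 'I_n -> 'I_m.+1}) : R := #|@totg m n M :&: colg (fun k => f k : nat)|%:R.
have hAs : A = \sum_(f : {ffun 'I_n -> 'I_m.+1} | goodt (fun k => f k)) a f.
  by rewrite /A card_goodcols natr_sum.
have hBs : B = \sum_(f : {ffun 'I_n -> 'I_m.+1} | goodt (fun k => f k)) b f.
  by rewrite /B card_goodcols natr_sum.
have term (f : {ffun 'I_n -> 'I_m.+1}) : goodt (fun k => f k) ->
    P * b f * expR (kp - E) <= a f * C /\ a f * C <= P * b f * expR (kp + E).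
  (* Column vectors with a wrong total contribute 0 on both sides. *)
  move=> hf; have [hs|hs] := eqVneq (\sum_k f k)%N M; last first.
    have -> : a f = 0.
      apply/eqP; rewrite pnatr_eq0 cards_eq0 -subset0; apply/subsetP => G.
      rewrite inE => /andP[/tots h1]; rewrite inE => /forallP h2; case/eqP: hs.
      by rewrite -h1; apply: eq_bigr => k _; rewrite (eqP (h2 k)).
    have -> : b f = 0.
      apply/eqP; rewrite pnatr_eq0 cards_eq0 -subset0; apply/subsetP => G.
      rewrite inE => /andP[]; rewrite inE -colsum_tot => /eqP h1; rewrite inE => /forallP h2; case/eqP: hs.
      by rewrite -h1; apply: eq_bigr => k _; rewrite (eqP (h2 k)).
    by rewrite mulr0 !mul0r.
  have bf : box (fun k => f k : nat) by apply: box_cls.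
  have [nf _] := eqv _ bf.
  have := graphs_lr bf nf; rewrite -/M graphs_rowcol -/(a f) -/P -/C => ->.
  have -> : b f = #|@colg m n (fun k => f k : nat)|%:R.
    congr (_%:R); apply: eq_card => G; rewrite inE andb_idl // inE => /forallP h.
    by rewrite inE -colsum_tot -hs; apply/eqP; apply: eq_bigr => k _; exact/eqP.
  have := dev _ bf; rewrite ler_norml => /andP[d1 d2].
  have p0 : 0 <= P * #|@colg m n (fun k => f k : nat)|%:R by rewrite mulr_ge0 // ltW.
  by split; rewrite ler_wpM2l // ler_expR; lra.
have C1 : (1 - u^-1) * C <= B := hB.
have C2 : B <= C by rewrite /B /C -card_totg ler_nat subset_leq_card // subsetIl.
have A1 : (1 - u^-1) * P <= A := hA.
have A2 : A <= P by rewrite /A /P ler_nat subset_leq_card // subsetIl.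
have up : A * C <= P * B * expR (kp + E).
  rewrite hAs hBs mulr_suml mulr_sumr mulr_suml; apply: ler_sum => f hf; exact: (term f hf).2.
have dn : P * B * expR (kp - E) <= A * C.
  rewrite hAs hBs mulr_suml mulr_sumr mulr_suml; apply: ler_sum => f hf; exact: (term f hf).1.
have C0 : 0 < C.
  have := tot_le sc bt0; rewrite /= cards0 subn0 => h.
  by rewrite ltr0n bin_gt0 ltnW // h.
have r0 : 0 < 1 - u^-1 by lra.
have k1 : 1 - u^-1 <= expR (kp + E).
  rewrite -(ler_pM2l (mulr_gt0 P0 C0)).
  apply: (@le_trans _ _ (A * C)); first by rewrite mulrAC [P * _]mulrC ler_wpM2r ?(ltW C0).
  apply: le_trans up _; rewrite ler_wpM2r ?expR_ge0 // ler_wpM2l ?(ltW P0) //.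
have k2 : (1 - u^-1) * expR (kp - E) <= 1.
  rewrite -(ler_pM2l (mulr_gt0 P0 C0)) mulr1.
  apply: (@le_trans _ _ (P * B * expR (kp - E))).
    by rewrite mulrA ler_wpM2r ?expR_ge0 // -mulrA ler_wpM2l ?(ltW P0) // mulrC.
  by apply: le_trans dn _; rewrite ler_wpM2r ?(ltW C0).
have lnt : - (2 * u^-1) <= ln (1 - u^-1).
  have := ln_ge_sub1 r0; apply: le_trans.
  rewrite -[leRHS]opprB lerN2 lerBlDr -[leLHS]div1r ler_pdivrMr //.
  have -> : (2 * u^-1 + 1) * (1 - u^-1) = 1 + u^-1 * (1 - 2 * u^-1) by ring.
  by rewrite lerDl mulr_ge0 //; lra.
have kk : `|kp| <= E + 2 * u^-1.
  have h1 : ln (1 - u^-1) <= kp + E by rewrite -(expRK (kp + E)) ler_ln ?posrE ?expR_gt0.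
  have h2 : ln (1 - u^-1) + (kp - E) <= 0.
    by rewrite -(expRK (kp - E)) -lnM ?posrE ?expR_gt0 // ln_le0.
  by rewrite ler_norml; apply/andP; split; lra.
move=> bt; have [nt ht] := eqv _ bt; split => //.
have bE : bd 551 (-1) E by rewrite /bd ger0_norm.
have b2 : bd 1 (-1) (2 * u^-1).
  have bu : bd 0 (-1) u^-1 by rewrite /bd ger0_norm // mul1r exprN1.
  exact: (bdM w_ge u_ge1 (bd_natr w_ge u_ge1 (isT : (2 <= 16)%N)) bu).
have bk := bd_norm_le w_ge u_ge1 kk (bdD w_ge u_ge1 bE b2).
have := bdD w_ge u_ge1 ht bk; rewrite subrK => h.
exact: (bd_le w_ge u_ge1 h).
Qed.
End Base.

Lemma normalise (s : 'I_m -> nat) (t : 'I_n -> nat) : cls w u lam 0 (Inst s t set0) ->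
  (\sum_j s j)%N%:R = lam * m%:R * n%:R ->
  nonempty (Inst s t set0) /\ bd 1110 (-1) (lr lam (Inst s t set0)).
Proof.
move=> b tot; have [s0 [h1 h2 h3]] := base_row sc tot.
have tot0 : (\sum_j s0 j)%N%:R = lam * m%:R * n%:R by rewrite h1.
have teq : (\sum_j s j = \sum_k t k)%N := tot_eq b.
have b0 : cls w u lam 0 (Inst s0 t set0).
  apply: box_cls => //; first by rewrite h1.
  by apply/forallP => k; have := col_dev b k; rewrite addr0.
have [n0 l0] := normal_base tot0 h2 h3 b0.
have tt : (\sum_k t k)%N%:R = lam * m%:R * n%:R by rewrite -teq.
have [n1 l1] := rows_equiv sc wu b0 b tt n0; split => //.
have := bdD w_ge u_ge1 l1 l0; rewrite subrK => h.
exact: (bd_le w_ge u_ge1 h).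
Qed.

Lemma formula (I : inst m n) : cls w u lam 0 I ->
  (\sum_j rs I j)%N%:R = lam * m%:R * n%:R ->
  nonempty I /\ bd 1112 (-1) (lr lam I).
Proof.
case: I => s t H cl tot0.
have p0 : 0 <= w * u by rewrite mulr_ge0 ?(ltW (sc_w0 sc)) ?(ltW (sc_u0 sc)).
have b : cls w u lam 0 (Inst s t set0).
  apply: box_cls => //; first exact: tot_eq cl.
    by move=> j; have := row_dev cl j; rewrite addr0.
  by apply/forallP => k; have := col_dev cl k; rewrite addr0.
have [n0 l0] := normalise b tot0.
have [n1 l1] := forbid_chain sc tot0 cl n0; split => //.
have := bdD w_ge u_ge1 l1 l0; rewrite subrK => h.
exact: (bd_le w_ge u_ge1 h).
Qed.
End Normalise.

(** * Reduction of the theorem *)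

Section Bridge.
Variable D : bdata.
Notation m := (bm D).
Notation n := (bn D).

Definition inst_of : inst m n := Inst (bs D) (bt D) [set e | bH D e.1 e.2].
Notation I := inst_of.

Lemma hrow_of j : hrow I j = hx j.
Proof.
rewrite /hrow /hx -sum1_card [RHS]big_mkcond; apply: eq_bigr => k _.
by rewrite !inE; case: ifP.
Qed.

Lemma hcol_of k : hcol I k = hy k.
Proof.
rewrite /hcol /hy -sum1_card [RHS]big_mkcond; apply: eq_bigr => j _.
by rewrite !inE; case: ifP.
Qed.

Lemma forb_of : #|forb I| = hX D.
Proof.
rewrite /hX; under eq_bigr => j _ do rewrite -hrow_of /hrow.
rewrite pair_bigA /= -sum1_card big_mkcond; apply: eq_bigr => -[j k] _ /=.
by case: ifP.
Qed.

Lemma card_of : card_BstH D = #|graphs I|.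
Proof.
apply: eq_card => G; rewrite !inE /in_BstH -andbA; congr [&& _, _ & _].
- by apply: eq_forallb => j; rewrite -card_rowset.
- apply: eq_forallb => k; congr (_ == _); rewrite -sum1_card big_mkcond; apply: eq_bigr => j _.
  by rewrite inE; case: (G _).
- apply/forallP/forallP => [h [j k]|h j]; last apply/forallP => k.
    by rewrite inE /= implybN; have /forallP := h j; apply.
  by have := h (j, k); rewrite inE /= implybN.
Qed.

Variable R : realType.

Lemma main_of : mterm I = main_term R D :> R.
Proof.
rewrite /mterm /main_term forb_of; congr (_ * _ * _).
  by apply: eq_bigr => j _; rewrite hrow_of.
by apply: eq_bigr => k _; rewrite hcol_of.
Qed.

Hypotheses (m0 : (0 < m)%N) (n0 : (0 < n)%N) (tot : stot D = ttot D).
Let m0' : m%:R != 0 :> R. Proof. by rewrite pnatr_eq0 -lt0n. Qed.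
Let n0' : n%:R != 0 :> R. Proof. by rewrite pnatr_eq0 -lt0n. Qed.

Lemma lam_n : lam R D * n%:R = savg R D.
Proof. by rewrite /lam mulfVK. Qed.

Lemma lam_m : lam R D * m%:R = tavg R D.
Proof. by rewrite /lam /savg /tavg tot; field; rewrite m0' n0'. Qed.

Lemma lam_mn : lam R D * m%:R * n%:R = (stot D)%:R.
Proof. by rewrite lam_m /tavg tot mulfVK. Qed.

Lemma expo_of : expo (lam R D) I = exponent_term R D.
Proof.
have hA : 2 * AA R D = lam R D * (1 - lam R D).
  by rewrite /AA; field.
rewrite /expo /exponent_term hA /Rdev /Cdev /= lam_n lam_m; congr (_ - _ / _).
rewrite /Ydev /YY; apply: eq_bigr => j _.
apply: eq_big => [k|k _]; first by rewrite inE.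
by rewrite /idlt /ieta /= hrow_of hcol_of lam_n lam_m.
Qed.
End Bridge.

Lemma powR_large (R : realType) (c dl : R) : 0 < dl ->
  exists N : nat, forall n, (N <= n)%N -> c <= n%:R `^ dl.
Proof.
move=> d0; pose c1 := Num.max c 1.
have c10 : 0 <= c1 by rewrite le_max ler01 orbT.
exists (Num.truncn (c1 `^ dl^-1)).+1 => n hn.
apply: (@le_trans _ _ c1); first by rewrite le_max lexx.
have h : c1 `^ dl^-1 <= n%:R.
  have /andP[_ h] := truncn_itv (powR_ge0 c1 dl^-1).
  by apply: le_trans (ltW h) _; rewrite ler_nat.
have := ge0_ler_powR (ltW d0) _ _ h.
rewrite -powRrM mulVf ?gt_eqF // powRr1 //; apply; rewrite nnegrE ?powR_ge0 //.
Qed.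

(** * Choice of [u] and [w] for a fixed large [n], and verification of the regime *)

Section Large.
Context {R : realType} (a b eps : R).
Hypotheses (a0 : 0 < a) (b0 : 0 < b) (e0 : 0 < eps) (e1 : 7200 * eps <= 2^-1 - b).
Variable D : bdata.
Notation m := (bm D).
Notation n := (bn D).
Notation lm := (lam R D).
Notation nn := (n%:R : R).
Variable K : R.
Hypotheses (m1 : (0 < m)%N) (n1 : (0 < n)%N) (tot : stot D = ttot D).
Hypotheses
  (big : 16 + `|K| + 4 * (1 + a / eps) + 16 / eps <= nn `^ eps)
  (Hs : forall j, `|(bs D j)%:R - savg R D| <= K * nn `^ (2^-1 + eps))
  (Hx : forall j, ((@hx D j)%:R : R) <= K * nn `^ (2^-1 + eps))
  (Ht : forall k, `|(bt D k)%:R - tavg R D| <= K * nn `^ (2^-1 + eps))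
  (Hy : forall k, ((@hy D k)%:R : R) <= K * nn `^ (2^-1 + eps))
  (HX : ((hX D)%:R : R) <= K * nn `^ (1 + 2 * eps))
  (nm : nn <= m%:R `^ (1 + eps)) (mn : m%:R <= nn `^ (1 + eps))
  (A0 : 0 < AA R D)
  (hlam : (1 - 2 * lm) ^+ 2 / (8 * AA R D) *
     (1 + 5 * m%:R / (6 * nn) + 5 * nn / (6 * m%:R)) <= a * ln nn).

Let z := nn `^ eps.
Let u := nn `^ 2^-1.
(** The cube comes from the bound on [X]: its factor n^(2 eps) and the constant [K] take three
    powers of [z]. *)
Let w := z ^+ 3.

Let npos : 0 < nn. Proof. by rewrite ltr0n. Qed.
Let nge1 : 1 <= nn. Proof. by rewrite ler1n. Qed.
Let mpos : 0 < (m%:R : R). Proof. by rewrite ltr0n. Qed.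

Let zbounds : [/\ 16 <= z, K <= z, 4 * (1 + a / eps) <= z & 16 / eps <= z].
Proof.
have h1 : 0 <= a / eps by rewrite divr_ge0 ?(ltW a0) ?(ltW e0).
have h2 : 0 <= 16 / eps by rewrite divr_ge0 ?(ltW e0).
move: big (ler_norm K) (normr_ge0 K) h1 h2; rewrite -/z.
move: (a / eps) (16 / eps) `|K| z => x y k z'.
by move=> *; split; lra.
Qed.

Let z16 : 16 <= z. Proof. by case: zbounds. Qed.
Let z0 : 0 < z. Proof. exact: lt_le_trans z16. Qed.
Let z1 : 1 <= z. Proof. by apply: le_trans z16; rewrite ler1n. Qed.
Let u1 : 1 <= u. Proof. by rewrite -[leLHS](powRr0 nn) ler_powR ?invr_ge0. Qed.
Let u0 : 0 < u. Proof. exact: lt_le_trans u1. Qed.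

Let u2 : u ^+ 2 = nn.
Proof. by rewrite -powR_mulrn ?powR_ge0 // -powRrM mulVf ?pnatr_eq0 // powRr1. Qed.

Let zX p : z ^+ p = nn `^ (eps * p%:R).
Proof. by rewrite -powR_mulrn ?powR_ge0 // -powRrM. Qed.

Let nD (x y : R) : nn `^ (x + y) = nn `^ x * nn `^ y.
Proof. by rewrite powRD // (gt_eqF npos) implybT. Qed.

Let lnz : ln nn <= z / eps.
Proof.
rewrite ler_pdivlMr // mulrC -ln_powR; apply: ltW; exact: ln_sublinear.
Qed.

Let w_gez : z ^+ 2 <= w. Proof. by apply: ler_weXn2l. Qed.
Let w1 : 1 <= w. Proof. exact: exprn_ege1. Qed.
Let w0 : 0 < w. Proof. exact: lt_le_trans w1. Qed.

Let w1200 : w ^+ 1200 <= u.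
Proof.
rewrite -exprM zX; apply: ler_powR => //.
by move: e1 b0; have -> : ((3 * 1200)%N)%:R = 3600 :> R by []; lra.
Qed.

Let lamA : lm * (1 - lm) = 2 * AA R D.
Proof. by rewrite /AA; field. Qed.

Let lam0 : 0 < lm.
Proof.
have h : 0 <= lm by rewrite !divr_ge0.
rewrite lt_def h andbT; apply/eqP => E; move: A0; rewrite /AA E mulr0 mul0r ltxx //.
Qed.

Let lam1 : lm < 1.
Proof.
have : 0 < lm * (1 - lm) by rewrite lamA mulr_gt0.
by rewrite pmulr_rgt0 // subr_gt0.
Qed.

(** With [L] for [lam * (1 - lam)], the first factor of the hypothesis is [(1 - 4 * L) / (4 * L)],
    so [1 / L] is O(log n), and [ln n <= z / eps]. *)
Let var : 1 <= w * (lm * (1 - lm)).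
Proof.
set L := lm * (1 - lm); have L0 : 0 < L by rewrite mulr_gt0 // subr_gt0.
have h1 : (1 - 4 * L) / (4 * L) <= a * ln nn.
  apply: le_trans hlam.
  have -> : (1 - 2 * lm) ^+ 2 = 1 - 4 * L by rewrite /L; ring.
  have -> : 8 * AA R D = 4 * L by rewrite /L lamA; ring.
  have s0 : 0 <= (1 - 4 * L) / (4 * L).
    apply: divr_ge0; last by apply: mulr_ge0 => //; exact: ltW.
    have -> : 1 - 4 * L = (1 - 2 * lm) ^+ 2 by rewrite /L; ring.
    exact: sqr_ge0.
  by rewrite ler_peMr // -addrA lerDl addr_ge0 // divr_ge0 // mulr_ge0.
have [_ _ h4 _] := zbounds.
have h2 : a * ln nn <= a / eps * z.
  by rewrite -mulrA [_^-1 * z]mulrC ler_wpM2l ?(ltW a0) // lnz.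
have h3 : (1 - 4 * L) <= a / eps * z * (4 * L).
  have p4 : 0 < 4 * L by apply: mulr_gt0.
  by rewrite -ler_pdivrMr //; apply: le_trans h1 h2.
have h5 : 1 <= L * (4 * (1 + a / eps) * z).
  apply: (@le_trans _ _ (4 * L + a / eps * z * (4 * L))); first by lra.
  have -> : L * (4 * (1 + a / eps) * z) = 4 * L * z + a / eps * z * (4 * L) by ring.
  by rewrite lerD2r ler_peMr //; apply: mulr_ge0 => //; exact: ltW.
apply: le_trans h5 _; rewrite mulrC ler_wpM2r ?(ltW L0) //.
by apply: le_trans w_gez; rewrite expr2 ler_wpM2r ?(ltW z0).
Qed.

Let mz : m%:R <= nn * z.
Proof. by apply: le_trans mn _; rewrite nD powRr1 // ltW. Qed.

Let nz : nn <= z ^+ 2 * m%:R.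
Proof.
apply: le_trans nm _.
rewrite powRD; last by rewrite (gt_eqF mpos) implybT.
rewrite powRr1 ?(ltW mpos) // mulrC ler_wpM2r ?(ltW mpos) //.
apply: (@le_trans _ _ ((nn * z) `^ eps)).
  by apply: ge0_ler_powR; rewrite ?(ltW e0) ?nnegrE ?mulr_ge0 ?(ltW z0) ?(ltW mpos) ?(ltW npos).
rewrite powRM ?(ltW npos) ?(ltW z0) // expr2 ler_wpM2l ?(ltW z0) //.
by apply: ler1_powR => //; move: e1 b0 e0; lra.
Qed.

Lemma scale_of : scale w u lm m n.
Proof.
split => //.
- by apply: le_trans z16 _; rewrite -[leLHS]expr1; apply: ler_weXn2l.
- by apply: le_trans w1200; apply: ler_weXn2l.
- by rewrite mulrC; apply: le_trans mz _; rewrite ler_wpM2l ?(ltW npos) // -[leLHS]expr1; apply: ler_weXn2l.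
- by apply: le_trans nz _; rewrite ler_wpM2r // ltW.
Qed.

Let dev_le (x : R) : x <= K * nn `^ (2^-1 + eps) -> x <= w * u + 0%:R.
Proof.
move=> h; apply: le_trans h _; rewrite nD -/u -/z addr0 mulrCA [w * u]mulrC ler_wpM2l ?(ltW u0) //.
apply: le_trans w_gez; rewrite expr2 ler_wpM2r ?(ltW z0) //; by case: zbounds.
Qed.

Lemma cls_of : cls w u lm 0 (inst_of D).
Proof.
split => //=.
- rewrite (lam_mn R m1 n1 tot) subrr normr0 //.
- by move=> j; rewrite (lam_n R n1); apply: dev_le.
- by move=> k; rewrite (lam_m R m1 n1 tot); apply: dev_le.
- by move=> j; rewrite hrow_of; apply: dev_le.
- by move=> k; rewrite hcol_of; apply: dev_le.
- rewrite forb_of addr0; apply: le_trans HX _.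
  rewrite nD powRr1 ?(ltW npos) // mulrCA [w * _]mulrC ler_wpM2l ?(ltW npos) //.
  have -> : nn `^ (2 * eps) = z ^+ 2 by rewrite zX mulrC.
  by rewrite /w [z ^+ 3]exprS ler_wpM2r ?exprn_ge0 ?(ltW z0) //; case: zbounds.
Qed.

(** Amounts to [16 * ln n <= w], the origin of the term [16 / eps] in [big]. *)
Let tail : u ^+ 4 * expR (- (w / 8)) <= 1.
Proof.
rewrite expRN ler_pdivrMr ?expR_gt0 // mul1r.
have -> : u ^+ 4 = nn ^+ 2 by rewrite -u2 -exprM.
rewrite -[nn](@lnK R) ?posrE // -expRM_natl ler_expR.
have [_ _ _ h4] := zbounds.
have h5 : 16 * ln nn <= 16 / eps * z.
  by rewrite -mulrA ler_wpM2l // mulrC lnz.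
have h6 : 16 / eps * z <= w.
  by apply: le_trans w_gez; rewrite expr2 ler_wpM2r ?(ltW z0).
by lra.
Qed.

Lemma formula_of : exists d : R, `|d| <= 1 * nn `^ (- b) /\
  (card_BstH D)%:R = main_term R D * expR (exponent_term R D + d).
Proof.
have tot0 : (\sum_j rs (inst_of D) j)%N%:R = lm * m%:R * n%:R by rewrite (lam_mn R m1 n1 tot).
have [ne hl] := formula scale_of w1200 tail cls_of tot0.
exists (lr lm (inst_of D)); split.
  (* [w ^+ 1112 / u] is [n] to the power [3336 eps - 1/2], and [e1] puts this exponent below
     [- b]. *)
  apply: le_trans hl _; rewrite mul1r exprN1 /w -exprM zX -powRN -nD.
  apply: ler_powR => //; have -> : ((3 * 1112)%N)%:R = 3336 :> R by [].
  by move: e1 e0 b0; lra.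
have M0 : 0 < mterm (inst_of D) :> R := mterm_gt0 scale_of cls_of tot0.
rewrite -(expo_of R m1 n1 tot) -main_of card_of /lr addrC subrK lnK.
  by rewrite mulrC divfK // gt_eqF.
by rewrite posrE divr_gt0 // ltr0n.
Qed.
End Large.

From mathcomp Require Import all_classical all_reals all_analysis.
Theorem theorem2p1 (R : realType) (a b : R) :
  0 < a -> 0 < b -> a + b < 2^-1 ->
  exists eps0 : R, 0 < eps0 /\
  forall eps : R, 0 < eps -> eps < eps0 ->
  forall D : nat -> bdata,
    (* data as in the context *)
    (forall N, (forall j, (0 < bs (D N) j)%N) /\ (forall k, (0 < bt (D N) k)%N)
               /\ stot (D N) = ttot (D N)) ->
    (* m, n -> oo *)
    (forall M : nat, exists N0, forall N, (N0 <= N)%N ->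
        (M <= bm (D N))%N /\ (M <= bn (D N))%N) ->
    (* uniform O-bounds *)
    (exists K : R, exists N0, forall N, (N0 <= N)%N ->
       (forall j, `|(bs (D N) j)%:R - savg R (D N)| <= K * (bn (D N))%:R `^ (2^-1 + eps))
    /\ (forall j, ((@hx (D N) j)%:R : R) <= K * (bn (D N))%:R `^ (2^-1 + eps))
    /\ (forall k, `|(bt (D N) k)%:R - tavg R (D N)| <= K * (bn (D N))%:R `^ (2^-1 + eps))
    /\ (forall k, ((@hy (D N) k)%:R : R) <= K * (bn (D N))%:R `^ (2^-1 + eps))
    /\ ((hX (D N))%:R : R) <= K * (bn (D N))%:R `^ (1 + 2 * eps)) ->
    (* n = o(m^{1+eps}) and m = o(n^{1+eps}) *)
    (forall e : R, 0 < e -> exists N0, forall N, (N0 <= N)%N ->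
        (bn (D N))%:R <= e * (bm (D N))%:R `^ (1 + eps)
     /\ (bm (D N))%:R <= e * (bn (D N))%:R `^ (1 + eps)) ->
    (* the lambda-condition (which presupposes A > 0) *)
    (exists N0, forall N, (N0 <= N)%N ->
       0 < AA R (D N) /\
       (1 - 2 * lam R (D N)) ^+ 2 / (8 * AA R (D N))
         * (1 + 5 * (bm (D N))%:R / (6 * (bn (D N))%:R)
              + 5 * (bn (D N))%:R / (6 * (bm (D N))%:R))
       <= a * ln ((bn (D N))%:R)) ->
    (* conclusion, with error term O(n^{-b}) *)
    exists K : R, exists N0, forall N, (N0 <= N)%N ->
      exists d : R, `|d| <= K * (bn (D N))%:R `^ (- b) /\
        (card_BstH (D N))%:R = main_term R (D N) * expR (exponent_term R (D N) + d).
Proof.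
(* Leaves room for both demands on eps: 3600 eps at most 1/2, for [w ^+ 1200 <= u], and 3336 eps at
   most 1/2 - b, for the final error. It is positive since [0 < a] and [a + b < 1/2] give
   [b < 1/2]. *)
move=> a0 b0 hab; exists ((2^-1 - b) / 7200).
have pos : 0 < (2^-1 - b) / 7200 by rewrite ltr_pdivlMr ?mul0r ?ltr0n //; lra.
split; first exact: pos.
move=> eps e0 he D hD hinf [K [N1 h1]] hmn [N2 h2].
have e1 : 7200 * eps <= 2^-1 - b by move: he; rewrite ltr_pdivlMr ?ltr0n // mulrC => /ltW.
have [n0 hn0] := powR_large (16 + `|K| + 4 * (1 + a / eps) + 16 / eps) e0.
have [N3 h3] := hinf n0.+1.
have [N4 h4] := hmn 1 ltr01.
exists 1, (N1 + N2 + N3 + N4)%N => N hN.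
have le1 : (N1 <= N)%N by apply: leq_trans hN; rewrite -!addnA leq_addr.
have le2 : (N2 <= N)%N by apply: leq_trans hN; rewrite -!addnA addnCA leq_addr.
have le3 : (N3 <= N)%N by apply: leq_trans hN; rewrite -addnA addnCA leq_addr.
have le4 : (N4 <= N)%N by apply: leq_trans hN; rewrite leq_addl.
have [p1 [p2 [p3 [p4 p5]]]] := h1 N le1.
have [q1 q2] := h2 N le2.
have [m1 n1] := h3 N le3.
have [r1 r2] := h4 N le4; rewrite !mul1r in r1 r2.
have [_ [_ tot]] := hD N.
have hz : 16 + `|K| + 4 * (1 + a / eps) + 16 / eps <= (bn (D N))%:R `^ eps.
  by apply: hn0; exact: ltnW.
exact: (formula_of a0 b0 e0 e1 (leq_trans (ltn0Sn _) m1) (leq_trans (ltn0Sn _) n1) tot hz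
  p1 p2 p3 p4 p5 r1 r2 q1 q2).
Qed.
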